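(* Let $K \subset \mathbb{R}^d$ be a smooth convex body, and for each positive integer $n$ let $K_n$ be the convex hull of $n$ points chosen independently and uniformly at random in $K$. Then there is an integer $n_K$ such that for all $n \ge n_K$, $$E[f_i(K_{n+1})] > E[f_i(K_n)], \qquad i = d-2,\ d-1.$$
   Context: A convex body is a compact convex set with nonempty interior. It is called smooth if its boundary is of differentiability class $C^2$ and has everywhere positive Gaussian curvature. For a polytope $P$, $f_i(P)$ denotes the number of $i$-dimensional faces of $P$. *)

(* Defs.v *)
From HB Require Import structures.
From mathcomp Require Import all_boot all_order all_algebra.
From mathcomp Require Import all_classical all_reals all_analysis.
Set Implicit Arguments. Unset Strict Implicit. Unset Printing Implicit Defensive.
Import Order.TTheory GRing.Theory Num.Theory.
Import numFieldNormedType.Exports.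
Local Open Scope classical_set_scope.
Local Open Scope ring_scope.

Section Defs.
Variable R : realType.

Definition dotv (d : nat) (u v : 'rV[R]_d) : R := (u *m v^T) 0 0.
Definition enorm (d : nat) (u : 'rV[R]_d) : R := Num.sqrt (dotv u u).

Definition convex_set (d : nat) (K : set 'rV[R]_d) : Prop :=
  forall x y, K x -> K y -> forall t : R, 0 <= t <= 1 -> K ((1 - t) *: x + t *: y).

Definition convex_body (d : nat) (K : set 'rV[R]_d) : Prop :=
  convex_set K /\ compact K /\ K° !=set0.

Definition evec (d : nat) (j : 'I_d) : 'rV[R]_d := delta_mx 0 j.

Definition partial (d : nat) (j : 'I_d) (g : 'rV[R]_d -> R) : 'rV[R]_d -> R :=
  fun x => 'D_(evec j) g x.

Definition C2_on (d : nat) (U : set 'rV[R]_d) (g : 'rV[R]_d -> R) : Prop :=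
  [/\ {within U, continuous g},
      (forall x, U x -> forall j, derivable g x (evec j)),
      (forall j, {within U, continuous (partial j g)}),
      (forall x, U x -> forall j k, derivable (partial j g) x (evec k)) &
      (forall j k, {within U, continuous (partial k (partial j g))})].

Definition gradient (d : nat) (g : 'rV[R]_d -> R) (p : 'rV[R]_d) : 'rV[R]_d :=
  \row_j partial j g p.

Definition hessian (d : nat) (g : 'rV[R]_d -> R) (p : 'rV[R]_d) : 'M[R]_d :=
  \matrix_(j, k) partial k (partial j g) p.

(* Gaussian curvature at p of the level hypersurface {g = 0} (with normal
   oriented by grad g), via the bordered-Hessian formula
   K = - det [[Hess g, (grad g)^T], [grad g, 0]] / |grad g|^(d+1). *)
Definition gauss_curvature (d : nat) (g : 'rV[R]_d -> R) (p : 'rV[R]_d) : R :=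
  - \det (block_mx (hessian g p) (gradient g p)^T (gradient g p) (0 : 'M[R]_1))
    / (enorm (gradient g p)) ^+ d.+1.

Definition smooth_convex_body (d : nat) (K : set 'rV[R]_d) : Prop :=
  convex_body K /\
  forall p, (closure K `\` K°) p ->
    exists (U : set 'rV[R]_d) (g : 'rV[R]_d -> R),
      [/\ open U, U p, C2_on U g,
          setI K U = [set x | U x /\ g x <= 0] &
          gradient g p != 0 /\ 0 < gauss_curvature g p].

(* The faces of conv{X_0,...,X_(n-1)} are exactly the sets conv{X_k | k in T}
   where T is nonempty and is the set of indices of points lying on a
   supporting hyperplane {x | <c,x> = b} (c = 0 allowed, giving the polytope
   itself); T and the face determine each other. *)
Definition face_index_set (d n : nat) (X : 'I_n -> 'rV[R]_d) (T : {set 'I_n}) : Prop :=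
  T != finset.set0 /\
  exists (c : 'rV[R]_d) (b : R),
    (forall k, dotv c (X k) <= b) /\ (forall k, (k \in T) <-> dotv c (X k) = b).

(* affine dimension of {X_k | k in T} (+1 = rank of the lifted points [X_k, 1]) *)
Definition affdim1 (d n : nat) (X : 'I_n -> 'rV[R]_d) (T : {set 'I_n}) : nat :=
  \rank (\matrix_(k < n) (if k \in T then row_mx (X k) (1 : 'rV[R]_1) else 0)).

Definition fnum (d n : nat) (X : 'I_n -> 'rV[R]_d) (i : nat) : nat :=
  #|[set T : {set 'I_n} | `[< face_index_set X T >] && (affdim1 X T == i.+1)%N]|.

(* For nonnegative integrands, by Tonelli this is the integral w.r.t.
   m-dimensional Lebesgue measure. *)
Fixpoint iint (m : nat) (F : seq R -> \bar R) : \bar R :=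
  match m with
  | 0 => F [::]
  | m'.+1 => (\int[@lebesgue_measure R]_(x in [set: R]) iint m' (fun s => F (x :: s)))%E
  end.

Definition point_of (d : nat) (s : seq R) : 'rV[R]_d := \row_j nth 0 s j.

Definition points_of (d n : nat) (s : seq R) : 'I_n -> 'rV[R]_d :=
  fun k => \row_j nth 0 s (k * d + j)%N.

Definition volume (d : nat) (K : set 'rV[R]_d) : \bar R :=
  iint d (fun s => ((\1_K (@point_of d s) : R))%:E).

Definition expected_fnum (d : nat) (K : set 'rV[R]_d) (n i : nat) : \bar R :=
  (iint (n * d) (fun s =>
     ((\prod_(k < n) (\1_K (@points_of d n s k) : R)) * (fnum (@points_of d n s) i)%:R)%:E)
   * ((volume K) ^+ n)^-1)%E.

End Defs.

(* Main.v *)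
Require Import Defs.
From HB Require Import structures.
From mathcomp Require Import all_boot all_order all_algebra.
From mathcomp Require Import all_classical all_reals all_analysis.
From mathcomp Require Import measurable_realfun ring lra zify.
From mathcomp Require fingroup perm.
Import Order.TTheory GRing.Theory Num.Theory.
Import numFieldNormedType.Exports.
Local Open Scope classical_set_scope.
Local Open Scope ring_scope.
Set Implicit Arguments. Unset Strict Implicit. Unset Printing Implicit Defensive.

(* Write D for the dimension and k = n - D. Almost surely the points are in general
   position, so every facet is a simplex, 2 f_(D-2) = D f_(D-1), and it suffices to
   treat facets: E f_(D-1)(K_n) = C(n, D) L_n / vol^n, where L_n integrates
   V_+^k + V_-^k over the D-tuples of points of K, V_+ and V_- being the volumes of
   the two parts of K cut off by the hyperplane through them. The claim becomes
   (k + 1) vol L_n < (n + 1) L_(n+1) for large n.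

   Planes of a fixed slope are parametrised by their depth t below the supporting
   plane of K. Since the boundary is C^2 with positive curvature, small caps are
   uniformly close to paraboloids, so that t -> nu^2 t with nu < 1 near 1 multiplies
   the cap volume V(t) by about nu^(D+1) and the density of planes by about
   nu^(D^2-1). This self-similarity is a substitute for the asymptotics of V: it
   yields (k + 1) vol Phi(k) <= (k + 1 + theta) Phi(k + 1) for the contribution Phi of
   the planes cutting off thin caps, where theta is close to (D^2 + 1) / (D + 1) < D. The other
   planes contribute an exponentially smaller amount. *)

(** * Integration over vectors and tuples of points *)

(** Origin of theta: substituting t -> lam t with lam = nu^2 in Phi(k + 1) bounds it below by kap
    times the integral of (vol - mu V)^(k + 1) over thin caps, kap being close to nu^(D^2 + 1) and
    mu to nu^(D + 1). Expanding at vol - V, the linear term (k + 1) (1 - mu) V (vol - V)^k is (k +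
    1) (1 - mu) (vol (vol - V)^k - (vol - V)^(k + 1)), so Phi(k) appears and theta = (1 / kap - 1) /
    (1 - mu). As n + 1 = (k + 1) + D, a surplus D - theta > 0 is left to absorb the thick caps.
    Thinness bounds the volume of a cap, not its depth, because the substitution respects the
    former: V(lam t) <= V(t). Only one-sided comparisons are needed, so maps that shrink sections
    slightly more than an exact paraboloid requires suffice, and compactness of the boundary makes
    them uniform over all slopes. A technical obstacle: the expectation is an iterated integral of
    the face number, whose measurability is not established beforehand; off fibrewise null sets it
    is replaced by a measurable sum over D-subsets. *)

Section gen_sigma.
Context (I T : Type) d (T' : measurableType d) (f : I -> T -> T').

Definition coord_sets : set (set T) :=
  [set A | exists i B, measurable B /\ A = f i @^-1` B].

Lemma coord_measurable i (B : set T') : measurable B ->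
  <<s coord_sets >> (f i @^-1` B).
Proof. by move=> mB; apply: sub_sigma_algebra; exists i, B. Qed.

(** Good-sets principle: the sets with measurable preimage form a sigma-algebra that contains the
    generators. *)
Lemma measurable_into_gen d1 (X : measurableType d1) (g : X -> T) (A : set T) :
  (forall i, measurable_fun setT (fun x => f i (g x))) ->
  <<s coord_sets >> A -> measurable (g @^-1` A).
Proof.
move=> mg; suff : <<s coord_sets >> `<=` [set A | measurable (g @^-1` A)] by apply.
apply: smallest_sub => [|_ [i [B [mB ->]]]] /=.
  split => [|B /= mB|F /= mF].
  - exact: measurable0.
  - by rewrite setTD; exact: measurableC.
  - by rewrite preimage_bigcup; exact: bigcupT_measurable.
by rewrite -comp_preimage -[X in measurable X]setTI; apply: mg.
Qed.

End gen_sigma.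

Fact mx_display : measure_display. Proof. by []. Qed.

Section mx_measurable.
Context (R : realType) (m n : nat).
Let co (ij : 'I_m * 'I_n) (M : 'M[R]_(m, n)) : R := M ij.1 ij.2.

(** The product sigma-algebra, so that measurability into matrices is checked entry by entry;
    [open_measurable_vec] shows that it contains the open sets of row vectors. *)
HB.instance Definition _ := @isMeasurable.Build mx_display 'M[R]_(m, n)
  <<s coord_sets co >> (@sigma_algebra0 _ setT _)
  (fun A => @sigma_algebraC _ _ A)
  (@sigma_algebra_bigcup _ setT _).

Lemma measurable_coord i j : measurable_fun setT (fun M : 'M[R]_(m, n) => M i j).
Proof.
by move=> _ B mB; rewrite setTI; apply: (@coord_measurable _ _ _ _ co (i, j)).
Qed.

Lemma measurable_into_mx d1 (X : measurableType d1) (g : X -> 'M[R]_(m, n)) :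
  (forall i j, measurable_fun setT (fun x => g x i j)) -> measurable_fun setT g.
Proof.
move=> mg _ B mB; rewrite setTI.
by apply: (@measurable_into_gen _ _ _ _ co) => // -[i j]; apply: mg.
Qed.

End mx_measurable.

Fact seq_display : measure_display. Proof. by []. Qed.

HB.instance Definition _ (T : choiceType) := isPointed.Build (seq T) [::].

Section seq_measurable.
Context (R : realType) (d : nat).
Local Notation E := 'rV[R]_d.
Let co (i : nat) (s : seq E) : E := nth 0 s i.

(** Sequences of all lengths carry one sigma-algebra, generated by the entries read with default
    [0]. This avoids types indexed by the number of points and keeps prepending a point
    measurable. *)
HB.instance Definition _ := @isMeasurable.Build seq_display (seq E)
  <<s coord_sets co >> (@sigma_algebra0 _ setT _)
  (fun A => @sigma_algebraC _ _ A)
  (@sigma_algebra_bigcup _ setT _).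

Lemma measurable_nth i : measurable_fun setT (fun s : seq E => nth 0 s i).
Proof.
by move=> _ B mB; rewrite setTI; apply: (@coord_measurable _ _ _ _ co i).
Qed.

Lemma measurable_into_seq d1 (X : measurableType d1) (g : X -> seq E) :
  (forall i, measurable_fun setT (fun x => nth 0 (g x) i)) -> measurable_fun setT g.
Proof.
move=> mg _ B mB; rewrite setTI.
by apply: (@measurable_into_gen _ _ _ _ co) => // i; apply: mg.
Qed.

End seq_measurable.

Definition pushm d1 d2 (T1 : measurableType d1) (T2 : measurableType d2)
    (R : realType) (m : {measure set T1 -> \bar R}) (f : T1 -> T2)
    (mf : measurable_fun setT f) : {measure set T2 -> \bar R} :=
  measure_function_pushforward__canonical__measure_function_Measure m mf.

Lemma integral_pushm d1 d2 (T1 : measurableType d1) (T2 : measurableType d2)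
    (R : realType) (m : {measure set T1 -> \bar R}) (f : T1 -> T2)
    (mf : measurable_fun setT f) (G : T2 -> \bar R) :
  measurable_fun setT G -> (forall y, 0 <= G y)%E ->
  (\int[pushm m mf]_y G y = \int[m]_x G (f x))%E.
Proof.
move=> mG G0.
exact: (ge0_integral_pushforward mf m measurableT mG (fun y _ => G0 y)).
Qed.

(** A pushforward need not stay sigma-finite; the left inverse [g] transports a cover by sets of
    finite measure to the target. *)
Lemma sigma_finite_pushforward d1 d2 (T1 : measurableType d1)
    (T2 : measurableType d2) (R : realType)
    (m : {sigma_finite_measure set T1 -> \bar R}) (f : T1 -> T2) (g : T2 -> T1) :
  measurable_fun setT f -> measurable_fun setT g -> cancel f g ->
  exists nu : {sigma_finite_measure set T2 -> \bar R},
    forall A, nu A = m (f @^-1` A).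
Proof.
move=> mf mg fK.
pose nu := pushm m mf.
have sf : sigma_finite setT nu.
  have [F FT mF] := sigma_finiteT m.
  exists (fun i => g @^-1` F i).
    by rewrite -preimage_bigcup -FT.
  move=> i; have [mFi Foo] := mF i; split.
    by rewrite -[X in measurable X]setTI; apply: mg.
  rewrite /nu/= /pushforward/= -comp_preimage (_ : g \o f = id) //.
  by apply/funext => x /=; rewrite fK.
pose nus : {sigma_finite_measure set T2 -> \bar R} :=
  HB.pack (Measure.sort nu) (Measure_isSigmaFinite.Build _ _ _ (Measure.sort nu) sf).
by exists nus.
Qed.

(* The canonical sigma-finite structure on [m1 \x m2] is shadowed in the
   library by the one for products of subprobabilities. *)
Section product_sigma_finite.
Context d1 d2 (T1 : measurableType d1) (T2 : measurableType d2) (R : realType).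
Variable m1 : {sigma_finite_measure set T1 -> \bar R}.
Variable m2 : {sigma_finite_measure set T2 -> \bar R}.

Lemma sigma_finite_product : sigma_finite setT (m1 \x m2)%E.
Proof.
have /sigma_finiteP[F [TF ndF Foo]] := sigma_finiteT m1.
have /sigma_finiteP[G [TG ndG Goo]] := sigma_finiteT m2.
exists (fun n => F n `*` G n).
  rewrite -setXTT TF TG predeqE => -[x y]; split; last first.
    by move=> [n _ []/= ? ?]; split; exists n.
  move=> [/= [n _ Fnx] [k _ Gky]]; exists (maxn n k) => //; split.
  - by move: x Fnx; exact/subsetPset/ndF/leq_maxl.
  - by move: y Gky; exact/subsetPset/ndG/leq_maxr.
move=> k; have [? ?] := Foo k; have [? ?] := Goo k.
split; first exact: measurableX.
by rewrite product_measure1E// lte_mul_pinfty// ge0_fin_numE.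
Qed.

Definition prod_sf : {sigma_finite_measure set (T1 * T2)%type -> \bar R} :=
  HB.pack (product_measure1 m1 m2)
    (Measure_isSigmaFinite.Build _ _ _ (product_measure1 m1 m2) sigma_finite_product).

End product_sigma_finite.

(** * Lebesgue measure on row vectors and on tuples of points *)

Section vector_measure.
Variable R : realType.
Local Notation leb := (@lebesgue_measure R).

Definition cons_row d (p : R * 'rV[R]_d) : 'rV[R]_d.+1 :=
  row_mx (p.1%:M : 'rV_1) p.2.
Definition uncons_row d (v : 'rV[R]_d.+1) : R * 'rV[R]_d :=
  (v 0 0, @rsubmx _ 1 1 d v).

Lemma cons_row0 d p : @cons_row d p 0 0 = p.1.
Proof.
rewrite /cons_row; have -> : (0 : 'I_(1 + d)) = lshift d 0 by exact/val_inj.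
by rewrite (@row_mxEl R 1 1 d) mxE eqxx mulr1n.
Qed.

Lemma cons_rowS d p j : @cons_row d p 0 (lift ord0 j) = p.2 0 j.
Proof.
rewrite /cons_row; have -> : lift ord0 j = rshift 1 j :> 'I_(1 + d) by exact/val_inj.
by rewrite (@row_mxEr R 1 1 d).
Qed.

Lemma measurable_cons_row d : measurable_fun setT (@cons_row d).
Proof.
apply: measurable_into_mx => i j; rewrite (ord1 i).
have [->|[k ->]] : j = ord0 \/ exists k, j = lift ord0 k.
  by case: (unliftP ord0 j) => [k ->|->]; [right; exists k|left].
- by under eq_fun do rewrite cons_row0; exact: measurable_fst.
- under eq_fun do rewrite cons_rowS.
  exact: (measurableT_comp (@measurable_coord R 1 d 0 k) measurable_snd).
Qed.

Lemma measurable_uncons_row d : measurable_fun setT (@uncons_row d).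
Proof.
apply: measurable_fun_pair; first exact: measurable_coord.
apply: measurable_into_mx => i j.
by under eq_fun do rewrite mxE; exact: measurable_coord.
Qed.

Lemma cons_rowK d : cancel (@cons_row d) (@uncons_row d).
Proof.
move=> [x v]; rewrite /uncons_row; congr (_, _); first exact: cons_row0.
by rewrite /cons_row /= row_mxKr.
Qed.

(** Gives the iterated integral [iint] a genuine sigma-finite measure, so that Tonelli and
    pushforwards apply. It is built one coordinate at a time as the image of a product under
    [cons_row]; Tonelli for that product identifies the integral. *)
Lemma row_vec_measure d : exists nu : {sigma_finite_measure set 'rV[R]_d -> \bar R},
  forall G : 'rV[R]_d -> \bar R, measurable_fun setT G -> (forall v, 0 <= G v)%E ->
  (\int[nu]_v G v)%E = iint d (fun s => G (point_of d s)).
Proof.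
elim: d => [|d [nu IH]].
  have sf : sigma_finite setT (dirac (0 : 'rV[R]_0) : {measure set _ -> \bar R}).
    exact: sigma_finiteT.
  pose nu : {sigma_finite_measure set 'rV[R]_0 -> \bar R} := dirac (0 : 'rV[R]_0).
  exists nu => G mG G0 /=.
  rewrite integral_dirac// diracT mul1e; congr G.
  by apply/rowP => -[].
have [nu' nu'E] := sigma_finite_pushforward
   (prod_sf leb nu) (@measurable_cons_row d)
   (@measurable_uncons_row d) (@cons_rowK d).
exists nu' => G mG G0 /=.
have mG' : measurable_fun setT (fun p => G (@cons_row d p)).
  exact: (measurableT_comp mG (@measurable_cons_row d)).
transitivity (\int[(leb \x nu)]_p G (@cons_row d p))%E.
  pose nu2 := pushm (leb \x nu)%E (@measurable_cons_row d).
  rewrite (eq_measure_integral nu2); last by move=> A mA _; exact: nu'E.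
  exact: integral_pushm.
rewrite fubini_tonelli1//; apply: eq_integral => x _.
rewrite /fubini_F IH//=; last first.
  by apply: (measurableT_comp mG'); exact: measurable_pair1.
congr (iint d _); apply/funext => s; congr G.
apply/rowP => j.
have [->|[k ->]] : j = ord0 \/ exists k, j = lift ord0 k.
  by case: (unliftP ord0 j) => [k ->|->]; [right; exists k|left].
- by rewrite cons_row0 mxE.
- by rewrite cons_rowS !mxE.
Qed.

Definition vmu d := projT1 (cid (row_vec_measure d)).

End vector_measure.

Section points_measure.
Variables (R : realType) (d : nat).
Local Notation E := 'rV[R]_d.

Lemma vmuE (G : E -> \bar R) : measurable_fun setT G -> (forall v, 0 <= G v)%E ->
  (\int[vmu R d]_v G v)%E = iint d (fun s => G (point_of d s)).
Proof. by rewrite /vmu; case: cid => nu /= + mG G0 => ->. Qed.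

Definition cons_seq (p : E * seq E) : seq E := p.1 :: p.2.
Definition uncons_seq (s : seq E) : E * seq E := (nth 0 s 0, behead s).

Lemma measurable_cons_seq : measurable_fun setT cons_seq.
Proof.
apply: measurable_into_seq => -[|i]; first exact: measurable_fst.
exact: (measurableT_comp (measurable_nth i) measurable_snd).
Qed.

Lemma measurable_behead : measurable_fun setT (@behead E).
Proof.
by apply: measurable_into_seq => i; under eq_fun do rewrite nth_behead; exact: measurable_nth.
Qed.

Lemma measurable_uncons_seq : measurable_fun setT uncons_seq.
Proof.
by apply: measurable_fun_pair; [exact: (measurable_nth 0)|exact: measurable_behead].
Qed.

Lemma cons_seqK : cancel cons_seq uncons_seq. Proof. by case. Qed.

Fixpoint pint (n : nat) (F : seq E -> \bar R) : \bar R :=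
  if n is n'.+1 then iint d (fun s => pint n' (fun xs => F (point_of d s :: xs)))
  else F [::].

Lemma seq_measure n : exists nu : {sigma_finite_measure set (seq E) -> \bar R},
  forall G : seq E -> \bar R, measurable_fun setT G -> (forall v, 0 <= G v)%E ->
  (\int[nu]_v G v)%E = pint n G.
Proof.
elim: n => [|n [nu IH]].
  pose nu : {sigma_finite_measure set (seq E) -> \bar R} := dirac ([::] : seq E).
  exists nu => G mG G0 /=.
  by rewrite integral_dirac// diracT mul1e.
have [nu' nu'E] := sigma_finite_pushforward
   (prod_sf (vmu R d) nu)
   measurable_cons_seq measurable_uncons_seq cons_seqK.
exists nu' => G mG G0 /=.
have mG' : measurable_fun setT (fun p => G (cons_seq p)).
  exact: (measurableT_comp mG measurable_cons_seq).
transitivity (\int[(vmu R d \x nu)]_p G (cons_seq p))%E.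
  pose nu2 := pushm (vmu R d \x nu)%E measurable_cons_seq.
  rewrite (eq_measure_integral nu2); last by move=> A mA _; exact: nu'E.
  exact: integral_pushm.
have mF := @measurable_fun_fubini_tonelli_F _ _ _ _ _ nu _ mG' (fun=> G0 _).
rewrite fubini_tonelli1// vmuE//; last first.
  by move=> v; exact: integral_ge0.
congr (iint d _); apply/funext => s.
rewrite /fubini_F IH//=.
by apply: (measurableT_comp mG'); exact: measurable_pair1.
Qed.

Definition pmu n := projT1 (cid (seq_measure n)).

Lemma pmuE n (G : seq E -> \bar R) : measurable_fun setT G -> (forall v, 0 <= G v)%E ->
  (\int[pmu n]_v G v)%E = pint n G.
Proof. by rewrite /pmu; case: cid => nu /= + mG G0 => ->. Qed.

Lemma measurable_cons_l (x : E) : measurable_fun setT (cons x).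
Proof.
rewrite (_ : cons x = cons_seq \o pair x)//.
by apply: (measurableT_comp measurable_cons_seq); exact: measurable_pair1.
Qed.

Lemma pmu0E (G : seq E -> \bar R) : measurable_fun setT G -> (forall v, 0 <= G v)%E ->
  (\int[pmu 0]_v G v)%E = G [::].
Proof. by move=> *; rewrite pmuE. Qed.

Lemma measurable_pmu_section n (G : seq E -> \bar R) :
  measurable_fun setT G -> (forall v, 0 <= G v)%E ->
  measurable_fun setT (fun x : E => \int[pmu n]_xs G (x :: xs))%E.
Proof.
move=> mG G0; have mG' : measurable_fun setT (fun p => G (cons_seq p)).
  exact: (measurableT_comp mG measurable_cons_seq).
exact: (@measurable_fun_fubini_tonelli_F _ _ _ _ _ (pmu n) _ mG' (fun=> G0 _)).
Qed.

Lemma pmuS n (G : seq E -> \bar R) : measurable_fun setT G -> (forall v, 0 <= G v)%E ->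
  (\int[pmu n.+1]_v G v = \int[vmu R d]_x \int[pmu n]_xs G (x :: xs))%E.
Proof.
move=> mG G0; rewrite pmuE//= vmuE; first last.
- by move=> v; exact: integral_ge0.
- exact: measurable_pmu_section.
congr (iint d _); apply/funext => s; rewrite pmuE//.
exact: (measurableT_comp mG (measurable_cons_l _)).
Qed.

Lemma iint_cat a b (F : seq R -> \bar R) :
  iint (a + b) F = iint a (fun s => iint b (fun t => F (s ++ t))).
Proof. by elim: a F => //= a IH F; apply: eq_integral => x _; rewrite IH. Qed.

Lemma eq_iint m (F G : seq R -> \bar R) : (forall s, size s = m -> F s = G s) ->
  iint m F = iint m G.
Proof.
elim: m F G => [|m IH] F G FG /=; first exact: FG.
by apply: eq_integral => x _; apply: IH => s sm; apply: FG; rewrite /= sm.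
Qed.

(** A pure regrouping of the [n * d] nested scalar integrals by points, valid for every [F]. *)
Lemma iint_pint n (F : ('I_n -> E) -> \bar R) :
  iint (n * d) (fun s => F (@points_of R d n s)) =
  pint n (fun xs => F (fun k : 'I_n => nth 0 xs k)).
Proof.
(* The induction on [n] needs an integrand defined on sequences, since prepending a point to a
   function on ['I_n] changes its type. *)
have gen (G : seq E -> \bar R) : iint (n * d) (fun s =>
    G [seq \row_j nth 0 s (k * d + j)%N | k <- iota 0 n]) = pint n G.
  elim: n {F} G => [//|n IH] G; rewrite mulSn iint_cat /=.
  apply: eq_iint => s sd; rewrite -IH; apply: eq_iint => t td.
  congr (G (_ :: _)).
    by apply/rowP => j; rewrite !mxE mul0n add0n nth_cat sd ltn_ord.
  rewrite -[1%N]addn0 iotaDl -map_comp; apply: eq_map => k /=.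
  apply/rowP => j; rewrite !mxE nth_cat sd.
  by rewrite mulnDl mul1n -addnA ltnNge leq_addr/= addKn.
rewrite -gen; apply: eq_iint => s _; congr F; apply/funext => k.
by rewrite /points_of (nth_map 0%N) ?size_iota// nth_iota.
Qed.

End points_measure.

(** * Exceptional sets of iterated integrals *)

Section null_sets.
Variable R : realType.
Import HBNNSimple.
Local Notation leb := (@lebesgue_measure R).

Lemma ae_imp d (T : measurableType d) (mu : {measure set T -> \bar R})
    (P Q : T -> Prop) : (forall x, P x -> Q x) ->
  {ae mu, forall x, P x} -> {ae mu, forall x, Q x}.
Proof. exact: (@filterS _ _ (ae_filter_ringOfSetsType mu)). Qed.

Lemma ae_and d (T : measurableType d) (mu : {measure set T -> \bar R})
    (P Q : T -> Prop) : {ae mu, forall x, P x} -> {ae mu, forall x, Q x} ->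
  {ae mu, forall x, P x /\ Q x}.
Proof. exact: (@filterI _ _ (ae_filter_ringOfSetsType mu)). Qed.

(** Holds for arbitrary nonnegative functions: the integral is a supremum over simple functions
    below [f], and these can be set to zero on [N] without changing their integrals. This is what
    allows the face number as an integrand. *)
Lemma le_integral_off_null d (T : measurableType d) (mu : {measure set T -> \bar R})
    (N : set T) (f g : T -> \bar R) :
  measurable N -> mu N = 0%E -> (forall x, 0 <= f x)%E -> (forall x, 0 <= g x)%E ->
  (forall x, ~ N x -> f x = g x) ->
  (\int[mu]_x f x <= \int[mu]_x g x)%E.
Proof.
move=> mN N0 f0 g0 fg; rewrite ge0_integralTE//.
apply: ge_ereal_sup => _ [h /= hf <-].
pose k := mul_nnsfun h (indic_nnsfun R (measurableC mN)).
have -> : sintegral mu h = sintegral mu k.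
  rewrite -!integralT_nnsfun; apply: ge0_ae_eq_integral => //.
  - exact/measurable_EFinP.
  - exact/measurable_EFinP.
  - by move=> x _; rewrite lee_fin.
  - by move=> x _; rewrite lee_fin.
  - exists N; split => // x /= /not_implyP[_]; apply: contra_notP => Nx.
    by rewrite /k/= /mindic/= indicE mem_set// mulr1.
rewrite ge0_integralTE//; apply: ereal_sup_ubound.
exists k => //= x; rewrite /mindic/= indicE.
have [Nx|/negP Nx] := boolP (x \in ~` N).
  by rewrite mulr1 -fg//; rewrite inE in Nx.
by rewrite mulr0.
Qed.

Lemma eq_integral_ae_nonmeas d (T : measurableType d) (mu : {measure set T -> \bar R})
    (f g : T -> \bar R) :
  (forall x, 0 <= f x)%E -> (forall x, 0 <= g x)%E ->
  {ae mu, forall x, f x = g x} -> (\int[mu]_x f x = \int[mu]_x g x)%E.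
Proof.
move=> f0 g0 [N [mN N0 sN]].
have fg x : ~ N x -> f x = g x by move=> Nx; apply: contra_notP Nx => ?; exact: sN.
apply/eqP; rewrite eq_le; apply/andP; split.
  by apply: (@le_integral_off_null _ _ _ N).
by apply: (@le_integral_off_null _ _ _ N) => // x Nx; rewrite fg.
Qed.

(* [iint] is an iterated integral, so exceptional sets are null fibrewise. *)
Fixpoint inull (m : nat) (N : seq R -> Prop) : Prop :=
  if m is m'.+1 then {ae leb, forall x, inull m' (fun s => N (x :: s))}
  else ~ N [::].

Lemma sub_inull m (N N' : seq R -> Prop) : (forall s, N' s -> N s) ->
  inull m N -> inull m N'.
Proof.
elim: m N N' => [|m IH] N N' NN' /=; first by move=> + /NN'.
apply: ae_imp => x; apply: IH => s; exact: NN'.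
Qed.

Lemma inullU m (N N' : seq R -> Prop) : inull m N -> inull m N' ->
  inull m (fun s => N s \/ N' s).
Proof.
elim: m N N' => [|m IH] N N' /=; first by move=> ? ? [].
move=> n1 n2; apply: ae_imp (ae_and n1 n2) => x []; exact: IH.
Qed.

Lemma inull_false m : inull m (fun=> False).
Proof. by elim: m => [|m IH] //=; apply: aeW => x. Qed.

Lemma inull_exists m (I : finType) (N : I -> seq R -> Prop) :
  (forall i, inull m (N i)) -> inull m (fun s => exists i, N i s).
Proof.
move=> Ni.
suff : inull m (fun s => exists2 i, i \in enum I & N i s).
  by apply: sub_inull => s [i]; exists i => //; rewrite mem_enum.
elim: (enum I) => [|i l IH]; first by apply: sub_inull (inull_false m) => s [].
apply: sub_inull (inullU (Ni i) IH) => s [j]; rewrite inE => /predU1P[->|jl] Nj.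
  by left.
by right; exists j.
Qed.

Lemma iint_ge0 m (F : seq R -> \bar R) : (forall s, 0 <= F s)%E -> (0 <= iint m F)%E.
Proof. by elim: m F => //= m IH F F0; apply: integral_ge0 => x _; exact: IH. Qed.

Lemma eq_iint_inull m (N : seq R -> Prop) (F G : seq R -> \bar R) :
  (forall s, 0 <= F s)%E -> (forall s, 0 <= G s)%E ->
  (forall s, ~ N s -> F s = G s) -> inull m N -> iint m F = iint m G.
Proof.
elim: m N F G => [|m IH] N F G F0 G0 FG /=; first exact: FG.
move=> Nn; apply: eq_integral_ae_nonmeas => [x|x|].
- exact: iint_ge0.
- exact: iint_ge0.
- by apply: ae_imp Nn => x; apply: IH => // s; exact: FG.
Qed.

Fixpoint maff (m : nat) (f : seq R -> R) : Prop :=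
  if m is m'.+1 then (forall s, exists a b, forall x, f (x :: s) = a + b * x) /\
    (forall x, maff m' (fun s => f (x :: s)))
  else True.

Lemma maffP m (f : seq R -> R) :
  (forall p s, exists a b, forall x, f (p ++ x :: s) = a + b * x) -> maff m f.
Proof.
elim: m f => //= m IH f fP; split => [s|x]; first exact: (fP [::]).
by apply: IH => p s; exact: (fP (x :: p)).
Qed.

(** With the tail of the witness [s0] frozen, [f] is a nonzero affine function of the first
    variable, hence nonzero for all but at most one value of it. For each such value the same tail
    witnesses that the remaining function is not identically zero, and induction applies. *)
Lemma maff_inull m (f : seq R -> R) s0 : maff m f -> size s0 = m -> f s0 != 0 ->
  inull m (fun s => f s = 0).
Proof.
elim: m f s0 => [|m IH] f [|x0 s1]//=; first by move=> _ _ /eqP.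
move=> [fa fm] [s1m] f0; have [a [b fab]] := fa s1.
have : {ae leb, forall x, f (x :: s1) != 0}.
  have [b0|b0] := eqVneq b 0.
    apply: aeW => x; apply: contraNneq f0; by rewrite !fab b0 !mul0r => ->.
  exists [set - a / b]; split => //; first exact: lebesgue_measure_set1.
  move=> x /= /negP; rewrite negbK fab => /eqP abx.
  apply: (mulIf b0); rewrite divfK// mulrC; lra.
by apply: ae_imp => x fx; apply: (IH _ s1).
Qed.

Lemma points_of_surj d n (X : 'I_n -> 'rV[R]_d.+1) :
  exists2 s, size s = (n * d.+1)%N & @points_of R d.+1 n s = X.
Proof.
case: n X => [|n] X; first by exists [::] => //; apply/funext => -[].
(* Coordinate [j] of point [k] sits at position [k * d.+1 + j]; quotient and remainder by [d.+1]
   recover both indices. *)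
exists (mkseq (fun t => X (inord (t %/ d.+1)) 0 (inord (t %% d.+1))) (n.+1 * d.+1)).
  by rewrite size_mkseq.
apply/funext => k; apply/rowP => j; rewrite mxE nth_mkseq; last first.
  have := ltn_ord k; have := ltn_ord j; nia.
rewrite divnMDl// modnMDl divn_small// modn_small// addn0.
by rewrite !inord_val.
Qed.

(** Each scalar coordinate belongs to one point, and injectivity of [sig] puts that point in at most
    one row. As [L] is affine in the point, the determinant is affine in each coordinate, and a
    single configuration where it is nonzero suffices. *)
Lemma det_points_inull d n q (sig : 'I_q -> 'I_n) (L : 'I_q -> 'rV[R]_d.+1 -> R) :
  injective sig ->
  (forall j v w t, L j ((1 - t) *: v + t *: w) = (1 - t) * L j v + t * L j w) ->
  (exists X : 'I_n -> 'rV[R]_d.+1, \det (\matrix_(i, j) L j (X (sig i))) != 0) ->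
  inull (n * d.+1) (fun s =>
    \det (\matrix_(i, j) L j (@points_of R d.+1 n s (sig i))) = 0).
Proof.
move=> sinj Laff [X0 X0P]; have [s0 s0n s0X] := points_of_surj X0.
apply: (@maff_inull _ _ s0) => //; last by rewrite s0X.
apply: maffP => p s.
pose M x := \matrix_(i, j) L j (@points_of R d.+1 n (p ++ x :: s) (sig i)).
have ptE x k : @points_of R d.+1 n (p ++ x :: s) k =
    (1 - x) *: @points_of R d.+1 n (p ++ 0 :: s) k +
    x *: @points_of R d.+1 n (p ++ 1 :: s) k.
  apply/rowP => j; rewrite !mxE !nth_cat; case: ltnP => ?; first by ring.
  by case: (_ - _)%N => [|t] /=; ring.
have ptE' x k : (nat_of_ord k != size p %/ d.+1)%N ->
    @points_of R d.+1 n (p ++ x :: s) k = @points_of R d.+1 n (p ++ 0 :: s) k.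
  move=> kp; apply/rowP => j; rewrite !mxE !nth_cat; case: ltnP => // pk.
  case E : (_ - _)%N => [|t] //; exfalso; move/eqP: kp; apply.
  have -> : size p = (k * d.+1 + j)%N.
    by move: pk E; set u := (_ + _)%N => ? /eqP; rewrite subn_eq0 => ?; apply/eqP; rewrite eqn_leq; apply/andP.
  by rewrite divnMDl// divn_small// addn0.
(* Either the point owning the varied coordinate, of index [size p %/ d.+1], occurs in a row [i0],
   or the determinant does not depend on that coordinate. *)
have [[i0 i0P]|noi] := pselect (exists i0, nat_of_ord (sig i0) = size p %/ d.+1)%N.
  have nz i : nat_of_ord (sig (lift i0 i)) != (size p %/ d.+1)%N.
    apply/eqP => e; have /sinj/eqP : sig (lift i0 i) = sig i0.
      by apply/val_inj; rewrite /= e -i0P.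
    by rewrite eq_sym (negbTE (neq_lift _ _)).
  exists (\det (M 0)), (\det (M 1) - \det (M 0)) => x.
  have -> : \det (M x) = (1 - x) * \det (M 0) + x * \det (M 1).
    apply: (@determinant_multilinear _ _ _ _ _ i0).
    - by apply/rowP => j; rewrite !mxE ptE Laff.
    - by apply/matrixP => i j; rewrite !mxE (ptE' x _ (nz i)).
    - by apply/matrixP => i j; rewrite !mxE (ptE' x _ (nz i)) (ptE' 1 _ (nz i)).
  by ring.
exists (\det (M 0)), 0 => x; rewrite mul0r addr0; congr (\det _).
apply/matrixP => i j; rewrite !mxE ptE'//.
by apply/eqP => e; apply: noi; exists i.
Qed.

End null_sets.

(** * Tonelli and affine changes of variables *)

Section tonelli.
Context d1 d2 (T1 : measurableType d1) (T2 : measurableType d2) (R : realType).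
Variables (m1 : {sigma_finite_measure set T1 -> \bar R})
          (m2 : {sigma_finite_measure set T2 -> \bar R}).
Variable G : T1 * T2 -> \bar R.
Hypotheses (mG : measurable_fun setT G) (G0 : forall p, (0 <= G p)%E).

Lemma measurable_integral_param : measurable_fun setT (fun x => \int[m2]_y G (x, y))%E.
Proof. exact: (@measurable_fun_fubini_tonelli_F _ _ _ _ _ m2 _ mG G0). Qed.

Lemma tonelli_swap :
  (\int[m1]_x \int[m2]_y G (x, y) = \int[m2]_y \int[m1]_x G (x, y))%E.
Proof. exact: (@fubini_tonelli _ _ _ _ _ m1 m2 _ mG G0). Qed.

End tonelli.

Lemma integral_scale d1 (T1 : measurableType d1) (R : realType)
    (mu : {measure set T1 -> \bar R}) (c : R) (G : T1 -> \bar R) :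
  measurable_fun setT G -> (forall x, 0 <= G x)%E -> 0 <= c ->
  (c%:E * \int[mu]_x G x = \int[mu]_x (c%:E * G x))%E.
Proof. by move=> mG G0 c0; rewrite ge0_integralZl_EFin. Qed.

Lemma measurable_EFinR (R : realType) (phi : R -> R) : measurable_fun setT phi ->
  measurable_fun [set: measurableTypeR R] (fun x => (phi x)%:E).
Proof. by move=> mphi; exact: (@measurableT_comp _ _ _ _ _ _ EFin _ phi). Qed.

Lemma measurable_section_l d1 d2 (T1 : measurableType d1) (T2 : measurableType d2)
    d3 (T3 : measurableType d3) (G : T1 * T2 -> T3) x :
  measurable_fun setT G -> measurable_fun setT (fun y => G (x, y)).
Proof. by move=> mG; apply: (measurableT_comp mG); exact: measurable_pair1. Qed.

Section affine_line.
Variable R : realType.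
Local Notation leb := (@lebesgue_measure R).

(** Lebesgue measure is determined by its values on half-open intervals, so it suffices to measure
    their preimages; for negative [a] the closed end changes side. *)
Lemma leb_affine (a b : R) (F : R -> \bar R) : a != 0 -> measurable_fun setT F ->
  (forall x, 0 <= F x)%E ->
  (\int[leb]_z F z = (`|a|)%:E * \int[leb]_z F (a * z + b)%R)%E.
Proof.
move=> a0 mF F0.
have mf : measurable_fun [set: measurableTypeR R]
    ((fun z => a * z + b) : measurableTypeR R -> measurableTypeR R).
  by apply: measurable_funD => //; apply: measurable_funM.
pose mu := pushm leb mf.
pose k : {nonneg R} := NngNum (normr_ge0 a).
transitivity (\int[mscale k mu]_z F z)%E; last first.
  by rewrite ge0_integral_mscale// integral_pushm.
apply: (eq_measure_integral (mscale k mu)) => A mA _.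
apply: (lebesgue_measure_unique _ mA) => _ [[x y] _ <-] /=.
rewrite /mscale/= /pushm/= /pushforward/=.
have -> : (fun z : R => a * z + b) @^-1` `]x, y] =
    if 0 < a then `](x - b) / a, (y - b) / a]%classic
    else `[(y - b) / a, (x - b) / a[%classic.
  apply/seteqP; split => z; case: ifPn => [a1|]; rewrite /= ?in_itv/=.
  - by rewrite ltr_pdivrMr// ler_pdivlMr// [_ * a]mulrC ltrBlDr lerBrDr.
  - rewrite -leNgt => a1; have a2 : a < 0 by rewrite lt_neqAle a0.
    by rewrite ltr_ndivlMr// ler_ndivrMr// [_ * a]mulrC ltrBlDr lerBrDr andbC.
  - by rewrite ltr_pdivrMr// ler_pdivlMr// [_ * a]mulrC ltrBlDr lerBrDr.
  - rewrite -leNgt => a1; have a2 : a < 0 by rewrite lt_neqAle a0.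
    by rewrite ltr_ndivlMr// ler_ndivrMr// [_ * a]mulrC ltrBlDr lerBrDr andbC.
case: ifPn => [a1|].
  rewrite !lebesgue_measure_itv/= !lte_fin ltr_pM2r ?invr_gt0// ltrD2r.
  case: ifPn => xy; last by rewrite mule0.
  by rewrite -!EFinB -EFinM gtr0_norm//; congr EFin; field.
rewrite -leNgt => a1; have a2 : a < 0 by rewrite lt_neqAle a0.
rewrite !lebesgue_measure_itv/= !lte_fin ltr_nM2r ?invr_lt0// ltrD2r.
case: ifPn => xy; last by rewrite mule0.
by rewrite -!EFinB -EFinM ltr0_norm//; congr EFin; field.
Qed.

End affine_line.

Section vector_integrals.
Variable R : realType.
Local Notation leb := (@lebesgue_measure R).

Lemma vmu0 (G : 'rV[R]_0 -> \bar R) : measurable_fun setT G -> (forall v, 0 <= G v)%E ->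
  (\int[vmu R 0]_v G v)%E = G 0.
Proof. by move=> mG G0; rewrite vmuE//=; congr G; apply/rowP => -[]. Qed.

Lemma vmuS d (G : 'rV[R]_d.+1 -> \bar R) : measurable_fun setT G -> (forall v, 0 <= G v)%E ->
  (\int[vmu R d.+1]_v G v = \int[leb]_x \int[vmu R d]_v G (cons_row (x, v)))%E.
Proof.
move=> mG G0; rewrite vmuE//=; apply: eq_integral => x _; rewrite vmuE//=; last first.
  exact: (measurable_section_l x (measurableT_comp mG (@measurable_cons_row R d))).
congr (iint d _); apply/funext => s; congr G; apply/rowP => j.
have [->|[k ->]] : j = ord0 \/ exists k, j = lift ord0 k.
  by case: (unliftP ord0 j) => [k ->|->]; [right; exists k|left].
- by rewrite cons_row0 mxE.
- by rewrite cons_rowS !mxE.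
Qed.

Definition ins_row m (j : 'I_m.+1) (p : 'rV[R]_m * R) : 'rV[R]_m.+1 :=
  \row_k (if unlift j k is Some k' then p.1 0 k' else p.2).

Lemma ins_row_at m (j : 'I_m.+1) p : ins_row j p 0 j = p.2.
Proof. by rewrite mxE unlift_none. Qed.

Lemma ins_row_lift m (j : 'I_m.+1) p k : ins_row j p 0 (lift j k) = p.1 0 k.
Proof. by rewrite mxE liftK. Qed.

Lemma measurable_ins_row m (j : 'I_m.+1) : measurable_fun setT (ins_row j).
Proof.
apply: measurable_into_mx => i k; rewrite (ord1 i).
case: (unliftP j k) => [k' ->|->].
  under eq_fun do rewrite ins_row_lift.
  exact: (measurableT_comp (@measurable_coord R 1 m 0 k') measurable_fst).
by under eq_fun do rewrite ins_row_at; exact: measurable_snd.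
Qed.

(** Brings an arbitrary coordinate to the innermost integral, in preparation for exchanging two
    coordinates. *)
Lemma vmu_ins m (j : 'I_m.+1) (G : 'rV[R]_m.+1 -> \bar R) :
  measurable_fun setT G -> (forall v, 0 <= G v)%E ->
  (\int[vmu R m.+1]_v G v = \int[vmu R m]_s \int[leb]_z G (ins_row j (s, z)))%E.
Proof.
elim: m j G => [|m IH] j G mG G0.
  rewrite vmuS// vmu0; last 2 first.
  - apply: (@measurable_integral_param _ _ _ _ _ leb (G \o ins_row j) _ (fun=> G0 _)).
    exact: (measurableT_comp mG (measurable_ins_row j)).
  - by move=> v; exact: integral_ge0.
  apply: eq_integral => x _; rewrite vmu0//; last first.
    exact: (measurable_section_l x (measurableT_comp mG (@measurable_cons_row R 0))).
  congr G; apply/rowP => k; rewrite !ord1.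
  by rewrite (@cons_row0 R 0) (@ins_row_at 0).
case: (unliftP ord0 j) => [j' ->|->]; last first.
  rewrite vmuS//.
  have mGc : measurable_fun setT (G \o @cons_row R m.+1).
    exact: (measurableT_comp mG (@measurable_cons_row R m.+1)).
  rewrite (@tonelli_swap _ _ _ _ _ leb (vmu R m.+1) _ mGc (fun=> G0 _)).
  apply: eq_integral => s _; apply: eq_integral => z _ /=; congr G; apply/rowP => k.
  case: (unliftP ord0 k) => [k' ->|->]; first by rewrite cons_rowS ins_row_lift.
  by rewrite cons_row0 ins_row_at.
rewrite vmuS// [RHS]vmuS; first last.
- by move=> v; exact: integral_ge0.
- apply: (@measurable_integral_param _ _ _ _ _ leb (G \o ins_row (lift ord0 j')) _ (fun=> G0 _)).
  exact: (measurableT_comp mG (measurable_ins_row _)).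
apply: eq_integral => x _.
rewrite (IH j' _ (measurable_section_l x
  (measurableT_comp mG (@measurable_cons_row R _))) (fun=> G0 _)).
apply: eq_integral => s _; apply: eq_integral => z _; rewrite /=; congr G; apply/rowP => k.
case: (unliftP (lift ord0 j') k) => [k' ->|->]; last first.
  by rewrite ins_row_at cons_rowS ins_row_at.
rewrite ins_row_lift /=.
case: (unliftP ord0 k') => [k2 ->|->].
  rewrite cons_rowS.
  have -> : lift (lift ord0 j') (lift ord0 k2) = lift ord0 (lift j' k2).
    by apply/val_inj; rewrite /= /bump/=; lia.
  by rewrite cons_rowS ins_row_lift.
have -> : lift (lift ord0 j') ord0 = ord0.
  by apply/val_inj; rewrite /= /bump/=; lia.
by rewrite !cons_row0.
Qed.

Lemma measurable_affine_vec m (e : R) (q : 'rV[R]_m) :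
  measurable_fun setT (fun s : 'rV[R]_m => q + e *: s).
Proof.
apply: measurable_into_mx => i j; under eq_fun do rewrite !mxE.
apply: measurable_funD => //; apply: measurable_funM => //; exact: measurable_coord.
Qed.

Lemma vmu_scale m (e : R) (q : 'rV[R]_m) (G : 'rV[R]_m -> \bar R) : e != 0 ->
  measurable_fun setT G -> (forall v, 0 <= G v)%E ->
  (\int[vmu R m]_s G s = (`|e| ^+ m)%:E * \int[vmu R m]_s G (q + e *: s)%R)%E.
Proof.
move=> e0; elim: m q G => [|m IH] q G mG G0.
  rewrite expr0 mul1e !vmu0//; last exact: (measurableT_comp mG (@measurable_affine_vec _ _ _)).
  by congr G; apply/rowP => -[].
rewrite vmuS//.
have mGc : measurable_fun setT (fun p => G (@cons_row R m p)).
  exact: (measurableT_comp mG (@measurable_cons_row R m)).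
rewrite (leb_affine (q 0 0) e0); last 2 first.
- exact: (@measurable_integral_param _ _ _ _ _ (vmu R m) _ mGc (fun=> G0 _)).
- by move=> x; exact: integral_ge0.
rewrite exprS EFinM -muleA; congr (_ * _)%E.
have mGq := measurableT_comp mG (@measurable_affine_vec m.+1 e q).
rewrite vmuS//.
have mGq' : measurable_fun setT (fun p => (G \o (fun s => q + e *: s)) (@cons_row R m p)).
  exact: (measurableT_comp mGq (@measurable_cons_row R m)).
rewrite integral_scale; first last.
- exact: exprn_ge0.
- by move=> x; exact: integral_ge0.
- exact: (@measurable_integral_param _ _ _ _ _ (vmu R m) _ mGq' (fun=> G0 _)).
apply: eq_integral => x _.
rewrite (IH (\row_k q 0 (lift ord0 k)))//; last exact: (measurable_section_l _ mGc).
have L n (a b : 'rV[R]_n) i : (a + e *: b) 0 i = a 0 i + e * b 0 i by rewrite !mxE.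
congr (_ * _)%E; apply: eq_integral => s _ /=; congr G; apply/rowP => k.
case: (unliftP ord0 k) => [k' ->|->].
  by rewrite cons_rowS !L mxE cons_rowS.
by rewrite cons_row0 L cons_row0 addrC.
Qed.

Lemma vmu_prod d (phi : 'I_d -> R -> R) :
  (forall k, measurable_fun setT (phi k)) -> (forall k x, 0 <= phi k x) ->
  (\int[vmu R d]_v (\prod_(k < d) phi k (v 0 k))%:E =
   \prod_(k < d) \int[leb]_x (phi k x)%:E)%E.
Proof.
elim: d phi => [|d IH] phi mphi phi0.
  rewrite (_ : (fun v => _) = cst 1%E) ?vmu0// ?big_ord0//.
  by apply/funext => v; rewrite big_ord0.
have mprod : measurable_fun setT (fun v : 'rV[R]_d.+1 => (\prod_(k < d.+1) phi k (v 0 k))%:E).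
  apply/measurable_EFinP; apply: measurable_prod => k _.
  by apply: (measurableT_comp (mphi k)); exact: measurable_coord.
rewrite vmuS//; last by move=> v; rewrite lee_fin prodr_ge0.
rewrite big_ord_recl -ge0_integralZr//; last 3 first.
- exact: measurable_EFinR.
- by move=> x _; rewrite lee_fin.
- by apply: prode_ge0 => k _; apply: integral_ge0 => x _; rewrite lee_fin.
apply: eq_integral => x _; rewrite -IH//.
rewrite integral_scale//; last first.
- by move=> v; rewrite lee_fin prodr_ge0.
- apply/measurable_EFinP; apply: measurable_prod => k _.
  by apply: (measurableT_comp (mphi _)); exact: measurable_coord.
apply: eq_integral => v _; rewrite big_ord_recl cons_row0 EFinM; congr (_ * _)%E.
by congr EFin; apply: eq_bigr => k _; rewrite cons_rowS.
Qed.

(** An open set is the union of the countably many cubes with rational centre and radius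
    [1 / (n + 1)] that it contains. *)
Lemma open_measurable_vec d (U : set 'rV[R]_d) : open U -> measurable U.
Proof.
move=> oU.
pose B (p : 'rV[rat]_d * nat) : set 'rV[R]_d :=
  [set v | forall k, `|v 0 k - ratr (p.1 0 k)| < p.2.+1%:R^-1].
have mB p : measurable (B p).
  have -> : B p = \bigcap_(k in [set: 'I_d]) [set v | `|v 0 k - ratr (p.1 0 k)| < p.2.+1%:R^-1].
    by apply/seteqP; split => v /= h => [k _|k]; apply: h.
  apply: fin_bigcap_measurable => [|k _]; first exact: finite_finset.
  have mf : measurable_fun setT (fun v : 'rV[R]_d => `|v 0 k - ratr (p.1 0 k)|).
    apply: measurableT_comp => //; apply: measurable_funB => //; exact: measurable_coord.
  have := mf measurableT _ (measurable_itv `]-oo, p.2.+1%:R^-1[).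
  by rewrite setTI; congr measurable; apply/seteqP; split => v; rewrite /= in_itv.
pose F (i : nat) : set 'rV[R]_d :=
  if unpickle i is Some p then (if `[< B p `<=` U >] then B p else set0) else set0.
have -> : U = \bigcup_i F i.
  apply/seteqP; split => [v Uv|v [i _]]; last first.
    rewrite /F; case: unpickle => // p; case: ifPn => // /asboolP; exact.
  have /nbhs_ballP[e /= e0 be] := open_nbhs_nbhs (conj oU Uv).
  have [n ne] : exists n, n.+1%:R^-1 < e / 2.
    have e2 : 0 < e / 2 by lra.
    exists (Num.truncn (e / 2)^-1); rewrite invf_plt ?posrE//.
    exact: truncnS_gt.
  have rk k : exists r : rat, `|v 0 k - ratr r| < n.+1%:R^-1 :> R.
    have u0 : 0 < n.+1%:R^-1 :> R by rewrite invr_gt0 ltr0Sn.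
    move: (n.+1%:R^-1) u0 => u u0.
    have vv : v 0 k - u < v 0 k + u by lra.
    have [r] := rat_in_itvoo vv.
    by rewrite in_itv/= => /andP[r1 r2]; exists r; rewrite ltr_norml; apply/andP; split; lra.
  have [r rP] := choice rk.
  exists (pickle (\row_k r k, n)) => //; rewrite /F pickleK.
  have -> : `[< B (\row_k r k, n) `<=` U >].
    apply/asboolP => w Bw; apply: be; split => // i k; rewrite (ord1 i).
    rewrite /ball/=; have := Bw k; have := rP k; rewrite /= mxE.
    set a := ratr _; move=> h1 h2.
    have : `|v 0 k - w 0 k| <= `|v 0 k - a| + `|w 0 k - a|.
      by rewrite [X in _ <= _ + X]distrC; exact: ler_distD.
    by move: (n.+1%:R^-1) ne h1 h2 => u ne' h1 h2 ?; lra.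
  by move=> k /=; rewrite mxE.
apply: bigcupT_measurable => i; rewrite /F; case: unpickle => // p.
by case: ifP => _; [exact: mB|exact: measurable0].
Qed.

Lemma closed_measurable_vec d (C : set 'rV[R]_d) : closed C -> measurable C.
Proof.
move=> cC; rewrite -(setCK C); apply: measurableC; apply: open_measurable_vec.
exact: closed_openC.
Qed.

End vector_integrals.

(** * Faces of points in general position *)

Section affine_det.
Variables (R : realType) (d : nat).
Local Notation E := 'rV[R]_d.

Definition lift1 (v : E) : 'rV[R]_(d + 1) := row_mx v (1 : 'rV_1).

(** Up to the factor [d!] and a sign, the signed volume of the simplex on [Y] and [y]: its sign
    tells on which side of the hyperplane through [Y] the point [y] lies. *)
Definition adet_mx (Y : 'I_d -> E) (y : E) : 'M[R]_(d + 1) :=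
  col_mx (\matrix_(i < d) lift1 (Y i)) (lift1 y).
Definition adet Y y := \det (adet_mx Y y).
Definition anormal (Y : 'I_d -> E) : E :=
  \row_j cofactor (adet_mx Y 0) (rshift d 0) (lshift 1 j).
Definition aoffset (Y : 'I_d -> E) : R :=
  cofactor (adet_mx Y 0) (rshift d 0) (rshift d 0).

Lemma dotvE (u v : E) : dotv u v = \sum_j u 0 j * v 0 j.
Proof. by rewrite /dotv mxE; apply: eq_bigr => j _; rewrite mxE. Qed.

(** Expansion along the last row, whose cofactors do not involve [y]; hence [anormal] and [aoffset]
    may be computed with the dummy last point [0]. *)
Lemma adetE Y y : adet Y y = dotv (anormal Y) y + aoffset Y.
Proof.
rewrite /adet (expand_det_row _ (rshift d 0)) big_split_ord/=.
have cofE k : cofactor (adet_mx Y y) (rshift d 0) k = cofactor (adet_mx Y 0) (rshift d 0) k.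
  rewrite /cofactor; congr (_ * \det _); apply/matrixP => i j; rewrite !mxE.
  case: splitP => // i' /= e; exfalso.
  by move: e (ltn_ord i) (ltn_ord i'); rewrite /bump; lia.
congr (_ + _).
  rewrite dotvE; apply: eq_bigr => j _; rewrite cofE col_mxEd row_mxEl.
  by rewrite [X in _ = X * _]mxE mulrC.
by rewrite big_ord1 cofE col_mxEd row_mxEr mxE eqxx mul1r.
Qed.

Lemma adet_vertex Y i : adet Y (Y i) = 0.
Proof.
rewrite /adet (determinant_alternate (i1 := lshift 1 i) (i2 := rshift d 0))//.
  by rewrite eq_lrshift.
by move=> j; rewrite col_mxEu col_mxEd mxE.
Qed.

(* An affine functional vanishing on the points of [Y] is proportional to
   [adet Y], by Cramer's rule. *)
Lemma adet_prop Y (c : E) (b : R) : (forall i, dotv c (Y i) = b) ->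
  forall y z, (dotv c y - b) * adet Y z = (dotv c z - b) * adet Y y.
Proof.
move=> cY y z.
pose cb : 'cV[R]_(d + 1) := col_mx c^T (- b)%:M.
have liftcb v : lift1 v *m cb = (dotv c v - b)%:M.
  rewrite /lift1 mul_row_col; apply/matrixP => i j; rewrite !ord1 !mxE.
  rewrite eqxx mulr1n; congr (_ + _).
    by rewrite dotvE; apply: eq_bigr => k _; rewrite mxE mulrC.
  by rewrite big_ord1 !mxE eqxx !mulr1n mul1r.
(* Only the last row of the product survives, the functional being zero on the points of [Y];
   multiplying by the adjugate then expresses the functional through cofactors. *)
have Mcb : adet_mx Y y *m cb = (dotv c y - b) *: delta_mx (rshift d 0) 0.
  apply/matrixP => i j; rewrite !ord1.
  have -> : (adet_mx Y y *m cb) i 0 = (row i (adet_mx Y y) *m cb) 0 0.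
    by rewrite -row_mul [RHS]mxE.
  case: (splitP i) => [i' e|i' e].
    have -> : i = lshift 1 i' by apply/val_inj.
    by rewrite /adet_mx rowKu rowK liftcb cY subrr !mxE eq_lrshift andFb mulr0 mul0rn.
  have -> : i = rshift d i' by apply/val_inj.
  rewrite !ord1 /adet_mx rowKd.
  have -> : row 0 (lift1 y) = lift1 y by apply/rowP => k; rewrite !mxE.
  by rewrite liftcb !mxE !eqxx mulr1.
have cofE k : (\adj (adet_mx Y y)) k (rshift d 0) = cofactor (adet_mx Y 0) (rshift d 0) k.
  rewrite mxE /cofactor; congr (_ * \det _); apply/matrixP => i j; rewrite !mxE.
  case: splitP => // i' /= e; exfalso.
  by move: e (ltn_ord i) (ltn_ord i'); rewrite /bump; lia.
have key k : adet Y y * cb k 0 = (dotv c y - b) * cofactor (adet_mx Y 0) (rshift d 0) k.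
  have := congr1 (fun M : 'cV_(d + 1) => (\adj (adet_mx Y y) *m M) k 0) Mcb.
  rewrite mulmxA mul_adj_mx mul_scalar_mx mxE => ->.
  rewrite -scalemxAr mxE -cofE; congr (_ * _).
  by rewrite -colE mxE.
have h1 : adet Y y * dotv c z = (dotv c y - b) * dotv (anormal Y) z.
  rewrite [dotv c z]dotvE [dotv (anormal Y) z]dotvE !mulr_sumr.
  apply: eq_bigr => j _.
  have -> : anormal Y 0 j = cofactor (adet_mx Y 0) (rshift d 0) (lshift 1 j) by rewrite mxE.
  by rewrite mulrA mulrA -key /cb col_mxEu [c^T _ _]mxE.
have h2 : adet Y y * - b = (dotv c y - b) * aoffset Y.
  by rewrite /aoffset -key /cb col_mxEd mxE eqxx mulr1n.
by rewrite [adet Y z]adetE mulrDr -h1 -h2; ring.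
Qed.

End affine_det.

(** * Facets and ridges of a point set in general position *)

Section general_position.
Variables (R : realType) (d n : nat).
Local Notation E := 'rV[R]_d.

Definition adets (xs : seq E) (y : E) : R := adet (fun i : 'I_d => nth 0 xs i) y.

Definition pts (X : 'I_n -> E) (T : {set 'I_n}) : seq E := [seq X k | k <- enum T].

(** The usual notion: no [d + 1] of the points lie on a common hyperplane. *)
Definition genpos (X : 'I_n -> E) : Prop :=
  forall (T : {set 'I_n}) k, #|T| = d -> k \notin T -> adets (pts X T) (X k) != 0.

Lemma pts_nth (X : 'I_n -> E) (T : {set 'I_n}) k0 (i : 'I_d) : #|T| = d ->
  nth 0 (pts X T) i = X (nth k0 (enum T) i).
Proof. by move=> Td; rewrite (nth_map k0)// -cardE Td. Qed.

Lemma adets_in (X : 'I_n -> E) (T : {set 'I_n}) k : #|T| = d -> k \in T ->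
  adets (pts X T) (X k) = 0.
Proof.
move=> Td kT; have kd : (index k (enum T) < d)%N.
  by rewrite -Td cardE index_mem mem_enum.
have -> : X k = nth 0 (pts X T) (Ordinal kd).
  by rewrite (pts_nth X k)//= nth_index ?mem_enum.
exact: (adet_vertex (fun i : 'I_d => nth 0 (pts X T) i)).
Qed.

Lemma adets_prop (X : 'I_n -> E) (T : {set 'I_n}) (c : E) b : #|T| = d ->
  (forall k, k \in T -> dotv c (X k) = b) ->
  forall y z, (dotv c y - b) * adets (pts X T) z = (dotv c z - b) * adets (pts X T) y.
Proof.
move=> Td cT; apply: adet_prop => i.
have [k0 k0T] : exists k, k \in T by apply/card_gt0P; rewrite Td (leq_ltn_trans (leq0n i)).
rewrite (pts_nth X k0)//; apply: cT.
by rewrite -mem_enum mem_nth// -cardE Td.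
Qed.

Lemma superset_card (T : {set 'I_n}) m : (#|T| <= m <= n)%N ->
  exists2 S : {set 'I_n}, T \subset S & #|S| = m.
Proof.
move=> /andP[]; elim: m => [|m IH] Tm mn.
  by exists T => //; apply/eqP; rewrite -leqn0.
move: Tm; rewrite leq_eqVlt => /predU1P[e|]; first by exists T.
rewrite ltnS => Tm; have [S TS Sm] := IH Tm (ltnW mn).
have [x xS] : exists x, x \in ~: S.
  by apply/card_gt0P; rewrite cardsCs finset.setCK card_ord Sm subn_gt0.
exists (x |: S); first exact: (fintype.subset_trans TS (finset.subsetUr _ _)).
by move: xS; rewrite inE cardsU1 => ->; rewrite Sm.
Qed.

Definition lifted (X : 'I_n -> E) (T : {set 'I_n}) : 'M[R]_(n, d + 1) :=
  \matrix_(k < n) (if k \in T then row_mx (X k) (1 : 'rV_1) else 0).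

Lemma lifted_sub (X : 'I_n -> E) (S T : {set 'I_n}) : S \subset T ->
  (lifted X S <= lifted X T)%MS.
Proof.
move=> ST; apply/row_subP => k; rewrite rowK; case: ifP => [kS|]; last by rewrite sub0mx.
have := row_sub k (lifted X T).
by rewrite rowK (fintype.subsetP ST _ kS).
Qed.

Lemma lifted_full (X : 'I_n -> E) (T : {set 'I_n}) : genpos X -> #|T| = d.+1 ->
  \rank (lifted X T) = d.+1.
Proof.
move=> gX Td1.
have [k kT] : exists k, k \in T by apply/card_gt0P; rewrite Td1.
have kd : #|T :\ k| = d by apply: succn_inj; rewrite -Td1 (cardsD1 k T) kT.
have := gX (T :\ k) k kd; rewrite !inE eqxx => /(_ isT).
rewrite /adets /adet -unitfE -unitmxE => Mu.
apply/eqP; rewrite eqn_leq; apply/andP; split.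
  by rewrite (leq_trans (rank_leq_col _))// addn1.
have := mxrank_unit Mu; rewrite [RHS]addn1 => <-; apply: mxrankS.
apply/row_subP => i; rewrite /adet_mx.
have rowT j : j \in T -> (lift1 (X j) <= lifted X T)%MS.
  by move=> jT; have := row_sub j (lifted X T); rewrite rowK jT.
case: (splitP i) => [i' e|i' e].
  have -> : i = lshift 1 i' by apply/val_inj.
  rewrite rowKu rowK (pts_nth X k)//; apply: rowT.
  have : nth k (enum (T :\ k)) i' \in T :\ k by rewrite -mem_enum mem_nth// -cardE kd.
  by rewrite !inE => /andP[].
have -> : i = rshift d i' by apply/val_inj.
rewrite rowKd; have -> : row i' (lift1 (X k)) = lift1 (X k).
  by apply/rowP => l; rewrite mxE ord1.
exact: rowT.
Qed.

Lemma lifted_rank_le (X : 'I_n -> E) (T : {set 'I_n}) : (\rank (lifted X T) <= #|T|)%N.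
Proof.
have : (lifted X T <= \matrix_(i < #|T|) lift1 (X (enum_val i)))%MS.
  apply/row_subP => k; rewrite rowK; case: ifP => [kT|]; last by rewrite sub0mx.
  have := row_sub (enum_rank_in kT k) (\matrix_(i < #|T|) lift1 (X (enum_val i))).
  by rewrite rowK enum_rankK_in.
by move=> /mxrankS/leq_trans; apply; exact: rank_leq_row.
Qed.

(** Any [d + 1] lifted points are independent. A smaller [T] is enlarged to [d + 1] points, each new
    one adding at most one to the rank; a larger [T] contains [d + 1] points of full rank. *)
Lemma lifted_rank (X : 'I_n -> E) (T : {set 'I_n}) : (d < n)%N -> genpos X ->
  affdim1 X T = minn #|T| d.+1.
Proof.
move=> dn gX; rewrite /affdim1 -/(lifted X T).
case: (leqP #|T| d.+1) => Td.
  have [S TS Sd] := @superset_card T d.+1 (introT andP (conj Td dn)).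
  apply/eqP; rewrite eqn_leq lifted_rank_le/=.
  have : (lifted X S <= lifted X T + lifted X (S :\: T))%MS.
    apply/row_subP => k; rewrite rowK; case: ifP => [kS|]; last by rewrite sub0mx.
    have [kT|kT] := boolP (k \in T).
      apply: (submx_trans _ (addsmxSl _ _)).
      by have := row_sub k (lifted X T); rewrite rowK kT.
    apply: (submx_trans _ (addsmxSr _ _)).
    by have := row_sub k (lifted X (S :\: T)); rewrite rowK inE kT kS.
  move=> /mxrankS; rewrite lifted_full// => /leq_trans /(_ (mxrank_adds_leqif _ _).1) h.
  have := lifted_rank_le X (S :\: T); rewrite cardsD (finset.setIidPr TS) Sd => h2.
  move: h h2 Td; set a := \rank (lifted X T); set b := \rank (lifted X (S :\: T)).
  by set t := #|T|; lia.
have [S ST Sd] : exists2 S : {set 'I_n}, S \subset T & #|S| = d.+1.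
  (* [superset_card] applied to the complement of [T] produces a subset of [T]. *)
  have [s sT ss] : exists2 S : {set 'I_n}, ~: T \subset S & #|S| = (n - d.+1)%N.
    apply: superset_card; rewrite leq_subr andbT cardsCs finset.setCK card_ord.
    by rewrite leq_sub2l// ltnW.
  exists (~: s); first by rewrite -[T]finset.setCK finset.setCS.
  by rewrite cardsCs finset.setCK card_ord ss subKn.
apply/eqP; rewrite eqn_leq; apply/andP; split.
  by rewrite (leq_trans (rank_leq_col _))// addn1.
by rewrite -(lifted_full gX Sd); apply: mxrankS; exact: lifted_sub.
Qed.

(** One perturbation size that preserves finitely many strict inequalities at once. *)
Lemma eps_exists (p q : 'I_n -> R) (P : pred 'I_n) : (forall j, P j -> 0 < p j) ->
  exists2 e, 0 < e & forall j, P j -> e * q j < p j.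
Proof.
move=> p0; pose S := \sum_(j | P j) `|q j| / p j.
have S0 : 0 <= S by apply: sumr_ge0 => j Pj; rewrite divr_ge0// ltW// p0.
exists (1 + S)^-1; first by rewrite invr_gt0; lra.
move=> j Pj; rewrite mulrC ltr_pdivrMr; last by lra.
have : `|q j| / p j <= S.
  rewrite /S (bigD1 j)//= lerDl; apply: sumr_ge0 => k /andP[Pk _].
  by rewrite divr_ge0// ltW// p0.
rewrite ler_pdivrMr ?p0// => h; have := p0 _ Pj; have := ler_norm (q j).
by nra.
Qed.

Definition supports (X : 'I_n -> E) (T : {set 'I_n}) (c : E) (b : R) : Prop :=
  forall k, (k \in T -> dotv c (X k) = b) /\ (k \notin T -> dotv c (X k) < b).

Lemma face_supports (X : 'I_n -> E) (T : {set 'I_n}) :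
  face_index_set X T <-> T != finset.set0 /\ exists c b, supports X T c b.
Proof.
split=> -[T0 [c [b h]]]; split=> //; exists c, b.
  move: h => [h1 h2] k; split; first by move/h2.
  move=> kT; rewrite lt_neqAle h1 andbT; apply/eqP => /h2.
  by rewrite (negbTE kT).
split=> k; have [h1 h2] := h k; have [kT|kT] := boolP (k \in T).
- by rewrite (h1 kT).
- by rewrite ltW// h2.
- by split=> // _; exact: h1.
- by split=> // e; have := h2 kT; rewrite e ltxx.
Qed.

Lemma adets_dotv xs : exists c b, forall y, adets xs y = dotv c y - b.
Proof.
exists (anormal (fun i : 'I_d => nth 0 xs i)), (- aoffset (fun i : 'I_d => nth 0 xs i)).
by move=> z; rewrite /adets adetE opprK.
Qed.

Lemma dotvDl (u v w : E) : dotv (u + v) w = dotv u w + dotv v w.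
Proof. by rewrite /dotv mulmxDl mxE. Qed.

Lemma dotvZl a (u v : E) : dotv (a *: u) v = a * dotv u v.
Proof. by rewrite /dotv -scalemxAl mxE. Qed.

Lemma dotvNl (u v : E) : dotv (- u) v = - dotv u v.
Proof. by rewrite -scaleN1r dotvZl mulN1r. Qed.

Definition same_side (X : 'I_n -> E) (T : {set 'I_n}) : Prop :=
  (forall k, k \notin T -> 0 < adets (pts X T) (X k)) \/
  (forall k, k \notin T -> adets (pts X T) (X k) < 0).

(** A functional supporting at [d] points in general position is proportional to [adets], so being a
    facet means that [adets] has constant sign off [T]. *)
Lemma facetP (X : 'I_n -> E) (T : {set 'I_n}) : (0 < d)%N -> (d < n)%N -> genpos X ->
  (face_index_set X T /\ affdim1 X T = d) <-> (#|T| = d /\ same_side X T).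
Proof.
move=> d0 dn gX; rewrite lifted_rank//; split.
  move=> [/face_supports[T0 [c [b cb]]] Td].
  have {}Td : #|T| = d by lia.
  split => //.
  have [k0 k0T] : exists x, x \in ~: T.
    by apply/card_gt0P; rewrite cardsCs finset.setCK card_ord Td subn_gt0.
  rewrite inE in k0T.
  have prop := adets_prop Td (fun k kT => (cb k).1 kT).
  have neg k : k \notin T -> dotv c (X k) - b < 0 by move=> /(cb k).2; rewrite subr_lt0.
  have nz := gX T k0 Td k0T.
  have [D0|D0] := ltP 0 (adets (pts X T) (X k0)); [left|right] => k kT.
    have := prop (X k0) (X k); have := neg _ k0T; have := neg _ kT.
    set A := adets _ _; set B := adets _ _ in D0 *; nra.
  have {}D0 : adets (pts X T) (X k0) < 0 by rewrite lt_neqAle nz.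
  have := prop (X k0) (X k); have := neg _ k0T; have := neg _ kT.
  set A := adets _ _; set B := adets _ _ in D0 *; nra.
move=> [Td ss]; split; last by rewrite Td; lia.
apply/face_supports; split; first by rewrite -card_gt0 Td.
have [c [b cb]] := adets_dotv (pts X T).
case: ss => ss; [exists (- c), (- b)|exists c, b] => k; split => kT.
- by have := adets_in X Td kT; rewrite cb dotvNl; lra.
- by have := ss k kT; rewrite cb dotvNl; lra.
- by have := adets_in X Td kT; rewrite cb; lra.
- by have := ss k kT; rewrite cb; lra.
Qed.

(** The supporting hyperplane is tilted about the vertices [T :\ k] by a functional that vanishes on
    them but not at [k]: vertex [k] drops strictly inside, and a small enough tilt keeps the points
    off [T] strictly inside. *)
Lemma face_remove (X : 'I_n -> E) (T : {set 'I_n}) k : (1 < d)%N -> (d < n)%N -> genpos X ->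
  face_index_set X T -> #|T| = d -> k \in T -> face_index_set X (T :\ k).
Proof.
move=> d1 dn gX /face_supports[T0 [c [b cb]]] Td kT; apply/face_supports.
have Tk : #|T :\ k| = d.-1 by have := cardsD1 k T; rewrite kT Td => ->.
split; first by rewrite -card_gt0 Tk; lia.
have [m mT] : exists x, x \in ~: T.
  by apply/card_gt0P; rewrite cardsCs finset.setCK card_ord Td subn_gt0.
rewrite inE in mT.
have km : k != m by apply: contraNneq mT => <-.
(* The auxiliary point [m] completes [T :\ k] to [d] points, which determine the tilting functional;
   general position makes it nonzero at [k]. *)
pose S := m |: (T :\ k).
have Sd : #|S| = d by rewrite cardsU1 Tk !inE (negbTE mT) andbF /=; lia.
have kS : k \notin S by rewrite !inE eqxx/= orbF.
have [c' [b' cb']] := adets_dotv (pts X S).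
have nz := gX S k Sd kS; rewrite cb' in nz.
pose l y := dotv c' y - b'.
pose sg := Num.sg (l (X k)).
have sgl : 0 < sg * l (X k) by rewrite /sg -normrEsg normr_gt0.
have [e e0 eP] := @eps_exists (fun j => b - dotv c (X j)) (fun j => - (sg * l (X j)))
  (fun j => j \notin T) (fun j jT => etrans (subr_gt0 _ _) ((cb j).2 jT)).
have lS j : j \in T :\ k -> l (X j) = 0.
  by move=> jT; rewrite /l -cb'; apply: adets_in => //; rewrite finset.in_setU jT orbT.
exists (c - (e * sg) *: c'), (b - e * sg * b') => j.
have E : dotv (c - (e * sg) *: c') (X j) - (b - e * sg * b') =
    (dotv c (X j) - b) - e * (sg * l (X j)).
  by rewrite dotvDl -scaleNr dotvZl /l; ring.
split => jT.
  have := lS j jT; move: jT; rewrite !inE => /andP[_ /(cb j).1 h] h'.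
  by move: E; rewrite h' h; lra.
have [jk|jk] := eqVneq j k.
  have h := (cb k).1 kT; move: E; rewrite jk h.
  by have := mulr_gt0 e0 sgl; lra.
have {}jT : j \notin T by move: jT; rewrite !inE jk.
by have := eP j jT; move: E; lra.
Qed.

(* Seen from a ridge [S], the other points are ordered by the slope
   [l / u] of two functionals vanishing on [S]; the facets containing [S]
   are given by the two extreme points. *)
Lemma ridge_two_facets (X : 'I_n -> E) (S : {set 'I_n}) : (0 < d)%N -> (d < n)%N -> genpos X ->
  face_index_set X S -> #|S| = d.-1 ->
  #|[pred k | (k \notin S) && `[< face_index_set X (k |: S) >]]| = 2%N.
Proof.
move=> d0 dn gX /face_supports[S0 [c [b cb]]] Sd.
have card1 k : k \notin S -> #|k |: S| = d by move=> kS; rewrite cardsU1 kS Sd; lia.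
have [m mS] : exists x, x \in ~: S.
  by apply/card_gt0P; rewrite cardsCs finset.setCK card_ord Sd subn_gt0; lia.
rewrite inE in mS.
have [m' m'S] : exists x, x \in ~: (m |: S).
  by apply/card_gt0P; rewrite cardsCs finset.setCK card_ord card1// subn_gt0.
rewrite inE in m'S.
have [c' [b' cb']] := adets_dotv (pts X (m |: S)).
pose l (k : 'I_n) := dotv c' (X k) - b'.
pose u (k : 'I_n) := b - dotv c (X k).
have lS k : k \in m |: S -> l k = 0 by move=> kS; rewrite /l -cb' adets_in// card1.
have lm' : l m' != 0 by rewrite /l -cb'; apply: gX => //; exact: card1.
have uS k : k \in S -> u k = 0 by move=> /(cb k).1; rewrite /u; lra.
have u0 k : k \notin S -> 0 < u k by move=> /(cb k).2; rewrite /u; lra.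
pose r k := l k / u k.
(* In the pencil of hyperplanes through [S], [fc k] and [fb k] describe the one that also passes
   through [X k]. *)
pose fc k := c' + r k *: c; pose fb k := b' + r k * b.
have fE k j : dotv (fc k) (X j) - fb k = l j - r k * u j.
  by rewrite /fc /fb dotvDl dotvZl /l /u; ring.
have fE' k j : j \notin S -> dotv (fc k) (X j) - fb k = u j * (r j - r k).
  move=> jS; rewrite fE [RHS]mulrBr [u j * r k]mulrC; congr (_ - _).
  by rewrite /r mulrC divfK// gt_eqF// u0.
have fS k j : k \notin S -> j \in k |: S -> dotv (fc k) (X j) = fb k.
  move=> kS; rewrite in_setU1 => /predU1P[->|jS]; apply/eqP; rewrite -subr_eq0.
    by rewrite fE'// subrr mulr0.
  by rewrite fE uS// lS ?inE ?jS ?orbT// mulr0 subrr.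
(* Equal slopes would put the [d + 1] points of [S], [j] and [k] on one hyperplane. *)
have rinj k j : k \notin S -> j \notin S -> j != k -> r j != r k.
  move=> kS jS jk; apply/eqP => rjk.
  have zero i : dotv (fc k) (X i) - fb k = 0.
    have := adets_prop (card1 _ kS) (fun i => fS k i kS) (X i) (X j).
    rewrite (fE' _ j jS) rjk subrr mulr0 mul0r => /eqP; rewrite mulf_eq0.
    have jkS : j \notin k |: S by rewrite in_setU1 negb_or jk.
    by rewrite (negbTE (gX _ _ (card1 _ kS) jkS)) orbF => /eqP.
  have := zero m; rewrite fE lS ?inE ?eqxx// sub0r => /eqP.
  rewrite oppr_eq0 mulf_eq0 (gt_eqF (u0 _ mS)) orbF => /eqP rk0.
  by have := zero m'; rewrite fE rk0 mul0r subr0 => /eqP; rewrite (negbTE lm').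
have mS' : m \in ~: S by rewrite inE.
pose k1 := [arg max_(i > m in ~: S) r i]%O.
pose k2 := [arg min_(i < m in ~: S) r i]%O.
have [k1S k1max] : k1 \notin S /\ forall j, j \notin S -> r j <= r k1.
  rewrite /k1; case: Order.TotalTheory.arg_maxP => // i; rewrite inE => iS h; split=> // j jS.
  by apply: h; rewrite inE.
have [k2S k2min] : k2 \notin S /\ forall j, j \notin S -> r k2 <= r j.
  rewrite /k2; case: Order.TotalTheory.arg_minP => // i; rewrite inE => iS h; split=> // j jS.
  by apply: h; rewrite inE.
have m'S2 : m' \notin S by move: m'S; rewrite in_setU1 negb_or => /andP[].
have mm' : m' != m by move: m'S; rewrite in_setU1 negb_or => /andP[].
have k12 : k1 != k2.
  apply/eqP => e; have := rinj m m' mS m'S2 mm'.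
  have := k1max _ mS; have := k1max _ m'S2; have := k2min _ mS; have := k2min _ m'S2.
  rewrite e => ? ? ? ?; apply/negP; rewrite negbK; apply/eqP; lra.
rewrite (@eq_card _ _ (pred2 k1 k2)) ?card2 ?k12// => k.
  rewrite !inE; apply/andP/orP; last first.
    have ne : k |: S != finset.set0 by apply/set0Pn; exists k; rewrite !inE eqxx.
    move=> [] /eqP ->; (split; first by []); apply/asboolP/face_supports.
      split; first by apply/set0Pn; exists k1; rewrite !inE eqxx.
      exists (fc k1), (fb k1) => j; split; first exact: fS.
      rewrite in_setU1 negb_or => /andP[jk jS]; rewrite -subr_lt0 fE'//.
      rewrite pmulr_rlt0 ?u0// subr_lt0 lt_neqAle k1max// andbT.
      exact: rinj.
    split; first by apply/set0Pn; exists k2; rewrite !inE eqxx.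
    exists (- fc k2), (- fb k2) => j.
    have fN v : dotv (- fc k2) v = - dotv (fc k2) v by exact: dotvNl.
    rewrite fN; split; first by move=> jS; rewrite fS.
    rewrite in_setU1 negb_or => /andP[jk jS]; rewrite ltrN2 -subr_gt0 fE'//.
    rewrite pmulr_rgt0 ?u0// subr_gt0 lt_neqAle k2min// andbT eq_sym.
    exact: rinj.
  move=> [kS /asboolP/face_supports[_ [c2 [b2 cb2]]]].
  have p1 := adets_prop (card1 _ kS) (fun i => fS k i kS).
  have p2 := adets_prop (card1 _ kS) (fun i => (cb2 i).1).
  have [z zS] : exists x, x \in ~: (k |: S).
    by apply/card_gt0P; rewrite cardsCs finset.setCK card_ord card1// subn_gt0.
  rewrite inE in zS; have nz := gX _ _ (card1 _ kS) zS.
  have prop y : (dotv c2 (X y) - b2) * (dotv (fc k) (X z) - fb k) =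
      (dotv c2 (X z) - b2) * (dotv (fc k) (X y) - fb k).
    apply: (mulIf nz); rewrite mulrAC p2 -!mulrA; congr (_ * _).
    by rewrite mulrC -p1.
  (* Any functional supporting at [k |: S] is proportional to the pencil member through [k], so all
     other slopes lie on the same side of [r k]. This excludes a slope strictly between the two
     extremes. *)
  have sgn y : y \notin k |: S -> 0 < (r y - r k) * (r z - r k).
    move=> yS; have := prop y.
    move: (yS) (zS); rewrite !in_setU1 !negb_or => /andP[yk y1] /andP[zk z1].
    rewrite !fE'// => h.
    have h1 := (cb2 y).2 yS; have h2 := (cb2 z).2 zS.
    have h3 := u0 _ y1; have h4 := u0 _ z1.
    have h5 := rinj _ _ kS y1 yk; have h6 := rinj _ _ kS z1 zk.
    have : (b2 - dotv c2 (X y)) * u z * (r z - r k) = (b2 - dotv c2 (X z)) * u y * (r y - r k).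
      by lra.
    set A := (b2 - _) * _; set B := (b2 - _) * _ => hAB.
    have A0 : 0 < A by apply: mulr_gt0 => //; rewrite subr_gt0.
    have B0 : 0 < B by apply: mulr_gt0 => //; rewrite subr_gt0.
    have sq : 0 < (r z - r k) ^+ 2 by rewrite exprn_even_gt0//= subr_eq0.
    by rewrite -(pmulr_rgt0 _ B0) mulrA -hAB -mulrA -expr2 pmulr_rgt0.
  have [kk1|kk1] := eqVneq k k1; first by left.
  have [kk2|kk2] := eqVneq k k2; first by right.
  have s1 : k1 \notin k |: S by rewrite in_setU1 negb_or k1S andbT eq_sym.
  have s2 : k2 \notin k |: S by rewrite in_setU1 negb_or k2S andbT eq_sym.
  have := sgn _ s1; have := sgn _ s2; have := k1max _ kS; have := k2min _ kS.
  move: (r k1) (r k2) (r k) (r z) => a a' rk rz h1 h2 h3 h4; exfalso.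
  have h5 := mulr_gt0 h3 h4.
  have h6 : 0 <= (a - rk) * (rk - a') * (rz - rk) ^+ 2.
    by rewrite mulr_ge0 ?sqr_ge0// mulr_ge0// subr_ge0.
  have : (a' - rk) * (rz - rk) * ((a - rk) * (rz - rk)) =
    - ((a - rk) * (rk - a') * (rz - rk) ^+ 2) by ring.
  by move: h5 h6; set u1 := _ * (_ * _); set u2 := _ * _ ^+ 2; lra.
Qed.

Lemma fnumE (X : 'I_n -> E) i : (i < d)%N -> (d < n)%N -> genpos X ->
  fnum X i = #|[pred T : {set 'I_n} | `[< face_index_set X T >] && (#|T| == i.+1)]|.
Proof.
move=> id dn gX; apply: eq_card => T.
have e : (affdim1 X T == i.+1) = (#|T| == i.+1).
  by rewrite lifted_rank//; move: #|T| => t; apply/idP/idP => /eqP h; apply/eqP; lia.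
by apply/idP/idP; rewrite !inE /= e.
Qed.

(** Double counting of incident pairs: each ridge lies in two facets, and each facet, a simplex,
    contains the [d] ridges obtained by dropping a vertex. *)
Lemma ridge_facet_count (X : 'I_n -> E) : (1 < d)%N -> (d < n)%N -> genpos X ->
  (2 * fnum X (d - 2) = d * fnum X (d - 1))%N.
Proof.
move=> d1 dn gX; rewrite !fnumE//; try lia.
have -> : (d - 2).+1 = d.-1 by lia.
have -> : (d - 1).+1 = d by lia.
set Rs := [pred T : {set 'I_n} | _ && (_ == d.-1)].
set Fs := [pred T : {set 'I_n} | _].
transitivity (\sum_(S in Rs) \sum_(k | (k \notin S) && ((k |: S) \in Fs)) 1)%N.
  rewrite mulnC -sum_nat_const; apply: eq_bigr => S; rewrite inE => /andP[/asboolP fS /eqP Sd].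
  rewrite -(ridge_two_facets (ltnW d1) dn gX fS Sd) -sum1_card.
  apply: eq_bigl => k; rewrite !inE; case: (boolP (k \in S)) => //= kS.
  by rewrite cardsU1 kS Sd; case: asboolP => //= _; apply/esym/eqP; lia.
transitivity (\sum_(T in Fs) \sum_(k in T) 1)%N; last first.
  rewrite mulnC -sum_nat_const; apply: eq_bigr => T; rewrite inE => /andP[_ /eqP Td].
  by rewrite sum1_card.
rewrite (exchange_big_dep xpredT)//= [RHS](exchange_big_dep xpredT)//=.
apply: eq_bigr => k _.
rewrite (reindex_onto (fun T : {set 'I_n} => T :\ k) (fun S => k |: S))/=; last first.
  move=> S /and3P[_ kS _]; apply/setP => j; rewrite !inE.
  by case: eqVneq => // -> /=; rewrite (negbTE kS).
apply: eq_bigl => T.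
have [kT|kT] := boolP (k \in T); last first.
  rewrite andbF; apply/negbTE; apply/negP => /andP[_ /eqP e].
  by move: kT; rewrite -e !inE eqxx.
have kTK : k |: T :\ k = T by rewrite finset.setD1K.
rewrite kTK eqxx andbT andbT !inE eqxx/=.
apply/idP/idP => [/and3P[_ -> ->]//|/andP[fT Td]]; rewrite fT Td !andbT.
apply/andP; split; last by rewrite -(eqP Td) (cardsD1 k T) kT.
by apply/asboolP; apply: (@face_remove _ T) => //; [exact/asboolP|exact/eqP].
Qed.

End general_position.

(** * The expected number of facets *)

Section genpos_ae.
Variables (R : realType) (d n : nat).
Local Notation E := 'rV[R]_d.+1.

Lemma lift1_affine (j : 'I_(d.+1 + 1)) (v w : E) t :
  lift1 ((1 - t) *: v + t *: w) 0 j = (1 - t) * lift1 v 0 j + t * lift1 w 0 j.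
Proof. by rewrite /lift1 !mxE; case: splitP => k _; rewrite !mxE //; ring. Qed.

Lemma genpos_inull : inull (n * d.+1) (fun s => ~ genpos (@points_of R d.+1 n s)).
Proof.
have Tk (Tk : {set 'I_n} * 'I_n) : inull (n * d.+1) (fun s => #|Tk.1| = d.+1 /\
    Tk.2 \notin Tk.1 /\ adets (pts (@points_of R d.+1 n s) Tk.1) (@points_of R d.+1 n s Tk.2) = 0).
  case: Tk => T k /=.
  have [Td|/eqP Td] := eqVneq #|T| d.+1; last first.
    by apply: sub_inull (inull_false R _) => s [].
  have [kT|kT] := boolP (k \in T).
    by apply: sub_inull (inull_false R _) => s [_ []].
  pose sig (i : 'I_(d.+1 + 1)) : 'I_n :=
    if fintype.split i is inl i' then nth k (enum T) i' else k.
  have sigl i : sig (lshift 1 i) = nth k (enum T) i.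
    by rewrite /sig -[lshift 1 i]/(unsplit (inl i)) unsplitK.
  have sigr i : sig (rshift d.+1 i) = k.
    by rewrite /sig -[rshift _ i]/(unsplit (inr i)) unsplitK.
  have sT i : sig (lshift 1 i) \in T by rewrite sigl -mem_enum mem_nth// -cardE Td.
  have sinj : injective sig.
    move=> i j; rewrite -(splitK i) -(splitK j).
    case: (fintype.split i) => i'; case: (fintype.split j) => j' /=.
    - rewrite !sigl => /eqP; rewrite nth_uniq ?enum_uniq -?cardE ?Td// => /eqP.
      by move/val_inj => ->.
    - by move=> e; have := sT i'; rewrite e sigr (negbTE kT).
    - by move=> e; have := sT j'; rewrite -e sigr (negbTE kT).
    - by rewrite !ord1.
  have mxE' (X : 'I_n -> E) : \matrix_(i, j) lift1 (X (sig i)) 0 j =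
      adet_mx (fun i : 'I_d.+1 => nth 0 (pts X T) i) (X k).
    apply/matrixP => i j; rewrite mxE -(splitK i); case: (fintype.split i) => i' /=.
      by rewrite sigl /adet_mx col_mxEu mxE (pts_nth X k).
    by rewrite sigr /adet_mx col_mxEd ord1.
  apply: sub_inull (@det_points_inull R d n _ sig (fun j v => lift1 v 0 j) sinj _ _).
  - by move=> s [_ [_ h]]; rewrite mxE'.
  - by move=> j v w t; exact: lift1_affine.
  (* A configuration with nonzero determinant: point [k] at the origin, the points of [T] at the
     standard basis vectors. *)
  pose X0 l : E := if l == k then 0 else delta_mx 0 (inord (index l (enum T))).
  exists X0; rewrite (mxE' X0) /adet_mx.
  have -> : (\matrix_(i < d.+1) lift1 (nth 0 (pts X0 T) i)) =
      row_mx (1%:M : 'M[R]_d.+1) (const_mx 1).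
    apply/row_matrixP => i; rewrite rowK row_row_mx (pts_nth _ k)// /X0.
    have -> : nth k (enum T) i == k = false.
      by apply/negbTE/eqP => e; have := sT i; rewrite sigl e (negbTE kT).
    rewrite index_uniq ?enum_uniq -?cardE ?Td// inord_val row1; congr row_mx.
    by apply/rowP => j; rewrite !mxE !ord1.
  rewrite /X0 eqxx /lift1 -[X in \det X]/(block_mx 1%:M (const_mx 1) 0 1%:M).
  by rewrite det_ublock !det1 mulr1 oner_neq0.
apply: sub_inull (inull_exists Tk) => s /existsNP[T /existsNP[k]].
move=> /not_implyP[Td /not_implyP[kT /negP]]; rewrite negbK => /eqP h.
by exists (T, k).
Qed.

End genpos_ae.

(** * Integrating out the points off a chosen subset *)

Section mask_integral.
Variables (R : realType) (d : nat).
Local Notation E := 'rV[R]_d.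

Definition sel (l : seq nat) (xs : seq E) : seq E := [seq nth 0 xs k | k <- l].

Definition selm (m : bitseq) : seq nat := mask m (iota 0 (size m)).
Arguments sel : simpl never.
Arguments selm : simpl never.

Lemma selm_cons b m : selm (b :: m) = (if b then [:: 0%N] else [::]) ++ map succn (selm m).
Proof.
rewrite /selm /= -[1%N]addn0 iotaDl map_mask.
by case: b => /=; congr (_ :: mask _ _) || congr (mask _ _); apply: eq_map.
Qed.

Lemma selmT m : selm (true :: m) = 0%N :: map succn (selm m).
Proof. exact: selm_cons. Qed.

Lemma selmF m : selm (false :: m) = map succn (selm m).
Proof. exact: selm_cons. Qed.

Lemma sel_succ l x xs : sel (map succn l) (x :: xs) = sel l xs.
Proof. by rewrite /sel -map_comp. Qed.

Lemma sel_cons k l xs : sel (k :: l) xs = nth 0 xs k :: sel l xs. Proof. by []. Qed.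

Lemma measurable_sel l : measurable_fun setT (sel l).
Proof.
apply: measurable_into_seq => i.
have [il|il] := ltnP i (size l); last first.
  by under eq_fun do rewrite nth_default ?size_map//; exact: measurable_cst.
by under eq_fun do rewrite (nth_map 0%N)//; exact: measurable_nth.
Qed.

Definition eprod (B : E -> \bar R) (xs : seq E) : \bar R := foldr (fun x r => B x * r)%E 1%E xs.

Lemma eprod_ge0 B xs : (forall x, 0 <= B x)%E -> (0 <= eprod B xs)%E.
Proof. by move=> B0; elim: xs => //= x xs IH; rewrite mule_ge0. Qed.

Lemma measurable_eprod_sel dX (X : measurableType dX) (B : E * X -> \bar R) l
    (f : X -> seq E) : measurable_fun setT B -> measurable_fun setT f ->
  measurable_fun setT (fun x => eprod (fun z => B (z, x)) (sel l (f x))).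
Proof.
move=> mB mf; elim: l => [|k l IH]; first exact: measurable_cst.
rewrite [sel]/sel /=.
apply: emeasurable_funM => //.
apply: (measurableT_comp mB); apply: measurable_fun_pair => //.
exact: (measurableT_comp (measurable_nth k) mf).
Qed.

Lemma measurable_pow (dX : measure_display) (X : measurableType dX) (f : X -> \bar R) k :
  measurable_fun setT f -> measurable_fun setT (fun x => f x ^+ k)%E.
Proof.
move=> mf; elim: k => [|k IH]; first by under eq_fun do rewrite expe0; exact: measurable_cst.
by under eq_fun do rewrite expeS; apply: emeasurable_funM.
Qed.

(** The points at true bits are the vertices [ys] of a candidate facet; given them, the points at
    false bits are independent and contribute one factor each. By induction on the mask, a true bit
    extends [ys], and a false bit is moved innermost by Tonelli and yields one more factor. *)
Lemma mask_integral (m : bitseq) (A : seq E -> \bar R) (B : E * seq E -> \bar R) :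
  measurable_fun setT A -> measurable_fun setT B ->
  (forall y, 0 <= A y)%E -> (forall p, 0 <= B p)%E ->
  (\int[pmu R d (size m)]_xs (A (sel (selm m) xs) *
     eprod (fun x => B (x, sel (selm m) xs)) (sel (selm (map negb m)) xs)) =
   \int[pmu R d (count id m)]_ys (A ys * (\int[vmu R d]_x B (x, ys)) ^+ (count negb m)))%E.
Proof.
elim: m A B => [|b m IH] A B mA mB A0 B0.
  under eq_integral do rewrite /= mule1.
  rewrite [RHS](_ : _ = \int[pmu R d 0]_ys A ys)%E; last first.
    by apply: eq_integral => ys _; rewrite /= mule1.
  by rewrite !pmu0E//; exact: (measurableT_comp mA (measurable_sel _)).
have mB' ys : measurable_fun setT (fun x => B (x, ys)).
  by apply: (measurableT_comp mB); exact: measurable_pair2.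
have mBs : measurable_fun setT (fun p : seq E * E => B (p.2, p.1)).
  by apply: (measurableT_comp mB); exact: measurable_fun_pair.
have mint : measurable_fun setT (fun ys => \int[vmu R d]_x B (x, ys))%E.
  exact: (measurable_integral_param (vmu R d) mBs (fun p => B0 _)).
have mall l l' : measurable_fun setT (fun xs => A (sel l xs) *
     eprod (fun x => B (x, sel l xs)) (sel l' xs))%E.
  apply: emeasurable_funM; first exact: (measurableT_comp mA (measurable_sel l)).
  apply: (@measurable_eprod_sel _ _ (fun p => B (p.1, sel l p.2)) l' id) => //.
  apply: (measurableT_comp mB); apply: measurable_fun_pair => //.
  exact: (measurableT_comp (measurable_sel l) measurable_snd).
have all0 l l' xs : (0 <= A (sel l xs) * eprod (fun x => B (x, sel l xs)) (sel l' xs))%E.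
  by rewrite mule_ge0// eprod_ge0.
case: b; rewrite [size _]/= [count id _]/= [count negb _]/= [map negb _]/= ?add0n ?add1n.
  rewrite (pmuS _ (mall _ _) (all0 _ _)).
  rewrite [RHS]pmuS; first last.
  - by move=> v; rewrite mule_ge0// expe_ge0// integral_ge0.
  - by apply: emeasurable_funM => //; exact: measurable_pow.
  apply: eq_integral => x _.
  under eq_integral do rewrite selmT selmF sel_cons !sel_succ.
  rewrite (IH (fun ys => A (x :: ys)) (fun p => B (p.1, x :: p.2)))//.
    exact: (measurableT_comp mA (measurable_cons_l x)).
  apply: (measurableT_comp mB); apply: measurable_fun_pair => //.
  exact: (measurableT_comp (measurable_cons_l x) measurable_snd).
rewrite (pmuS _ (mall _ _) (all0 _ _)).
under eq_integral do under eq_integral do rewrite selmT selmF sel_cons !sel_succ.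
pose G (p : E * seq E) : \bar R := (A (sel (selm m) p.2) * (B (p.1, sel (selm m) p.2) *
  eprod (fun x => B (x, sel (selm m) p.2)) (sel (selm (map negb m)) p.2)))%E.
have mG : measurable_fun setT G.
  apply: emeasurable_funM.
    exact: (measurableT_comp (measurableT_comp mA (measurable_sel _)) measurable_snd).
  apply: emeasurable_funM.
    apply: (measurableT_comp mB); apply: measurable_fun_pair => //.
    exact: (measurableT_comp (measurable_sel _) measurable_snd).
  apply: (@measurable_eprod_sel _ _ (fun p => B (p.1, sel (selm m) p.2.2)) _ snd) => //.
  apply: (measurableT_comp mB); apply: measurable_fun_pair => //.
  by apply: (measurableT_comp (measurable_sel _)); apply: measurableT_comp.
have G0 p : (0 <= G p)%E by rewrite !mule_ge0// eprod_ge0.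
rewrite (tonelli_swap (vmu R d) (pmu R d (size m)) mG G0).
transitivity (\int[pmu R d (size m)]_xs
   ((fun ys => A ys * \int[vmu R d]_x B (x, ys)) (sel (selm m) xs) *
     eprod (fun x => B (x, sel (selm m) xs)) (sel (selm (map negb m)) xs)))%E.
  apply: eq_integral => xs _; rewrite /G/=.
  set ys := sel _ xs; set e := eprod _ _.
  have e0 : (0 <= e)%E by exact: eprod_ge0.
  rewrite ge0_integralZl//; first last.
  - by move=> x _; rewrite mule_ge0.
  - by apply: emeasurable_funM => //; exact: measurable_cst.
  by rewrite ge0_integralZr// muleA.
rewrite (IH (fun ys => A ys * \int[vmu R d]_x B (x, ys))%E B)//; first last.
- by move=> y; rewrite mule_ge0// integral_ge0.
- exact: emeasurable_funM.
by apply: eq_integral => ys _; rewrite expeS muleA.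
Qed.

End mask_integral.

Lemma measurable_det (R : realType) dX (X : measurableType dX) n (M : X -> 'M[R]_n) :
  (forall i j, measurable_fun setT (fun x => M x i j)) ->
  measurable_fun setT (fun x => \det (M x)).
Proof.
move=> mM; rewrite /determinant; apply: measurable_sum => s.
apply: measurable_funM; first exact: measurable_cst.
by apply: measurable_prod => i _; exact: mM.
Qed.

Lemma emeasurable_sum_cond (R : realType) dX (X : measurableType dX) (I : finType)
    (P : pred I) (h : I -> X -> \bar R) :
  (forall i, P i -> measurable_fun setT (h i)) ->
  measurable_fun setT (fun x => \sum_(i | P i) h i x)%E.
Proof.
move=> mh; have mh' i : measurable_fun setT (fun x => if P i then h i x else 0%E).
  by case: (boolP (P i)) => [/mh//|_]; exact: measurable_cst.
have := @emeasurable_sum _ _ _ setT _ (index_enum I) _ mh'.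
by under [in X in X -> _]eq_fun do rewrite -big_mkcond.
Qed.

Lemma measurable_gt0 (R : realType) dX (X : measurableType dX) (f : X -> R) :
  measurable_fun setT f -> measurable_fun setT (fun x => (0 < f x)%R%:R : R).
Proof.
move=> mf; rewrite (_ : (fun x => _) = \1_(f @^-1` `]0, +oo[)); last first.
  apply/funext => x; rewrite indicE; congr (_%:R); congr nat_of_bool.
  by apply/idP/idP; rewrite inE /= in_itv/= andbT.
by apply: measurable_indic; rewrite -[X in measurable X]setTI; apply: mf.
Qed.

Lemma measurable_adets (R : realType) d :
  measurable_fun setT (fun p : 'rV[R]_d * seq 'rV[R]_d => adets p.2 p.1).
Proof.
apply: measurable_det => i j; rewrite /adet_mx.
rewrite -(splitK i); case: (fintype.split i) => i' /=.
  under eq_fun do rewrite col_mxEu mxE.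
  rewrite -(splitK j); case: (fintype.split j) => j' /=.
    under eq_fun do rewrite row_mxEl.
    apply: (measurableT_comp (@measurable_coord R 1 d 0 j')).
    exact: (measurableT_comp (measurable_nth i') measurable_snd).
  by under eq_fun do rewrite row_mxEr; exact: measurable_cst.
rewrite ord1; under eq_fun do rewrite col_mxEd.
rewrite -(splitK j); case: (fintype.split j) => j' /=.
  under eq_fun do rewrite row_mxEl.
  exact: (measurableT_comp (@measurable_coord R 1 d 0 j') measurable_fst).
by under eq_fun do rewrite row_mxEr; exact: measurable_cst.
Qed.

Section facet_expectation.
Variables (R : realType) (d n : nat).
Local Notation D := d.+1.
Local Notation E := 'rV[R]_D.
Variable K : set E.
Hypothesis mK : measurable K.

Definition half_ind (s : R) (p : E * seq E) : R := \1_K p.1 * (0 < s * adets p.2 p.1)%R%:R.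

Lemma half_ind_ge0 s p : 0 <= half_ind s p.
Proof. by rewrite mulr_ge0// indicE. Qed.

Lemma measurable_indK (dX : measure_display) (X : measurableType dX) (f : X -> E) :
  measurable_fun setT f -> measurable_fun setT (fun x => \1_K (f x) : R).
Proof. by move=> mf; apply: (measurableT_comp _ mf); exact: measurable_indic. Qed.

Lemma measurable_half_ind s : measurable_fun setT (half_ind s).
Proof.
apply: measurable_funM; first exact: measurable_indK.
apply: measurable_gt0; apply: measurable_funM; first exact: measurable_cst.
exact: measurable_adets.
Qed.

Definition all_in (ys : seq E) : R := \prod_(i < D) \1_K (nth 0 ys i).

Lemma all_in_ge0 ys : 0 <= all_in ys.
Proof. by apply: prodr_ge0 => i _; rewrite indicE. Qed.

Lemma measurable_all_in : measurable_fun setT all_in.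
Proof. by apply: measurable_prod => i _; apply: measurable_indK; exact: measurable_nth. Qed.

(* The measure of the part of [K] on one side of the hyperplane through [ys]. *)
Definition cap (s : R) (ys : seq E) : \bar R := (\int[vmu R D]_x (half_ind s (x, ys))%:E)%E.

Lemma cap_ge0 s ys : (0 <= cap s ys)%E.
Proof. by apply: integral_ge0 => x _; rewrite lee_fin half_ind_ge0. Qed.

Lemma measurable_cap s : measurable_fun setT (cap s).
Proof.
have mB : measurable_fun setT (fun p : seq E * E => (half_ind s (p.2, p.1))%:E).
  apply/measurable_EFinP; apply: (measurableT_comp (measurable_half_ind s)).
  exact: measurable_fun_pair.
by apply: (measurable_integral_param (vmu R D) mB) => p; rewrite lee_fin half_ind_ge0.
Qed.

(** Marks the event that all points are in [K] and those off [T] lie on side [s] of the hyperplane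
    through [T], written as a product so that [mask_integral] applies. *)
Definition facet_term s (T : {set 'I_n}) (X : 'I_n -> E) : \bar R :=
  ((all_in (pts X T))%:E * eprod (fun x => (half_ind s (x, pts X T))%:E) (pts X (~: T)))%E.

Lemma eprod_EFin (b : E -> R) xs : eprod (EFin \o b) xs = (\prod_(x <- xs) b x)%:E.
Proof. by elim: xs => [|x xs IH]; rewrite /= ?big_nil// big_cons IH EFinM. Qed.

Lemma prod_bool (I : finType) (P : pred I) (b : I -> bool) :
  \prod_(i | P i) (b i)%:R = [forall i, P i ==> b i]%:R :> R.
Proof.
have [/forallP h|] := boolP [forall i, P i ==> b i].
  by rewrite big1// => i Pi; have := h i; rewrite Pi => /= ->.
rewrite negb_forall => /existsP[i]; rewrite negb_imply => /andP[Pi /negbTE bi].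
by rewrite (bigD1 i)//= bi mul0r.
Qed.

Lemma facet_termE s (T : {set 'I_n}) (X : 'I_n -> E) : #|T| = D ->
  facet_term s T X = ((\prod_(k < n) \1_K (X k)) *
     [forall k, (k \notin T) ==> (0 < s * adets (pts X T) (X k))]%:R)%:E.
Proof.
move=> TD; rewrite /facet_term.
rewrite (eprod_EFin (fun x => half_ind s (x, pts X T))) -EFinM; congr EFin.
have allE : all_in (pts X T) = \prod_(k in T) \1_K (X k).
  rewrite -[RHS]big_enum/= -(big_map X xpredT (\1_K)).
  by rewrite (big_nth 0) size_map -cardE TD big_mkord.
have outE : \prod_(x <- pts X (~: T)) half_ind s (x, pts X T) =
    \prod_(k | k \notin T) (\1_K (X k) * (0 < s * adets (pts X T) (X k))%R%:R).
  rewrite big_map big_enum/=; apply: eq_bigl => k; first by rewrite inE.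
rewrite allE outE big_split/= mulrA [in RHS](bigID (mem T))/=.
by congr (_ * _); exact: prod_bool.
Qed.

(** The two signs exclude each other because [D < n] leaves a point off [T]. *)
Lemma same_side_terms (X : 'I_n -> E) (T : {set 'I_n}) : (D < n)%N -> #|T| = D ->
  ([forall k, (k \notin T) ==> (0 < 1 * adets (pts X T) (X k))]%:R +
   [forall k, (k \notin T) ==> (0 < -1 * adets (pts X T) (X k))]%:R)%R =
  `[< same_side X T >]%:R :> R.
Proof.
move=> Dn TD.
have [k0] : exists x, x \in ~: T.
  by apply/card_gt0P; rewrite cardsCs finset.setCK card_ord TD subn_gt0.
rewrite inE => k0T.
set a := [forall k, _]; set b := [forall k, _].
have aP : a = `[< forall k, k \notin T -> 0 < adets (pts X T) (X k) >].
  apply/forallP/asboolP => h k; first by move=> kT; have := h k; rewrite kT mul1r.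
  by apply/implyP => kT; rewrite mul1r; exact: h.
have bP : b = `[< forall k, k \notin T -> adets (pts X T) (X k) < 0 >].
  apply/forallP/asboolP => h k; first by move=> kT; have := h k; rewrite kT mulN1r oppr_gt0.
  by apply/implyP => kT; rewrite mulN1r oppr_gt0; exact: h.
rewrite aP bP /same_side.
case: asboolP => ha; case: asboolP => hb; case: asboolP => h; rewrite ?addr0 ?add0r//.
- by have := lt_trans (ha _ k0T) (hb _ k0T); rewrite ltxx.
- by have := lt_trans (ha _ k0T) (hb _ k0T); rewrite ltxx.
- by exfalso; apply: h; left.
- by exfalso; apply: h; right.
- by case: h.
Qed.

Lemma facet_sum (X : 'I_n -> E) : (D < n)%N -> genpos X ->
  (((\prod_(k < n) \1_K (X k)) * (fnum X (D - 1))%:R)%:E =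
  \sum_(T : {set 'I_n} | #|T| == D) (facet_term 1 T X + facet_term (-1) T X))%E.
Proof.
move=> Dn gX.
rewrite [RHS](eq_bigr (fun T => ((\prod_(k < n) \1_K (X k)) * `[< same_side X T >]%:R)%:E)); last first.
  by move=> T /eqP TD; rewrite !facet_termE// -EFinD -mulrDr same_side_terms.
rewrite sumEFin -mulr_sumr; congr EFin; congr (_ * _).
rewrite /fnum subn1/= (@eq_card _ _ [pred T : {set 'I_n} | (#|T| == D) && `[< same_side X T >]]).
  by rewrite -sum1_card natr_sum big_mkcondr/=; apply: eq_bigr => T _; case: ifP.
move=> T.
have h := facetP T (ltn0Sn d) Dn gX.
apply/idP/idP; rewrite !inE /=.
  by move=> /andP[/asboolP f /eqP a]; have [-> ss] := h.1 (conj f a); rewrite eqxx; apply/asboolP.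
by move=> /andP[/eqP TD /asboolP ss]; have [f ->] := h.2 (conj TD ss); rewrite eqxx andbT; apply/asboolP.
Qed.

(** The number [L_n]; each [D]-subset of the points contributes the same amount to the expected
    number of facets. *)
Definition facet_int : \bar R := (\int[pmu R D D]_ys ((all_in ys)%:E *
  (cap 1 ys ^+ (n - D) + cap (-1) ys ^+ (n - D))))%E.

Lemma facet_term_int s (T : {set 'I_n}) : #|T| = D ->
  pint n (fun xs => facet_term s T (fun k => nth 0 xs k)) =
  (\int[pmu R D D]_ys ((all_in ys)%:E * cap s ys ^+ (n - D)))%E /\
  measurable_fun setT (fun xs : seq E => facet_term s T (fun k => nth 0 xs k)).
Proof.
move=> TD.
pose m := [seq k \in T | k <- enum 'I_n].
have sm : size m = n by rewrite size_map size_enum_ord.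
have selE (b : bool -> bool) (S : {set 'I_n}) : (forall k, (k \in S) = b (k \in T)) ->
    forall xs : seq E, pts (fun k : 'I_n => nth 0 xs k) S = sel (selm (map b m)) xs.
  move=> Sb xs; rewrite /sel /selm size_map sm -val_enum_ord -map_mask -map_comp.
  rewrite /m -map_comp (eq_map (g := mem S)) -?filter_mask; last by move=> k; rewrite /= Sb.
  by rewrite /pts; congr (map _ _); rewrite [in RHS]enumT.
have s1 (xs : seq E) : pts (fun k : 'I_n => nth 0 xs k) T = sel (selm m) xs.
  by rewrite (selE id)// map_id.
have s2 (xs : seq E) : pts (fun k : 'I_n => nth 0 xs k) (~: T) = sel (selm (map negb m)) xs.
  by apply: selE => k; rewrite inE.
have cm : count id m = D.
  by rewrite count_map -size_filter -TD cardE [in LHS]enumT.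
have cn : count negb m = (n - D)%N.
  by rewrite -cm -[in RHS]sm -(count_predC id) addKn.
have mB : measurable_fun setT (fun p : E * seq E => (half_ind s p)%:E).
  by apply/measurable_EFinP; exact: measurable_half_ind.
have mA : measurable_fun setT (fun ys => (all_in ys)%:E).
  by apply/measurable_EFinP; exact: measurable_all_in.
have mf : measurable_fun setT (fun xs : seq E => facet_term s T (fun k => nth 0 xs k)).
  rewrite /facet_term; under eq_fun do rewrite s1 s2.
  apply: emeasurable_funM; first exact: (measurableT_comp mA (measurable_sel _)).
  apply: (@measurable_eprod_sel _ _ _ _ (fun p => (half_ind s (p.1, sel (selm m) p.2))%:E) _ id) => //.
  apply: (measurableT_comp mB); apply: measurable_fun_pair => //.
  exact: (measurableT_comp (measurable_sel _) measurable_snd).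
split=> //.
rewrite -pmuE//; last first.
  move=> xs; rewrite mule_ge0 ?lee_fin ?all_in_ge0// eprod_ge0// => x.
  by rewrite lee_fin half_ind_ge0.
rewrite /facet_term; under eq_integral do rewrite s1 s2.
rewrite -{1}sm (mask_integral m mA mB); first by rewrite cm cn.
- by move=> y; rewrite lee_fin all_in_ge0.
- by move=> p; rewrite lee_fin half_ind_ge0.
Qed.

(** [kappa] will be 1 for facets and [D / 2] for ridges. The face number is first replaced almost
    everywhere by the measurable sum of facet terms, whose integrals do not depend on the subset. *)
Lemma facet_expectation (kappa : R) i : (D < n)%N -> 0 <= kappa ->
  (forall X : 'I_n -> E, genpos X -> (fnum X i)%:R = kappa * (fnum X (D - 1))%:R :> R) ->
  iint (n * D) (fun s => ((\prod_(k < n) (\1_K (@points_of R D n s k) : R)) *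
     (fnum (@points_of R D n s) i)%:R)%:E) =
  (kappa%:E * ('C(n, D)%:R%:E * facet_int))%E.
Proof.
move=> Dn k0 fk.
pose Gf (X : 'I_n -> E) : \bar R := (kappa%:E *
  \sum_(T : {set 'I_n} | #|T| == D) (facet_term 1 T X + facet_term (-1) T X))%E.
have ft0 s T X : (0 <= facet_term s T X)%E.
  rewrite mule_ge0 ?lee_fin ?all_in_ge0// eprod_ge0// => x.
  by rewrite lee_fin half_ind_ge0.
have p0 (X : 'I_n -> E) : 0 <= \prod_(k < n) \1_K (X k) :> R.
  by apply: prodr_ge0 => k _; rewrite indicE.
rewrite (@eq_iint_inull R _ _ _ (fun s => Gf (@points_of R D n s)) _ _ _ (@genpos_inull R d n)); first last.
- move=> s /contrapT gX; rewrite /Gf -facet_sum// -EFinM fk//; congr EFin; ring.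
- move=> s; rewrite mule_ge0 ?lee_fin// sume_ge0// => T _; exact: adde_ge0.
- by move=> s; rewrite lee_fin mulr_ge0.
rewrite (iint_pint Gf) -pmuE; first last.
- move=> s; rewrite mule_ge0 ?lee_fin// sume_ge0// => T _; exact: adde_ge0.
- apply: measurable_funeM; apply: emeasurable_sum_cond => T /eqP TD.
  by apply: emeasurable_funD; apply: (facet_term_int _ TD).2.
have mft s (T : {set 'I_n}) : #|T| == D ->
    measurable_fun setT (fun xs : seq E => facet_term s T (fun k => nth 0 xs k)).
  by move=> /eqP TD; exact: (facet_term_int _ TD).2.
have mcs s : measurable_fun setT (fun ys => (all_in ys)%:E * cap s ys ^+ (n - D))%E.
  have mA : measurable_fun setT (fun ys => (all_in ys)%:E).
    by apply/measurable_EFinP; exact: measurable_all_in.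
  by apply: emeasurable_funM => //; apply: measurable_pow; exact: measurable_cap.
have cs0 s ys : (0 <= (all_in ys)%:E * cap s ys ^+ (n - D))%E.
  by rewrite mule_ge0 ?lee_fin ?all_in_ge0// expe_ge0// cap_ge0.
have FE : facet_int = (\int[pmu R D D]_ys ((all_in ys)%:E * cap 1 ys ^+ (n - D)) +
    \int[pmu R D D]_ys ((all_in ys)%:E * cap (-1) ys ^+ (n - D)))%E.
  rewrite /facet_int -ge0_integralD//; apply: eq_integral => ys _.
  by rewrite ge0_muleDr// expe_ge0// cap_ge0.
rewrite /Gf -integral_scale//; first last.
- by move=> xs; apply: sume_ge0 => T _; exact: adde_ge0.
- apply: emeasurable_sum_cond => T /eqP TD.
  by apply: emeasurable_funD; apply: (facet_term_int _ TD).2.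
congr (_ * _)%E.
transitivity (\sum_(T : {set 'I_n} | #|T| == D) facet_int)%E; last first.
  rewrite sumr_const (_ : #|_| = 'C(n, D)); first by rewrite mule_natl.
  by rewrite -[in RHS](card_ord n) -card_draws; apply: eq_card => T; rewrite !inE.
under eq_integral do rewrite big_mkcond/=.
rewrite ge0_integral_sum//; first last.
- by move=> T xs _; case: ifP => // _; exact: adde_ge0.
- by move=> T; case: (boolP (#|T| == D)) => [TD|_]; [apply: emeasurable_funD; exact: mft|exact: measurable_cst].
rewrite [RHS]big_mkcond/=; apply: eq_bigr => T _.
case: (boolP (#|T| == D)) => [TD|_]; last by rewrite integral0.
rewrite ge0_integralD//; [|exact: mft|exact: mft].
by rewrite FE -!(facet_term_int _ (eqP TD)).1 !pmuE//; exact: mft.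
Qed.

End facet_expectation.

(** * Second-order calculus *)

Section vector_norm.
Variables (R : realType) (d : nat).
Local Notation E := 'rV[R]_d.

Lemma coord_le_norm (w : E) j : `|w 0 j| <= `|w|.
Proof.
rewrite [X in _ <= X]/Num.norm/= mx_normrE.
by rewrite (le_trans _ (le_bigmax _ _ (ord0, j))).
Qed.

Lemma norm_le_coord (w : E) M : 0 <= M -> (forall j, `|w 0 j| <= M) -> `|w| <= M.
Proof.
move=> M0 h; rewrite [X in X <= _]/Num.norm/= mx_normrE.
by apply: bigmax_le => // -[i j] _ /=; rewrite (ord1 i).
Qed.

Lemma norm_evec (j : 'I_d) : `|evec R j| = 1.
Proof.
apply/eqP; rewrite eq_le; apply/andP; split.
  apply: norm_le_coord => // k; rewrite /evec mxE eqxx/=.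
  by case: (_ == _); rewrite ?normr1 ?normr0.
by have := coord_le_norm (evec R j) j; rewrite /evec mxE !eqxx normr1.
Qed.

Lemma nbhs_normP (x : E) (P : set E) :
  nbhs x P <-> exists2 r, 0 < r & forall z, `|z - x| < r -> P z.
Proof.
split=> [/nbhs_ballP[r /= r0 h]|[r r0 h]].
  by exists r => // z zx; apply: h; rewrite -ball_normE /ball_/= distrC.
apply/nbhs_ballP; exists r => // z; rewrite -ball_normE /ball_/= distrC; exact: h.
Qed.

Lemma within_continuous_norm (f : E -> R) (U : set E) x : open U ->
  {within U, continuous f} -> U x ->
  forall e, 0 < e -> exists2 r, 0 < r & forall z, `|z - x| < r -> `|f z - f x| < e.
Proof.
move=> oU; rewrite continuous_open_subspace// => cf Ux e e0.
have /cvgrPdist_lt /(_ e e0) := cf x (mem_set Ux).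
move=> /nbhs_normP[r r0 h]; exists r => // z zx.
by rewrite distrC; exact: h.
Qed.

End vector_norm.

Lemma dist_half (R : realFieldType) (A B C e : R) :
  `|A - B| < e / 2 -> `|A - C| < e / 2 -> `|B - C| <= e.
Proof. by rewrite !ltr_norml !ler_norml => /andP[? ?] /andP[? ?]; apply/andP; split; lra. Qed.

Section calculus.
Variables (R : realType) (d : nat).
Local Notation E := 'rV[R]_d.
Implicit Types (g : E -> R) (x v w z : E).

Lemma is_derive_line g x v (t : R) : derivable g (x + t *: v) v ->
  is_derive t 1 (fun s : R => g (x + s *: v)) ('D_v g (x + t *: v)).
Proof.
move=> dg.
have E1 : (fun h : R => h^-1 *: (((fun s : R => g (x + s *: v)) \o shift t) (h *: 1) -
    (fun s : R => g (x + s *: v)) t)) =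
    (fun h : R => h^-1 *: ((g \o shift (x + t *: v)) (h *: v) - g (x + t *: v))).
  apply/funext => h /=; congr (_ *: (g _ - _)).
  by rewrite [h *: 1]mulr1 scalerDl addrCA.
by split; [rewrite /derivable E1|rewrite /derive E1].
Qed.

Lemma mvt_closed (F F' : R -> R) (a b : R) : a <= b ->
  (forall t, t \in `[a, b] -> is_derive t (1 : R) F (F' t)) ->
  exists2 c, c \in `[a, b] & F b - F a = F' c * (b - a).
Proof.
move=> ab dF.
have dF1 (t : R) : t \in `]a, b[ -> is_derive t (1 : R) F (F' t).
  by move=> ts; apply: dF; apply: subset_itv_oo_cc.
have dF2 : {in `[a, b], forall t : R, derivable F t 1}.
  by move=> t ts; have [] := dF t ts.
exact: (MVT_segment ab dF1 (derivable_within_continuous dF2)).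
Qed.

Lemma mvt_line g x v (s : R) :
  (forall t, `|t| <= `|s| -> derivable g (x + t *: v) v) ->
  exists c, `|c| <= `|s| /\ g (x + s *: v) - g x = s * 'D_v g (x + c *: v).
Proof.
move=> dg; pose F (t : R) := g (x + t *: v); pose F' (t : R) := 'D_v g (x + t *: v).
have F0 : F 0 = g x by rewrite /F scale0r addr0.
have dF t : `|t| <= `|s| -> is_derive t (1 : R) F (F' t).
  by move=> ts; apply: is_derive_line; apply: dg.
have [s0|s0] := leP 0 s.
  have [t|c] := @mvt_closed F F' 0 s s0.
    rewrite in_itv/= => /andP[t0 ts]; apply: dF.
    by rewrite !ger0_norm.
  rewrite in_itv/= => /andP[c0 cs]; rewrite F0 subr0 mulrC => e; exists c; split => //.
  by rewrite !ger0_norm.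
have [t|c] := @mvt_closed F F' s 0 (ltW s0).
  rewrite in_itv/= => /andP[t0 ts]; apply: dF.
  by rewrite !ler0_norm ?lerN2// ltW.
rewrite in_itv/= => /andP[c0 cs]; rewrite F0 sub0r => e; exists c; split.
  by rewrite !ler0_norm ?lerN2// ltW.
by rewrite -/(F s) -opprB e mulrN opprK mulrC.
Qed.

Definition trunc_vec (k : nat) w : E := \row_(j < d) (if (j < k)%N then w 0 j else 0).

Lemma trunc_vecS (k : 'I_d) w : trunc_vec k.+1 w = trunc_vec k w + w 0 k *: evec R k.
Proof.
apply/rowP => j; rewrite !mxE eqxx/= ltnS leq_eqVlt.
have [->|jk] := eqVneq j k; first by rewrite eqxx ltnn add0r mulr1.
by rewrite (negbTE (_ : val j != k)) ?mulr0 ?addr0.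
Qed.

(** Only partial derivatives are given, so the increment is telescoped along the path through the
    vectors [trunc_vec k w], which changes one coordinate at a time, with the mean value theorem on
    each edge. *)
Lemma grad_approx g x w e : 0 <= e ->
  (forall z, `|z - x| <= `|w| -> forall j, derivable g z (evec R j) /\
     `|partial j g z - partial j g x| <= e) ->
  `|g (x + w) - g x - \sum_j w 0 j * partial j g x| <= d%:R * e * `|w|.
Proof.
move=> e0 h.
have -> : g (x + w) - g x = \sum_(k < d) (g (x + trunc_vec k.+1 w) - g (x + trunc_vec k w)).
  rewrite -(big_mkord xpredT (fun k => g (x + trunc_vec k.+1 w) - g (x + trunc_vec k w))).
  rewrite (telescope_sumr (fun k => g (x + trunc_vec k w)))//; congr (g _ - g _).
    by congr (_ + _); apply/rowP => j; rewrite mxE ltn_ord.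
  by rewrite (_ : trunc_vec 0 w = 0) ?addr0//; apply/rowP => j; rewrite !mxE.
rewrite -sumrB.
have step (k : 'I_d) : `|g (x + trunc_vec k.+1 w) - g (x + trunc_vec k w) -
    w 0 k * partial k g x| <= e * `|w|.
  have near (c : R) : `|c| <= `|w 0 k| -> `|x + trunc_vec k w + c *: evec R k - x| <= `|w|.
    move=> cw.
    have -> : x + trunc_vec k w + c *: evec R k - x = trunc_vec k w + c *: evec R k.
      by rewrite addrAC [x + _]addrC addrK.
    apply: norm_le_coord => // j; rewrite !mxE eqxx/=.
    have [->|jk] := eqVneq j k.
      by rewrite ltnn add0r mulr1 (le_trans cw)// coord_le_norm.
    by rewrite mulr0 addr0; case: ifP => _; rewrite ?normr0// coord_le_norm.
  have [|c [cw e1]] := @mvt_line g (x + trunc_vec k w) (evec R k) (w 0 k).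
    by move=> t tw; exact: (h _ (near _ tw) k).1.
  rewrite trunc_vecS addrA e1 -mulrBr normrM mulrC ler_pM//.
    exact: (h _ (near _ cw) k).2.
  exact: coord_le_norm.
apply: (le_trans (ler_norm_sum _ _ _)).
apply: (@le_trans _ _ (\sum_(k < d) (e * `|w|))); first by apply: ler_sum => k _.
by rewrite sumr_const card_ord -[X in X <= _]mulr_natl mulrA.
Qed.

Definition hquad g x w : R := \sum_j \sum_k w 0 j * w 0 k * partial k (partial j g) x.

(** The chain rule along a line, from continuity of the partial derivatives: [grad_approx] bounds
    the error of the difference quotient. *)
Lemma line_derive g U x w : open U -> C2_on U g -> U x ->
  forall t : R, U (x + t *: w) ->
  is_derive t 1 (fun s : R => g (x + s *: w)) (\sum_j w 0 j * partial j g (x + t *: w)).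
Proof.
move=> oU [cg dg cdg ddg cddg] Ux t Ut; set z := x + t *: w in Ut *.
set L := \sum_j _.
have lim : (fun h : R => h^-1 *: (((fun s : R => g (x + s *: w)) \o shift t) (h *: 1) -
    (fun s : R => g (x + s *: w)) t)) h @[h --> 0^'] --> L.
  apply/cvgrPdist_le => e e0.
  (* Chosen so that [d * e1 * |w| <= e]. *)
  pose e1 := e / (1 + d%:R * `|w|).
  have den0 : 0 < 1 + d%:R * `|w| by rewrite ltr_wpDr// mulr_ge0.
  have e10 : 0 < e1 by rewrite divr_gt0.
  have [r r0 hr] : exists2 r, 0 < r & forall y, `|y - z| < r -> U y /\
      forall j, `|partial j g y - partial j g z| <= e1.
    have : \forall y \near z, U y /\ forall j, `|partial j g y - partial j g z| <= e1.
      apply: filterI; first exact: open_nbhs_nbhs.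
      suff hj (j : 'I_d) : nbhs z [set y | `|partial j g y - partial j g z| <= e1].
        exact: (@filter_forall _ _ _ (nbhs z) _ hj).
      apply/nbhs_normP.
      have [r r0 hr] := within_continuous_norm oU (cdg j) Ut e10.
      by exists r => // y yz; exact: ltW (hr y yz).
    by move=> /nbhs_normP[r r0 hr]; exists r.
  have w1 : 0 < 1 + `|w| by rewrite ltr_wpDr.
  near=> h.
  have h0 : h != 0 by near: h; exact: nbhs_dnbhs_neq.
  have hw : `|h *: w| < r.
    rewrite normrZ (le_lt_trans (_ : _ <= `|h| * (1 + `|w|)))//.
      by rewrite ler_wpM2l// lerDr.
    rewrite -ltr_pdivlMr//; near: h; apply: dnbhs0_lt; exact: divr_gt0.
  have key : `|g (z + h *: w) - g z - \sum_j (h *: w) 0 j * partial j g z| <= d%:R * e1 * `|h *: w|.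
    apply: grad_approx; first exact: ltW.
    move=> y yz j; have [Uy hy] := hr y (le_lt_trans yz hw); split; first exact: dg.
    exact: hy.
  have sumE : \sum_j (h *: w) 0 j * partial j g z = h * L.
    by rewrite /L mulr_sumr; apply: eq_bigr => j _; rewrite mxE mulrA.
  rewrite sumE in key; rewrite /= [h *: 1]mulr1 [h + t]addrC scalerDl addrA -/z.
  rewrite distrC.
  have -> : h^-1 *: (g (z + h *: w) - g z) - L = h^-1 * (g (z + h *: w) - g z - h * L).
    by rewrite mulrBr mulKf.
  rewrite normrM normfV ler_pdivrMl ?normr_gt0//.
  apply: (le_trans key); rewrite normrZ mulrA [_ * `|h|]mulrC -!mulrA ler_wpM2l//.
  by rewrite mulrCA ler_piMr ?(ltW e0)// mulrCA ler_pdivrMl// mulr1 lerDr.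
split; first by apply/cvg_ex; exists L.
by rewrite /derive; apply: cvg_lim.
Unshelve. all: by end_near. Qed.

(** Mean value theorem for [psi], the restriction to the segment minus its expected linear and
    quadratic terms; the derivative of [psi] is controlled by [grad_approx] applied to each partial
    derivative. *)
Lemma taylor2 g U x w e : open U -> C2_on U g -> U x -> 0 <= e ->
  (forall z, `|z - x| <= `|w| -> U z /\ forall j k,
     `|partial k (partial j g) z - partial k (partial j g) x| <= e) ->
  `|g (x + w) - g x - \sum_j w 0 j * partial j g x - hquad g x w / 2|
     <= d%:R ^+ 2 * e * `|w| ^+ 2.
Proof.
move=> oU cU Ux e0 h; have [cg dg cdg ddg cddg] := cU.
pose q := hquad g x w; pose l := \sum_j w 0 j * partial j g x.
pose psi (t : R) := g (x + t *: w) - l * t - q / 2 * t ^+ 2.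
pose dpsi (t : R) := \sum_j w 0 j * partial j g (x + t *: w) - l - q * t.
have segU (t : R) : t \in `[0, 1] -> `|x + t *: w - x| <= `|w|.
  rewrite in_itv/= => /andP[t0 t1]; rewrite addrC addKr normrZ ger0_norm//.
  by rewrite ler_piMl.
have dpsiP (t : R) : t \in `[0, 1] -> is_derive t 1 psi (dpsi t).
  move=> t01; have Ut := (h _ (segU t t01)).1.
  have d1 := line_derive oU cU Ux Ut.
  rewrite /psi /dpsi.
  have d2 : is_derive t 1 (fun s : R => l * s) l.
    by apply: is_derive_eq; rewrite scaler1 ?mulr1.
  have d3 : is_derive t 1 (fun s : R => q / 2 * s ^+ 2) (q * t).
    apply: is_derive_eq; rewrite ?scaler1 ?expr1.
    by rewrite -[LHS]/(q / 2 * (t + t)); field.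
  exact: is_deriveB.
have [c cs e1] := mvt_closed ler01 dpsiP.
have -> : g (x + w) - g x - l - q / 2 = psi 1 - psi 0.
  by rewrite /psi scale1r scale0r addr0; ring.
rewrite e1 subr0 mulr1 /dpsi /l.
have c01 := cs; move: cs; rewrite in_itv/= => /andP[c0 c1].
have -> : \sum_j w 0 j * partial j g (x + c *: w) - \sum_j w 0 j * partial j g x - q * c =
  \sum_j w 0 j * (partial j g (x + c *: w) - partial j g x -
     \sum_k (c *: w) 0 k * partial k (partial j g) x).
  rewrite -sumrB /q /hquad mulr_suml -sumrB; apply: eq_bigr => j _.
  rewrite !mulrBr; congr (_ - _ - _); rewrite mulr_suml mulr_sumr.
  by apply: eq_bigr => k _; rewrite mxE; ring.
apply: (le_trans (ler_norm_sum _ _ _)).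
have cw : `|c *: w| <= `|w| by rewrite normrZ ger0_norm// ler_piMl.
have step j : `|w 0 j * (partial j g (x + c *: w) - partial j g x -
     \sum_k (c *: w) 0 k * partial k (partial j g) x)| <= `|w| * (d%:R * e * `|w|).
  rewrite normrM ler_pM// ?coord_le_norm//.
  apply: (@le_trans _ _ (d%:R * e * `|c *: w|)); last first.
    by rewrite ler_wpM2l// mulr_ge0.
  apply: grad_approx => // z zx k.
  have [Uz hz] := h z (le_trans zx cw).
  by split; [exact: ddg|exact: hz].
apply: (le_trans (ler_sum _ (fun j _ => step j))).
by rewrite sumr_const card_ord -mulr_natl; rewrite le_eqVlt; apply/orP; left; apply/eqP; ring.
Qed.

(** Schwarz: the second difference of [g] over a square of side [s] equals [s * s] times either
    mixed derivative at some nearby point, and continuity brings both back to [x]. *)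
Lemma partial_sym g U x j k : open U -> C2_on U g -> U x ->
  partial k (partial j g) x = partial j (partial k g) x.
Proof.
move=> oU [cg dg cdg ddg cddg] Ux.
apply/eqP; rewrite -subr_eq0 -normr_le0; apply/ler_addgt0Pl => e e0; rewrite addr0.
have e2 : 0 < e / 2 by rewrite divr_gt0.
have [r r0 hr] : exists2 r, 0 < r & forall y, `|y - x| < r -> U y /\
    (`|partial k (partial j g) y - partial k (partial j g) x| < e / 2 /\
     `|partial j (partial k g) y - partial j (partial k g) x| < e / 2).
  have : \forall y \near x, U y /\
    (`|partial k (partial j g) y - partial k (partial j g) x| < e / 2 /\
     `|partial j (partial k g) y - partial j (partial k g) x| < e / 2).
    apply: filterI; first exact: open_nbhs_nbhs.
    by apply: filterI; apply/nbhs_normP; apply: (@within_continuous_norm _ _ _ U).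
  by move=> /nbhs_normP[r r0 hr]; exists r.
(* Two steps of length at most [s] stay within radius [r]. *)
pose s := r / 3; have s0 : 0 < s by rewrite divr_gt0.
have near (a b : R) u v : `|u| <= 1 -> `|v| <= 1 -> `|a| <= s -> `|b| <= s ->
    `|x + a *: u + b *: v - x| < r.
  move=> u1 v1 a1 b1; have -> : x + a *: u + b *: v - x = a *: u + b *: v.
    by rewrite [x + _]addrC addrAC addrK.
  apply: (le_lt_trans (ler_normD _ _)); rewrite !normrZ.
  have : `|a| * `|u| <= s by rewrite -[s]mulr1 ler_pM.
  have : `|b| * `|v| <= s by rewrite -[s]mulr1 ler_pM.
  by rewrite /s; lra.
have sn : `|s| <= s by rewrite gtr0_norm.
have ev (i : 'I_d) : `|evec R i| <= 1 by rewrite norm_evec.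
have diff2 (i i' : 'I_d) : (forall y, U y -> derivable g y (evec R i)) ->
    (forall y, U y -> derivable (partial i g) y (evec R i')) ->
    exists2 y, `|y - x| < r & g (x + s *: evec R i + s *: evec R i') - g (x + s *: evec R i) -
      g (x + s *: evec R i') + g x = s * s * partial i' (partial i g) y.
  move=> di dii.
  pose G y := g (y + s *: evec R i') - g y.
  have dG (t : R) : `|t| <= `|s| -> derivable G (x + t *: evec R i) (evec R i) /\
     'D_(evec R i) G (x + t *: evec R i) =
       partial i g (x + t *: evec R i + s *: evec R i') - partial i g (x + t *: evec R i).
    rewrite (gtr0_norm s0) => ts.
    have U1 : U (x + t *: evec R i + s *: evec R i') by apply: (hr _ _).1; exact: near.
    have U2 : U (x + t *: evec R i).
      apply: (hr _ _).1; have := near t 0 _ (evec R i') (ev i) (ev i') ts.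
      by rewrite normr0 scale0r addr0; apply; exact: ltW.
    have d1 : is_derive (x + t *: evec R i) (evec R i) (fun y => g (y + s *: evec R i'))
        (partial i g (x + t *: evec R i + s *: evec R i')).
      have E1 : (fun h : R => h^-1 *: (((fun y => g (y + s *: evec R i')) \o shift (x + t *: evec R i)) (h *: evec R i) -
          (fun y => g (y + s *: evec R i')) (x + t *: evec R i))) =
        (fun h : R => h^-1 *: ((g \o shift (x + t *: evec R i + s *: evec R i')) (h *: evec R i) -
           g (x + t *: evec R i + s *: evec R i'))).
        by apply/funext => h /=; rewrite !addrA.
      split; first by rewrite /derivable E1; exact: di.
      by rewrite /derive E1.
    have d2 : is_derive (x + t *: evec R i) (evec R i) g (partial i g (x + t *: evec R i)).
      by split => //; exact: di.
    by have [] := is_deriveB d1 d2.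
  have [t ts|c [cs e1]] := @mvt_line G x (evec R i) s; first exact: (dG t ts).1.
  rewrite (dG c cs).2 in e1; rewrite (gtr0_norm s0) in cs.
  have [t ts|c' [cs' e3]] := @mvt_line (partial i g) (x + c *: evec R i) (evec R i') s.
    rewrite (gtr0_norm s0) in ts; apply: dii; apply: (hr _ _).1; exact: near.
  exists (x + c *: evec R i + c' *: evec R i').
    by apply: near => //; rewrite (gtr0_norm s0) in cs'.
  by rewrite -mulrA -e3 -e1 /G; ring.
have [y1 y1r e1] := diff2 j k (fun y Uy => dg y Uy j) (fun y Uy => ddg y Uy j k).
have [y2 y2r e3] := diff2 k j (fun y Uy => dg y Uy k) (fun y Uy => ddg y Uy k j).
have e4 : partial k (partial j g) y1 = partial j (partial k g) y2.
  have ss : s * s != 0 by rewrite mulf_neq0 ?gt_eqF.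
  apply: (mulfI ss); rewrite -{1}e1 -e3 [x + s *: evec R k + _]addrAC.
  by congr (_ + _); exact: addrAC.
have [_ [h1 _]] := hr _ y1r; have [_ [_ h2]] := hr _ y2r.
move: h1 h2; rewrite e4; set A := partial j _ y2; set B := partial k _ _; set C := partial j _ _.
exact: dist_half.
Qed.

End calculus.

(** * Quadratic forms on a tangent hyperplane *)

Section bilinear_forms.
Variables (R : realType) (d : nat).
Local Notation E := 'rV[R]_d.
Implicit Types (H : 'M[R]_d) (u v w : E).

Lemma dotvC u v : dotv u v = dotv v u.
Proof. by rewrite !dotvE; apply: eq_bigr => j _; rewrite mulrC. Qed.

Lemma dotvDr u v w : dotv u (v + w) = dotv u v + dotv u w.
Proof. by rewrite dotvC dotvDl ![dotv _ u]dotvC. Qed.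

Lemma dotvZr a u v : dotv u (a *: v) = a * dotv u v.
Proof. by rewrite dotvC dotvZl dotvC. Qed.

Lemma dotvNr u v : dotv u (- v) = - dotv u v.
Proof. by rewrite dotvC dotvNl dotvC. Qed.

Lemma dotv0l v : dotv 0 v = 0.
Proof. by rewrite -(scale0r v) dotvZl mul0r. Qed.

Lemma dotv_ge0 u : 0 <= dotv u u.
Proof. by rewrite dotvE; apply: sumr_ge0 => j _; rewrite -expr2 sqr_ge0. Qed.

Lemma coord_le_dotv u j : u 0 j ^+ 2 <= dotv u u.
Proof.
rewrite dotvE (bigD1 j)//= -expr2 lerDl; apply: sumr_ge0 => k _.
by rewrite -expr2 sqr_ge0.
Qed.

Lemma dotv_eq0 u : dotv u u = 0 -> u = 0.
Proof.
move=> u0; apply/rowP => j; rewrite mxE; apply/eqP; rewrite -sqrf_eq0 eq_le sqr_ge0 andbT.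
by rewrite -u0 coord_le_dotv.
Qed.

Lemma dotv_gt0 u : u != 0 -> 0 < dotv u u.
Proof.
move=> u0; rewrite lt_neqAle dotv_ge0 andbT eq_sym; apply: contraNneq u0.
by move/dotv_eq0 ->.
Qed.

Lemma dotv_le u v : `|dotv u v| <= d%:R * `|u| * `|v|.
Proof.
rewrite dotvE; apply: (le_trans (ler_norm_sum _ _ _)).
apply: (@le_trans _ _ (\sum_(j < d) (`|u| * `|v|))).
  by apply: ler_sum => j _; rewrite normrM ler_pM// coord_le_norm.
by rewrite sumr_const card_ord -[X in X <= _]mulr_natl mulrA.
Qed.

Lemma norm_le_dotv1 u : dotv u u = 1 -> `|u| <= 1.
Proof.
move=> u1; apply: norm_le_coord => // j.
by rewrite -(@ler_pXn2r _ 2)// ?nnegrE// expr1n -normrX ger0_norm ?sqr_ge0// -u1 coord_le_dotv.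
Qed.

Definition bil H u v : R := dotv (u *m H) v.

Lemma bilDl H u v w : bil H (u + v) w = bil H u w + bil H v w.
Proof. by rewrite /bil mulmxDl dotvDl. Qed.
Lemma bilDr H u v w : bil H u (v + w) = bil H u v + bil H u w.
Proof. by rewrite /bil dotvDr. Qed.
Lemma bilZl H a u v : bil H (a *: u) v = a * bil H u v.
Proof. by rewrite /bil -scalemxAl dotvZl. Qed.
Lemma bilZr H a u v : bil H u (a *: v) = a * bil H u v.
Proof. by rewrite /bil dotvZr. Qed.
Lemma bilBl H u v w : bil H (u - v) w = bil H u w - bil H v w.
Proof. by rewrite bilDl -scaleN1r bilZl mulN1r. Qed.
Lemma bilBr H u v w : bil H u (v - w) = bil H u v - bil H u w.
Proof. by rewrite bilDr -scaleN1r bilZr mulN1r. Qed.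
Lemma bilC H u v : H^T = H -> bil H u v = bil H v u.
Proof.
move=> Hs; rewrite /bil /dotv.
have -> : u *m H *m v^T = (v *m H *m u^T)^T by rewrite !trmx_mul trmxK Hs mulmxA.
by rewrite mxE.
Qed.

Lemma bil_bound H : exists2 C, 0 < C & forall u v, `|bil H u v| <= C * `|u| * `|v|.
Proof.
exists (1 + \sum_k \sum_j `|H j k|).
  by rewrite ltr_wpDr// sumr_ge0// => k _; rewrite sumr_ge0.
move=> u v; rewrite /bil dotvE; apply: (le_trans (ler_norm_sum _ _ _)).
apply: (@le_trans _ _ ((\sum_k \sum_j `|H j k|) * `|u| * `|v|)); last first.
  by rewrite -!mulrA ler_wpM2r ?mulr_ge0// lerDr.
rewrite !mulr_suml; apply: ler_sum => k _; rewrite normrM ler_pM ?coord_le_norm//.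
rewrite mxE mulr_suml; apply: (le_trans (ler_norm_sum _ _ _)); apply: ler_sum => j _.
by rewrite normrM mulrC ler_wpM2l// coord_le_norm.
Qed.

End bilinear_forms.

Section definiteness.
Variables (R : realType) (d : nat).
Local Notation E := 'rV[R]_d.
Implicit Types (H : 'M[R]_d) (u v w : E).

(** Along [w' + al *: w] the form is affine in [al], since it vanishes at [w]; a nonzero slope [b]
    would let it reach -1. *)
Lemma psd_kernel H v w : H^T = H -> (forall w, dotv v w = 0 -> 0 <= bil H w w) ->
  dotv v w = 0 -> bil H w w = 0 -> forall w', dotv v w' = 0 -> bil H w w' = 0.
Proof.
move=> Hs psd vw w0 w' vw'; apply/eqP; apply/negP => /negP b0.
set b := bil H w w' in b0.
pose al := - (bil H w' w' + 1) / (2 * b).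
have /psd : dotv v (w' + al *: w) = 0 by rewrite dotvDr dotvZr vw vw' mulr0 addr0.
rewrite bilDl !bilDr !bilZl !bilZr w0 (bilC w' w Hs) -/b !mulr0 addr0.
have -> : bil H w' w' + al * b + al * b = -1.
  rewrite /al; field; exact: b0.
by rewrite oppr_ge0 ler10.
Qed.

(** If the form vanished at [w], then [w *m H] would be orthogonal to the whole hyperplane, hence
    equal to [be *: v], and [(w, - be)] would lie in the kernel of the bordered matrix. *)
Lemma bordered_nondegenerate H v w : H^T = H -> v != 0 ->
  (forall w, dotv v w = 0 -> 0 <= bil H w w) ->
  \det (block_mx H v^T v (0 : 'M[R]_1)) != 0 ->
  w != 0 -> dotv v w = 0 -> 0 < bil H w w.
Proof.
move=> Hs v0 psd det0 w0 vw; rewrite lt_neqAle psd// andbT eq_sym.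
apply: contra det0 => /eqP ww0.
have ker := psd_kernel Hs psd vw ww0.
pose be := dotv (w *m H) v / dotv v v.
have vv : dotv v v != 0 by rewrite gt_eqF// dotv_gt0.
have eq1 : w *m H = be *: v.
  apply/eqP; rewrite -subr_eq0; apply/eqP; apply: dotv_eq0.
  set z := w *m H - be *: v.
  have vz : dotv v z = 0.
    by rewrite /z dotvDr dotvNr dotvZr /be divfK// dotvC subrr.
  rewrite {1}/z dotvDl dotvNl dotvZl vz mulr0 subr0.
  exact: ker.
apply/det0P; exists (row_mx w (- be)%:M).
  by apply: contra w0 => /eqP/(congr1 lsubmx); rewrite row_mxKl linear0 => ->.
rewrite mul_row_block eq1 mulmx0 addr0 mul_scalar_mx -scalerDl subrr scale0r.
rewrite [w *m _](_ : _ = 0) ?row_mx0//.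
by apply/matrixP => i j; rewrite !ord1 [RHS]mxE -[LHS]/(dotv w v) dotvC.
Qed.

(** Finsler's lemma: a form positive on the hyperplane orthogonal to [v] becomes positive definite
    after adding a large multiple of the squared component along [v]. Compactness of the unit sphere
    makes the claim local; one constant [c] is both lower bound and inverse penalty, so that it can
    tend to 0. *)
Lemma penalized_coercive H v :
  (forall w, w != 0 -> dotv v w = 0 -> 0 < bil H w w) ->
  exists2 c, 0 < c & forall w, c * `|w| ^+ 2 <= bil H w w + dotv v w ^+ 2 / c.
Proof.
move=> pd; have [CH CH0 hCH] := bil_bound H.
pose S := [set w : E | `|w| = 1].
have cS : compact S.
  apply: bounded_closed_compact.
    by exists 1; split => // M M1 w /= ->; exact: ltW.
  have /preimage_closed := @closed_eq R 1; apply => x _.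
  exact: norm_continuous.
suff [c c0 hc] : exists2 c, 0 < c & forall w, S w -> c <= bil H w w + dotv v w ^+ 2 / c.
  exists c => // w; have [->|w0] := eqVneq w 0.
    by rewrite normr0 expr0n/= mulr0 /bil mul0mx dotv0l add0r divr_ge0 ?sqr_ge0// ltW.
  have n0 : 0 < `|w| by rewrite normr_gt0.
  have /hc : S (`|w|^-1 *: w).
    by rewrite /S/= normrZ normfV normr_id mulVf// gt_eqF.
  rewrite bilZl bilZr dotvZr => h.
  rewrite -ler_pdivlMr ?exprn_gt0//; apply: (le_trans h); rewrite le_eqVlt; apply/orP; left.
  by apply/eqP; field; rewrite !gt_eqF.
have /compact_near_coveringP/(_ R (0^'+) (fun c w => c <= bil H w w + dotv v w ^+ 2 / c)) := cS.
have key : forall w, S w -> \forall w' \near w & c \near 0^'+,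
    c <= bil H w' w' + dotv v w' ^+ 2 / c.
  move=> w0 Sw0.
  have d0 : 0 < d%:R + 1 :> R by rewrite ltr_wpDl.
  pose DN : R := (d%:R + 1) * (`|v| + 1).
  have DN0 : 0 < DN by rewrite mulr_gt0// ltr_wpDl.
  have near (r : R) : 0 < r -> r <= 1 -> forall w', `|w' - w0| < r ->
      [/\ `|w'| <= 2, `|bil H w' w' - bil H w0 w0| <= 3 * CH * r &
          `|dotv v w' - dotv v w0| <= DN * r].
    move=> r0 r1 w' ww'.
    have w2 : `|w'| <= 2.
      rewrite -(subrK w0 w') (le_trans (ler_normD _ _))// Sw0; move: ww' r1; lra.
    split => //.
      have -> : bil H w' w' - bil H w0 w0 = bil H (w' - w0) w' + bil H w0 (w' - w0).
        by rewrite bilBl bilBr addrA subrK.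
      apply: (le_trans (ler_normD _ _)).
      apply: (@le_trans _ _ (CH * r * 2 + CH * 1 * r)); last by rewrite le_eqVlt; apply/orP; left; apply/eqP; ring.
      apply: lerD; apply: (le_trans (hCH _ _)).
        by apply: ler_pM => //; [rewrite mulr_ge0// ltW|rewrite ler_wpM2l// ltW].
      by rewrite Sw0 ler_wpM2l ?mulr_ge0// ltW.
    rewrite -dotvNr -dotvDr; apply: (le_trans (dotv_le _ _)).
    by apply: ler_pM (mulr_ge0 _ _) _ (ler_pM _ _ _ _) (ltW ww') => //; rewrite lerDl.
  (* On the hyperplane the form itself is bounded below near [w0]; off it the penalty, of order
     [1 / c], takes over for small [c]. *)
  have [vw|vw] := eqVneq (dotv v w0) 0.
    have m0 : 0 < bil H w0 w0.
      by apply: pd => //; apply/eqP => w00; move: Sw0; rewrite /S/= w00 normr0 => /eqP; rewrite eq_sym oner_eq0.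
    set m := bil H w0 w0 in m0 near.
    pose r := Num.min 1 (m / (6 * CH)).
    have r0 : 0 < r by rewrite lt_min ltr01 divr_gt0// mulr_gt0.
    exists ([set w' | `|w' - w0| < r], [set c | 0 < c < m / 2]) => /=.
      split; first by apply/nbhs_normP; exists r.
      near=> c; apply/andP; split; near: c; first exact: nbhs_right_gt.
      by apply: nbhs_right_lt; rewrite divr_gt0.
    move=> [w' c]/= [ww' /andP[c0 cm]].
    have [] := near r r0 _ w' ww'; first by rewrite ge_min lexx.
    move=> _ h1 _.
    have h2 : 3 * CH * r <= m / 2.
      have : r <= m / (6 * CH) by rewrite ge_min lexx orbT.
      rewrite ler_pdivlMr ?mulr_gt0//; lra.
    have h3 : 0 <= dotv v w' ^+ 2 / c by rewrite divr_ge0 ?sqr_ge0// ltW.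
    move: h1; rewrite ler_norml => /andP[h1 _]; move: h1 h2 h3 cm; lra.
  have n0 : 0 < `|dotv v w0| by rewrite normr_gt0.
  set n := `|dotv v w0| in n0.
  pose r := Num.min 1 (n / (2 * DN)).
  have r0 : 0 < r by rewrite lt_min ltr01 divr_gt0// mulr_gt0.
  exists ([set w' | `|w' - w0| < r], [set c | 0 < c < Num.min 1 (n ^+ 2 / (4 * (1 + 4 * CH)))]) => /=.
    split; first by apply/nbhs_normP; exists r.
    near=> c; apply/andP; split; near: c; first exact: nbhs_right_gt.
    by apply: nbhs_right_lt; rewrite lt_min ltr01 divr_gt0 ?exprn_gt0// mulr_gt0// ltr_wpDr// mulr_ge0// ltW.
  move=> [w' c]/= [ww' /andP[c0]]; rewrite lt_min => /andP[c1 c2].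
  have [] := near r r0 _ w' ww'; first by rewrite ge_min lexx.
  move=> w2 _ h1.
  have h2 : DN * r <= n / 2.
    have : r <= n / (2 * DN) by rewrite ge_min lexx orbT.
    rewrite ler_pdivlMr ?mulr_gt0//; lra.
  have h3 : n / 2 <= `|dotv v w'|.
    have : n <= `|dotv v w'| + `|dotv v w' - dotv v w0|.
      by have := ler_normB (dotv v w') (dotv v w' - dotv v w0); rewrite subKr.
    by move: h1 h2; lra.
  have h4 : n ^+ 2 / 4 <= dotv v w' ^+ 2.
    have -> : n ^+ 2 / 4 = (n / 2) ^+ 2 by field.
    by rewrite -[X in _ <= X]ger0_norm ?sqr_ge0// normrX lerXn2r// ?nnegrE ?divr_ge0 ?ltW.
  have h5 : - (4 * CH) <= bil H w' w'.
    have : `|bil H w' w'| <= CH * 2 * 2.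
      apply: (le_trans (hCH _ _)); apply: ler_pM => //; first by rewrite mulr_ge0// ltW.
      by rewrite ler_wpM2l// ltW.
    by rewrite ler_norml => /andP[]; lra.
  have h6 : 1 + 4 * CH <= dotv v w' ^+ 2 / c.
    rewrite ler_pdivlMr//; apply: (le_trans _ h4).
    have CH1 : 0 < 4 * (1 + 4 * CH) by rewrite mulr_gt0// ltr_wpDr// mulr_ge0// ltW.
    rewrite ltr_pdivlMr// in c2; rewrite ler_pdivlMr//; apply: ltW; apply: le_lt_trans c2.
    by rewrite [X in _ <= X]mulrC mulrAC [_ * 4]mulrC.
  move: c1 h5 h6; lra.
move=> /(_ _ key) near; have : \forall c \near 0^'+, 0 < c /\ S `<=` (fun w => c <= bil H w w + dotv v w ^+ 2 / c).
  by apply: filterI => //; exact: nbhs_right_gt.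
by move=> /filter_ex[c [c0 hc]]; exists c.
Unshelve. all: by end_near. Qed.

End definiteness.

Lemma dist_double (R : realFieldType) (a b c e : R) :
  `|a - c| <= e -> `|b - c| <= e -> `|b - a| <= 2 * e.
Proof. by rewrite !ler_norml => /andP[? ?] /andP[? ?]; apply/andP; split; lra. Qed.

(** * Self-similarity of small caps *)

Section boundary_charts.
Variables (R : realType) (d : nat).
Local Notation E := 'rV[R]_d.
Implicit Types (K U : set E) (g : E -> R) (p q x w u : E).

Lemma mid_interior K x1 x2 : Defs.convex_set K -> K° x1 -> K x2 -> K° (2^-1 *: (x1 + x2)).
Proof.
move=> cK /nbhs_normP[r r0 hr] Kx2; apply/nbhs_normP; exists (r / 2); first by rewrite divr_gt0.
move=> z hz; have : K (2 *: z - x2).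
  apply: hr; have -> : 2 *: z - x2 - x1 = 2 *: (z - 2^-1 *: (x1 + x2)).
    by rewrite scalerBr scalerA divff// scale1r opprD addrA addrAC.
  by rewrite normrZ ger0_norm// mulrC -ltr_pdivlMr.
move=> /cK/(_ Kx2 2^-1); rewrite scalerBr scalerA.
have -> : 1 - 2^-1 = 2^-1 :> R by field.
rewrite mulVf// scale1r subrK; apply.
by rewrite invr_ge0 ler0n invf_le1 ?ler1n// ltr0n.
Qed.

Lemma sublevel_interior K U g x : open U -> U x -> {within U, continuous g} ->
  K `&` U = [set x | U x /\ g x <= 0] -> g x < 0 -> K° x.
Proof.
move=> oU Ux cg KU gx.
have : \forall z \near x, U z /\ g z < 0.
  apply: filterI; first exact: open_nbhs_nbhs.
  have [|r r0 hr] := within_continuous_norm oU cg Ux (e := - g x); first by rewrite oppr_gt0.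
  apply/nbhs_normP; exists r => // z /hr; rewrite ltr_norml => /andP[_]; lra.
apply: filterS => z [Uz gz]; suff : (K `&` U) z by case.
by rewrite KU; split => //; exact: ltW.
Qed.

Lemma hquadE g x w : hquad g x w = bil (hessian g x) w w.
Proof.
rewrite /bil dotvE /hquad exchange_big; apply: eq_bigr => k _.
rewrite mxE mulr_suml; apply: eq_bigr => j _; rewrite mxE; ring.
Qed.

Lemma dotv_gradient g x w : dotv (gradient g x) w = \sum_j w 0 j * partial j g x.
Proof. by rewrite dotvE; apply: eq_bigr => j _; rewrite mxE mulrC. Qed.

Lemma hessian_sym g U x : open U -> C2_on U g -> U x -> (hessian g x)^T = hessian g x.
Proof.
by move=> oU cU Ux; apply/matrixP => j k; rewrite !mxE; exact: partial_sym oU cU Ux.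
Qed.

(** The Hessian is frozen at [p] while the base point [q] of the expansion moves, so that one
    quadratic form serves all boundary points near [p]. *)
Lemma uniform_taylor g U p e : open U -> C2_on U g -> U p -> 0 < e ->
  exists2 r, 0 < r & [/\ (forall z, `|z - p| < r -> U z),
    (forall z, `|z - p| < r -> `|gradient g z - gradient g p| <= e) &
    (forall q w, `|q - p| < r -> `|w| < r ->
      `|g (q + w) - g q - dotv (gradient g q) w - bil (hessian g p) w w / 2| <= e * `|w| ^+ 2)].
Proof.
move=> oU cU Up e0; have [cg dg cdg ddg cddg] := cU.
pose N : R := (d%:R + 1) ^+ 2; have N0 : 0 < N by rewrite exprn_gt0// ltr_wpDl.
have dN : d%:R ^+ 2 <= N by rewrite lerXn2r ?nnegrE ?addr_ge0// lerDl.
(* With [N >= d ^ 2], second derivatives varying by [2 * e1] cost two thirds of [e] in [taylor2],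
   and replacing half the Hessian at [q] by half the one at [p] costs another sixth. *)
pose e1 := e / (3 * N); have e10 : 0 < e1 by rewrite divr_gt0// mulr_gt0.
have [r r0 hr] : exists2 r, 0 < r & forall z, `|z - p| < r -> U z /\
   ((forall j, `|partial j g z - partial j g p| <= e) /\
    (forall jk : 'I_d * 'I_d, `|partial jk.2 (partial jk.1 g) z - partial jk.2 (partial jk.1 g) p| <= e1)).
  suff : nbhs p [set z | U z /\ ((forall j, `|partial j g z - partial j g p| <= e) /\
    (forall jk : 'I_d * 'I_d, `|partial jk.2 (partial jk.1 g) z - partial jk.2 (partial jk.1 g) p| <= e1))].
    by move=> /nbhs_normP[r r0 hr]; exists r.
  apply: filterI; first exact: open_nbhs_nbhs.
  apply: filterI.
    suff hj (j : 'I_d) : nbhs p [set z | `|partial j g z - partial j g p| <= e].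
      exact: (@filter_forall _ _ _ (nbhs p) _ hj).
    have [r r0 hr] := within_continuous_norm oU (cdg j) Up e0.
    by apply/nbhs_normP; exists r => // z /hr/ltW.
  suff hj (jk : 'I_d * 'I_d) : nbhs p [set z | `|partial jk.2 (partial jk.1 g) z - partial jk.2 (partial jk.1 g) p| <= e1].
    exact: (@filter_forall _ _ _ (nbhs p) _ hj).
  have [r r0 hr] := within_continuous_norm oU (cddg jk.1 jk.2) Up e10.
  by apply/nbhs_normP; exists r => // z /hr/ltW.
exists (r / 2); first by rewrite divr_gt0.
have rr z : `|z - p| < r / 2 -> `|z - p| < r by lra.
split.
- by move=> z /rr/hr[].
- move=> z /rr/hr[_ [h _]]; apply: norm_le_coord; first exact: ltW.
  by move=> j; rewrite !mxE.
move=> q w qp wr.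
have qp' := rr _ qp; have [Uq [_ hq]] := hr q qp'.
have h z : `|z - q| <= `|w| -> U z /\ forall j k,
     `|partial k (partial j g) z - partial k (partial j g) q| <= 2 * e1.
  move=> zq; have zp : `|z - p| < r.
    have -> : z - p = (z - q) + (q - p) by rewrite addrA subrK.
    by apply: (le_lt_trans (ler_normD _ _)); lra.
  have [Uz [_ hz]] := hr z zp; split => // j k.
  have := hz (j, k); have := hq (j, k) => /=.
  set a := partial _ _ q; set b := partial _ _ z; set c := partial _ _ p.
  exact: dist_double.
have := taylor2 oU cU Uq (e := 2 * e1) _ h; rewrite -dotv_gradient => /(_ (mulr_ge0 (ler0n _ 2) (ltW e10))) t2.
have t3 : `|hquad g q w - hquad g p w| <= d%:R ^+ 2 * e1 * `|w| ^+ 2.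
  rewrite /hquad -sumrB.
  apply: (le_trans (ler_norm_sum _ _ _)).
  apply: (@le_trans _ _ (\sum_(j < d) (d%:R * e1 * `|w| ^+ 2))); last first.
    by rewrite sumr_const card_ord -[X in X <= _]mulr_natl le_eqVlt; apply/orP; left; apply/eqP; ring.
  apply: ler_sum => j _; rewrite -sumrB; apply: (le_trans (ler_norm_sum _ _ _)).
  apply: (@le_trans _ _ (\sum_(j < d) (e1 * `|w| ^+ 2))); last first.
    by rewrite sumr_const card_ord -[X in X <= _]mulr_natl le_eqVlt; apply/orP; left; apply/eqP; ring.
  apply: ler_sum => k _; rewrite -mulrBr !normrM mulrC ler_pM//; first exact: (hq (j, k)).
  by rewrite expr2 ler_pM ?coord_le_norm.
have wN : d%:R ^+ 2 * e1 * `|w| ^+ 2 <= e / 3 * `|w| ^+ 2.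
  have -> : e / 3 = N * e1 by rewrite /e1; field; exact: lt0r_neq0.
  by rewrite ler_wpM2r ?exprn_ge0// ler_wpM2r// ltW.
have -> : bil (hessian g p) w w = hquad g p w by rewrite hquadE.
move: t2 t3 wN; have -> : d%:R ^+ 2 * (2 * e1) * `|w| ^+ 2 = 2 * (d%:R ^+ 2 * e1 * `|w| ^+ 2) by ring.
move: (d%:R ^+ 2 * e1 * `|w| ^+ 2) (hquad g q w) (hquad g p w) => a A B.
move: (dotv _ _) (g (q + w)) (g q) => G g1 g0.
have -> : e / 3 * `|w| ^+ 2 = (e * `|w| ^+ 2) / 3 by field.
move: (e * `|w| ^+ 2) => b.
rewrite !ler_norml => /andP[? ?] /andP[? ?] ?; apply/andP; split; lra.
Qed.

(** A tangent direction [w] with negative second derivative would put both [p + t *: w] and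
    [p - t *: w] in the interior of [K], hence also their midpoint [p]. *)
Lemma convex_psd K U g p : Defs.convex_set K -> open U -> U p -> C2_on U g ->
  K `&` U = [set x | U x /\ g x <= 0] -> K p -> ~ K° p ->
  forall w, dotv (gradient g p) w = 0 -> 0 <= bil (hessian g p) w w.
Proof.
move=> cK oU Up cU KU Kp nKp w vw; rewrite leNgt; apply/negP => neg.
have [cg _ _ _ _] := cU.
have gp : g p <= 0 by have : (K `&` U) p by []; rewrite KU => -[].
set B := bil _ w w in neg.
have [w0|w0] := eqVneq w 0.
  by move: neg; rewrite /B w0 /bil mul0mx dotv0l ltxx.
have n0 : 0 < `|w| by rewrite normr_gt0.
(* With this value the Taylor error is half of the second-order decrease [t ^+ 2 * B / 2]. *)
pose e := - B / (4 * `|w| ^+ 2).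
have e0 : 0 < e by rewrite divr_gt0 ?oppr_gt0// mulr_gt0// exprn_gt0.
have [r r0 [hU _ ht]] := uniform_taylor oU cU Up e0.
pose t := r / (2 * `|w|); have t0 : 0 < t by rewrite divr_gt0// mulr_gt0.
have side (s : R) : `|s| = t -> K° (p + s *: w).
  move=> st; have swr : `|s *: w| < r.
    rewrite normrZ st /t invfM mulrA mulfVK ?gt_eqF//; lra.
  apply: (sublevel_interior oU _ cg KU); first by apply: hU; rewrite addrC addKr.
  have := ht p (s *: w); rewrite subrr normr0 => /(_ r0 swr).
  rewrite dotvZr vw mulr0 subr0 bilZl bilZr -/B normrZ st.
  have -> : s * (s * B) = t ^+ 2 * B by rewrite mulrA -expr2 -st real_normK ?num_real.
  have -> : e * (t * `|w|) ^+ 2 = - (t ^+ 2 * B) / 4 by rewrite /e; field; rewrite gt_eqF.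
  have tB : t ^+ 2 * B < 0 by rewrite pmulr_rlt0// exprn_gt0.
  by rewrite ler_norml => /andP[_]; move: gp tB; lra.
apply: nKp; have -> : p = 2^-1 *: ((p + t *: w) + (p + (- t) *: w)).
  rewrite scaleNr addrACA subrr addr0 -mulr2n -scalerMnr scalerMnl -[_ *+ 2]mulr_natr mulVf ?scale1r//.
apply: mid_interior => //; first by apply: side; rewrite gtr0_norm.
by apply: interior_subset; apply: side; rewrite normrN gtr0_norm.
Qed.

(** Convexity makes the Hessian semidefinite on the tangent space; positive curvature makes the
    bordered determinant nonzero, which excludes null directions. *)
Lemma chart_coercive K U g p : Defs.convex_set K -> open U -> U p -> C2_on U g ->
  K `&` U = [set x | U x /\ g x <= 0] -> K p -> ~ K° p ->
  gradient g p != 0 -> 0 < gauss_curvature g p ->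
  exists2 c, 0 < c & forall w, c * `|w| ^+ 2 <=
    bil (hessian g p) w w + dotv (gradient g p) w ^+ 2 / c.
Proof.
move=> cK oU Up cU KU Kp nKp v0 curv.
apply: penalized_coercive => w w0 vw.
apply: (bordered_nondegenerate (hessian_sym oU cU Up) v0) => //.
  exact: convex_psd cK oU Up cU KU Kp nKp.
by apply: contraTneq curv; rewrite /gauss_curvature => ->; rewrite oppr0 mul0r ltxx.
Qed.

End boundary_charts.

(** * Real inequalities behind the cap estimates *)

Section cap_algebra.
Variable R : realType.
Implicit Types (c k e B W : R).

(** A cap of depth [t] has width of order the square root of [t]. Here [W] is the distance to the
    support point, [B] the Hessian form and [V] the component along the gradient at the centre of
    the chart: Taylor bounds [B] above, coercivity bounds it below, and [V] is of order [t] up to a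
    small multiple of [W]. *)
Lemma coercive_bound c k k1 e t B W V : 0 < c -> 0 <= k -> k <= k1 -> 0 <= t <= 1 ->
  0 <= W -> e <= c / 8 -> B <= 2 * k * t + 2 * e * W ^+ 2 -> c * W ^+ 2 <= B + V ^+ 2 / c ->
  `|V| <= k * t + c / 4 * W -> W ^+ 2 <= (8 * k1 + 8 * k1 ^+ 2 / c) / c * t.
Proof.
move=> c0 k0 kk1 /andP[t0 t1] W0 ec hB hW hV.
have c2 : c / c = 1 by rewrite divff// gt_eqF.
have i0 : 0 < c^-1 by rewrite invr_gt0.
move: (c^-1) i0 c2 hW => i i0 ci hW.
have V2 : V ^+ 2 <= 2 * (k * t) ^+ 2 + 2 * (c / 4 * W) ^+ 2.
  have kt0 : 0 <= k * t by rewrite mulr_ge0.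
  have cW0 : 0 <= c / 4 * W by rewrite !mulr_ge0// ltW.
  have : V ^+ 2 <= (k * t + c / 4 * W) ^+ 2.
    by rewrite -[V ^+ 2]real_normK ?num_real// lerXn2r ?nnegrE ?addr_ge0.
  by move: (sqr_ge0 (k * t - c / 4 * W)); lra.
have V3 : V ^+ 2 * i <= 2 * k1 ^+ 2 * i * t + c / 8 * W ^+ 2.
  apply: (@le_trans _ _ ((2 * (k * t) ^+ 2 + 2 * (c / 4 * W) ^+ 2) * i)).
    by rewrite ler_wpM2r// ltW.
  have -> : (2 * (k * t) ^+ 2 + 2 * (c / 4 * W) ^+ 2) * i =
    2 * i * (k ^+ 2 * t ^+ 2) + (c * i) * (c / 8 * W ^+ 2) by field.
  rewrite ci mul1r lerD2r.
  have -> : 2 * k1 ^+ 2 * i * t = 2 * i * (k1 ^+ 2 * t) by ring.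
  rewrite ler_wpM2l ?mulr_ge0 ?(ltW i0)//; apply: ler_pM; rewrite ?sqr_ge0//.
    by rewrite lerXn2r ?nnegrE// (le_trans k0).
  by rewrite expr2 ler_piMr.
have eW : e * W ^+ 2 <= c / 8 * W ^+ 2 by rewrite ler_wpM2r ?sqr_ge0.
have kt : k * t <= k1 * t by rewrite ler_wpM2r.
have p1 : 0 <= k1 * t by rewrite mulr_ge0// (le_trans k0).
have p2 : 0 <= k1 ^+ 2 * i * t by exact: mulr_ge0 (mulr_ge0 (sqr_ge0 _) (ltW i0)) t0.
have key : c * W ^+ 2 <= (8 * k1 + 8 * k1 ^+ 2 * i) * t by move: p1 p2 hW hB V3 eW kt; lra.
have -> : (8 * k1 + 8 * k1 ^+ 2 * i) * i * t = i * ((8 * k1 + 8 * k1 ^+ 2 * i) * t) by ring.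
have -> : W ^+ 2 = i * (c * W ^+ 2) by rewrite mulrA [i * c]mulrC ci mul1r.
by rewrite ler_wpM2l// ltW.
Qed.

(** Scaling widths by [s] multiplies the quadratic term by [s ^+ 2], while passing to depth
    [lam * t] multiplies the linear term by [lam]. The gain [k * (lam - s ^+ 2) * t] pays for the
    Taylor errors and the terms involving the normal [u], so the image stays in the sublevel set. *)
Lemma depth_scaling s lam k k0 e b t C C0 W Bww Bwu Buu W' g' : s ^+ 2 < lam -> 0 < s ->
  0 < k0 -> k0 <= k -> 0 < C -> 0 < C0 -> 0 < e -> 0 < b <= 1 -> 0 < t <= b ->
  e * (3 * s ^+ 2 * C0 + 2 * (s - lam) ^+ 2) <= k0 * (lam - s ^+ 2) / 2 ->
  b * (s * `|s - lam| + (s - lam) ^+ 2) * C <= k0 * (lam - s ^+ 2) / 2 ->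
  0 <= W <= b -> W ^+ 2 <= C0 * t ->
  Bww / 2 <= k * t + e * W ^+ 2 -> `|Bwu| <= C * W -> `|Buu| <= C ->
  0 <= W' <= s * W + `|s - lam| * t ->
  g' <= - (k * lam * t) + (s ^+ 2 * Bww + 2 * s * ((s - lam) * t) * Bwu +
     ((s - lam) * t) ^+ 2 * Buu) / 2 + e * W' ^+ 2 ->
  g' <= 0.
Proof.
move=> sl s0 k00 kk C0' C00 e0 /andP[b0 b1] /andP[t0 tb] he hb /andP[W0 Wb] hW hB hBu hBuu /andP[W'0 hW'] hg.
have d2 : (s - lam) ^+ 2 = `|s - lam| ^+ 2 by rewrite real_normK ?num_real.
set d := `|s - lam| in d2 hb hW'.
have d0 : 0 <= d by exact: normr_ge0.
have x1 : W' ^+ 2 <= 2 * s ^+ 2 * (C0 * t) + 2 * d ^+ 2 * t.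
  have st0 : 0 <= s * W by rewrite mulr_ge0// ltW.
  have dt0 : 0 <= d * t by rewrite mulr_ge0// ltW.
  have h1 : W' ^+ 2 <= (s * W + d * t) ^+ 2 by rewrite lerXn2r ?nnegrE ?addr_ge0.
  have h2 := sqr_ge0 (s * W - d * t).
  have h3 : s ^+ 2 * W ^+ 2 <= s ^+ 2 * (C0 * t) by rewrite ler_wpM2l ?sqr_ge0.
  have h4 : d ^+ 2 * (t * t) <= d ^+ 2 * t.
    by rewrite ler_wpM2l ?sqr_ge0// ler_piMr ?(le_trans tb)// ltW.
  move: h1 h2 h3 h4; lra.
have x2 : (s - lam) * t * Bwu <= d * t * (C * b).
  apply: (le_trans (ler_norm _)); rewrite !normrM -/d (gtr0_norm t0).
  rewrite ler_wpM2l ?mulr_ge0 ?(ltW t0)//; apply: (le_trans hBu).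
  by rewrite ler_wpM2l// ltW.
have x3 : ((s - lam) * t) ^+ 2 * Buu <= d ^+ 2 * (t * b) * C.
  rewrite exprMn d2; apply: (@le_trans _ _ (d ^+ 2 * t ^+ 2 * C)).
    have BC := le_trans (ler_norm _) hBuu.
    by apply: ler_wpM2l => //; rewrite mulr_ge0// sqr_ge0.
  by rewrite ler_wpM2r ?(ltW C0')// ler_wpM2l ?sqr_ge0// expr2 ler_wpM2l// ltW.
have x4 : s ^+ 2 * (Bww / 2) <= s ^+ 2 * (k * t + e * (C0 * t)).
  by rewrite ler_wpM2l ?sqr_ge0// (le_trans hB)// lerD2l ler_wpM2l// ltW.
have x5 : e * W' ^+ 2 <= e * (2 * s ^+ 2 * (C0 * t) + 2 * d ^+ 2 * t) by rewrite ler_wpM2l// ltW.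
have x6 : s * ((s - lam) * t * Bwu) <= s * (d * t * (C * b)) by rewrite ler_wpM2l// ltW.
have x7 : 0 <= (k - k0) * (lam - s ^+ 2) * t.
  by rewrite !mulr_ge0 ?subr_ge0 ?(ltW sl) ?(ltW t0).
have x8 : 0 <= d ^+ 2 * (t * b) * C.
  exact: mulr_ge0 (mulr_ge0 (sqr_ge0 d) (mulr_ge0 (ltW t0) (ltW b0))) (ltW C0').
rewrite d2 in he hb.
have he' : e * (3 * s ^+ 2 * C0 + 2 * d ^+ 2) * t <= k0 * (lam - s ^+ 2) / 2 * t by rewrite ler_wpM2r// ltW.
have hb' : b * (s * d + d ^+ 2) * C * t <= k0 * (lam - s ^+ 2) / 2 * t by rewrite ler_wpM2r// ltW.
apply: (le_trans hg).
clear hg hB hBu hBuu hW' hW he hb x1 d2.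
move: x2 => _; move: x3 x4 x5 x6 x7 x8 he' hb'.
lra.
Qed.

End cap_algebra.

Section lagrange.
Variables (R : realType) (d : nat).
Local Notation E := 'rV[R]_d.
Implicit Types (K U : set E) (g : E -> R) (p q x w u : E).

(** Lagrange multipliers for one constraint: if [u] had a component [z] orthogonal to [G], then [z]
    tilted slightly against [G] would increase [dotv u] while decreasing [dotv G]. *)
Lemma support_direction (G u : E) : G != 0 -> u != 0 ->
  (forall w, dotv G w < 0 -> dotv u w <= 0) -> exists2 k, 0 < k & G = k *: u.
Proof.
move=> G0 u0 h; have GG := dotv_gt0 G0; have uu := dotv_gt0 u0.
pose be := dotv u G / dotv G G.
have orth : dotv G (u - be *: G) = 0.
  by rewrite dotvDr dotvNr dotvZr /be divfK ?gt_eqF// dotvC subrr.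
set z := u - be *: G in orth.
have zz : dotv z z = dotv u z.
  by rewrite {1}/z dotvDl dotvNl dotvZl orth mulr0 subr0.
have z0 : z = 0.
  apply: dotv_eq0; apply/eqP; rewrite eq_le dotv_ge0 andbT leNgt; apply/negP => zpos.
  pose eta := dotv z z / (2 * (`|dotv u G| + 1)).
  have N0 : 0 < `|dotv u G| + 1 by rewrite ltr_wpDl.
  have eta0 : 0 < eta by rewrite divr_gt0// mulr_gt0.
  have /h : dotv G (z - eta *: G) < 0.
    by rewrite dotvDr dotvNr dotvZr orth sub0r oppr_lt0 mulr_gt0.
  rewrite dotvDr dotvNr dotvZr -zz subr_le0 leNgt => /negP; apply.
  apply: (@le_lt_trans _ _ (eta * (`|dotv u G| + 1))).
    by rewrite ler_wpM2l ?(ltW eta0)// (le_trans (ler_norm _))// lerDl.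
  rewrite /eta; have -> : dotv z z / (2 * (`|dotv u G| + 1)) * (`|dotv u G| + 1) = dotv z z / 2.
    by field; rewrite gt_eqF.
  by rewrite ltr_pdivrMr// mulr_natr mulr2n ltrDl.
have ub : u = be *: G by apply/eqP; rewrite -subr_eq0 -/z z0.
have b0 : 0 < be.
  rewrite lt_neqAle eq_sym; apply/andP; split.
    by apply: contraNneq u0 => be0; rewrite ub be0 scale0r.
  have /h : dotv G (- G) < 0 by rewrite dotvNr oppr_lt0.
  by rewrite dotvNr oppr_le0 ub dotvZl pmulr_lge0.
exists be^-1; first by rewrite invr_gt0.
by rewrite {1}ub scalerA mulVf ?scale1r// gt_eqF.
Qed.

End lagrange.

Lemma bil_square (R : realType) (d : nat) (H : 'M[R]_d) a b w u : H^T = H ->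
  bil H (a *: w + b *: u) (a *: w + b *: u) =
  a ^+ 2 * bil H w w + 2 * a * b * bil H w u + b ^+ 2 * bil H u u.
Proof. by move=> Hs; rewrite bilDl !bilDr !bilZl !bilZr (bilC u w Hs); ring. Qed.

Section local_cap.
Variables (R : realType) (d : nat).
Local Notation E := 'rV[R]_d.
Implicit Types (K U : set E) (g : E -> R) (p q x w u : E).

(** At [q] the gradient of [g] is a positive multiple [a] of [u], so depth in direction [u] is the
    linear part of [g] and the Hessian describes the shape of the cap; Taylor at [q] then decides
    that the image point is in [K]. *)
Lemma local_cap_scaling K U g p (s lam : R) : Defs.convex_set K -> open U -> U p ->
  C2_on U g -> K `&` U = [set x | U x /\ g x <= 0] -> K p -> ~ K° p ->
  gradient g p != 0 -> 0 < gauss_curvature g p -> 0 < s -> s ^+ 2 < lam ->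
  exists2 t0, 0 < t0 & forall q, `|q - p| < t0 -> K q -> forall u, dotv u u = 1 ->
    (forall x, K x -> dotv u x <= dotv u q) -> forall x, K x -> 0 < dotv u (q - x) <= t0 ->
    K (q + (s *: (x - q) + ((s - lam) * dotv u (q - x)) *: u)).
Proof.
move=> cK oU Up cU KU Kp nKp v0 curv s0 slam.
have [cg _ _ _ _] := cU.
have inK x : U x -> g x <= 0 -> K x.
  by move=> Ux gx; have : (K `&` U) x; [rewrite KU|case].
have gK x : U x -> K x -> g x <= 0.
  by move=> Ux Kx; have : (K `&` U) x by []; rewrite KU => -[].
have [c c0 hc] := chart_coercive cK oU Up cU KU Kp nKp v0 curv.
set v := gradient g p in v0 hc; set H := hessian g p in hc.
have [C CC0 hC] := bil_bound H.
have nv0 : 0 < `|v| by rewrite normr_gt0.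
pose N : R := d%:R + 1; have N0 : 0 < N by rewrite ltr_wpDl.
(* [k0] and [k1] will bound the multiplier [a] from below and above; [C0] is the width constant of
   [coercive_bound]. *)
pose k0 := `|v| / 2; have k00 : 0 < k0 by rewrite divr_gt0.
pose k1 := N * (2 * `|v|).
have k10 : 0 < k1 by rewrite !mulr_gt0.
pose C0 := (8 * k1 + 8 * k1 ^+ 2 / c) / c.
have C00 : 0 < C0 by rewrite divr_gt0// addr_gt0// ?divr_gt0// mulr_gt0// exprn_gt0.
have gap : 0 < k0 * (lam - s ^+ 2) / 2 by rewrite divr_gt0// mulr_gt0// subr_gt0.
set ga := k0 * _ / 2 in gap.
pose Ne := 3 * s ^+ 2 * C0 + 2 * (s - lam) ^+ 2.
have Ne0 : 0 < Ne.
  apply: ltr_wpDr; first by rewrite mulr_ge0// sqr_ge0.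
  by apply: mulr_gt0 => //; apply: mulr_gt0 => //; exact: exprn_gt0.
(* In order: the gradient keeps at least half its size, its variation is absorbed by coercivity, so
   is the Taylor error, and the errors of [depth_scaling] use at most [ga]. *)
pose e := Num.min (Num.min (`|v| / 2) (c / (4 * N))) (Num.min (c / 8) (ga / Ne)).
have e0 : 0 < e.
  rewrite !lt_min; apply/andP; split; apply/andP; split; apply: divr_gt0 => //.
  exact: mulr_gt0.
have e1 : e <= `|v| / 2 by rewrite !ge_min lexx.
have e2 : e <= c / (4 * N) by rewrite !ge_min lexx !orbT.
have e3 : e <= c / 8 by rewrite !ge_min lexx !orbT.
have e4 : e * Ne <= ga by rewrite -ler_pdivlMr// !ge_min lexx !orbT.
have [r r0 [hU hG hT]] := uniform_taylor oU cU Up e0.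
pose Nb := (s * `|s - lam| + (s - lam) ^+ 2) * C.
have Nb0 : 0 <= Nb by rewrite mulr_ge0 ?(ltW CC0)// addr_ge0 ?sqr_ge0// mulr_ge0// ltW.
pose b := Num.min (Num.min 1 (r / 2)) (Num.min (ga / (Nb + 1)) (r / (2 * (s + `|s - lam| + 1)))).
have b0 : 0 < b.
  rewrite !lt_min ltr01/=; apply/and3P; split; apply: divr_gt0 => //; first exact: ltr_wpDl.
  by apply: mulr_gt0 => //; apply: ltr_wpDl => //; rewrite addr_ge0// ltW.
have b1 : b <= 1 by rewrite !ge_min lexx.
have br : b <= r / 2 by rewrite !ge_min lexx !orbT.
have bga : b * (s * `|s - lam| + (s - lam) ^+ 2) * C <= ga.
  rewrite -mulrA -/Nb; apply: (@le_trans _ _ (b * (Nb + 1))).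
    by rewrite ler_wpM2l ?(ltW b0)// lerDl.
  by rewrite -ler_pdivlMr ?ltr_wpDl// !ge_min lexx !orbT.
have bs : s * b + `|s - lam| * b < r / 2.
  have : b * (s + `|s - lam| + 1) <= r / 2.
    rewrite -ler_pdivlMr; last by rewrite ltr_wpDl// addr_ge0// ltW.
    by rewrite -mulrA -invfM !ge_min lexx !orbT.
  by move: b0 r0; set y := `|_|; lra.
clearbody b.
(* Taylor is used at distance of order [b] from [q]; [C0 * t0 < b ^+ 2] will force caps of depth
   [t0] into the ball of radius [b]. *)
pose t0 := Num.min (Num.min b r) (b ^+ 2 / (2 * C0)).
have t00 : 0 < t0.
  rewrite !lt_min b0 r0/=; apply: divr_gt0; first exact: exprn_gt0.
  exact: mulr_gt0.
have t0b : t0 <= b by rewrite !ge_min lexx.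
have t0r : t0 <= r by rewrite !ge_min lexx !orbT.
have t0C : C0 * t0 < b ^+ 2.
  have : t0 <= b ^+ 2 / (2 * C0) by rewrite !ge_min lexx !orbT.
  rewrite ler_pdivlMr; last exact: mulr_gt0.
  move=> h; have : 0 < C0 * t0 by exact: mulr_gt0.
  move: h; lra.
exists t0 => // q qp Kq u uu umax x Kx /andP[t_gt0 t_le].
have qr : `|q - p| < r by exact: lt_le_trans qp t0r.
have Uq := hU _ qr.
have u1 := norm_le_dotv1 uu.
have u0 : u != 0 by apply: contra_eq_neq uu => ->; rewrite dotv0l eq_sym oner_eq0.
set G := gradient g q in hT *.
have GG := hG _ qr; rewrite -/G -/v in GG.
have G0 : G != 0.
  rewrite -normr_gt0; have : `|v| <= `|G| + `|G - v|.
    by have := ler_normB G (G - v); rewrite subKr.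
  by move: GG e1 nv0; lra.
have eN : N * e <= c / 4.
  by rewrite mulrC -ler_pdivlMr// -mulrA -invfM.
have Gv w : `|dotv v w| <= `|dotv G w| + c / 4 * `|w|.
  have -> : dotv v w = dotv G w - dotv (G - v) w by rewrite dotvDl dotvNl opprB addrC subrK.
  apply: (le_trans (ler_normB _ _)); rewrite lerD2l; apply: (le_trans (dotv_le _ _)).
  rewrite ler_wpM2r//; apply: le_trans eN; apply: ler_pM => //.
  by rewrite /N lerDl.
(* A short move from [q] along a descent direction of [g] stays in [K], hence cannot increase
   [dotv u]. *)
have [a a0 GaU] : exists2 a, 0 < a & G = a *: u.
  apply: support_direction => // w Gw; rewrite leNgt; apply/negP => uw.
  have w0 : 0 < `|w|.
    by rewrite normr_gt0; apply: contraTneq Gw => ->; rewrite dotvC dotv0l ltxx.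
  have [M M0 hM] : exists2 M, 0 < M & bil H w w / 2 + e * `|w| ^+ 2 <= M.
    exists (`|bil H w w / 2 + e * `|w| ^+ 2| + 1); first by rewrite ltr_wpDl.
    by rewrite (le_trans (ler_norm _))// lerDl.
  pose t := Num.min (Num.min 1 ((r - `|q - p|) / (2 * `|w|))) (- dotv G w / (2 * M)).
  have t_0 : 0 < t.
    by rewrite !lt_min ltr01 !divr_gt0// ?subr_gt0// ?oppr_gt0// mulr_gt0.
  have tw : `|t *: w| < r - `|q - p|.
    have : t <= (r - `|q - p|) / (2 * `|w|) by rewrite !ge_min lexx !orbT.
    rewrite normrZ (gtr0_norm t_0) ler_pdivlMr ?mulr_gt0// => h.
    have : 0 < t * `|w| by rewrite mulr_gt0.
    move: h; lra.
  have tM : t * M <= - dotv G w / 2.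
    have : t <= - dotv G w / (2 * M) by rewrite !ge_min lexx !orbT.
    rewrite ler_pdivlMr ?mulr_gt0//; lra.
  have Kt : K (q + t *: w).
    apply: inK.
      by apply: hU; rewrite addrAC (le_lt_trans (ler_normD _ _))// -ltrBrDl.
    have := hT q (t *: w) qr; rewrite dotvZr bilZl bilZr normrZ (gtr0_norm t_0).
    have twr : t * `|w| < r.
      rewrite -(gtr0_norm t_0) -normrZ (lt_le_trans tw)// gerBl//.
    move=> /(_ twr); rewrite ler_norml => /andP[_].
    have -> : e * (t * `|w|) ^+ 2 = t * t * (e * `|w| ^+ 2) by ring.
    have gq := gK _ Uq Kq; have tt : 0 < t * t by rewrite mulr_gt0.
    have : t * t * (bil H w w / 2 + e * `|w| ^+ 2) <= t * (- dotv G w / 2).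
      apply: (@le_trans _ _ (t * t * M)); first by rewrite ler_wpM2l// ltW.
      by rewrite -mulrA ler_wpM2l// ltW.
    have : t * dotv G w < 0 by rewrite pmulr_rlt0.
    move: gq; move: (dotv G w) (bil H w w) (e * _) (g q) (g _) => A1 A2 A3 A4 A5; lra.
  have := umax _ Kt; rewrite dotvDr dotvZr gerDl leNgt => /negP; apply.
  by rewrite mulr_gt0.
have ak1 : a <= k1.
  have : a = dotv G u by rewrite GaU dotvZl uu mulr1.
  move=> ->; apply: (le_trans (ler_norm _)); apply: (le_trans (dotv_le _ _)).
  rewrite -[X in _ <= X]mulr1; apply: ler_pM => //.
  apply: ler_pM => //; first by rewrite /N lerDl.
  have : `|G| <= `|v| + `|G - v| by rewrite -{1}[G](subrK v) addrC ler_normD.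
  by move: GG e1 nv0; lra.
have ak0 : k0 <= a.
  have : `|G| <= a by rewrite GaU normrZ (gtr0_norm a0) ler_piMr// ltW.
  have : `|v| <= `|G| + `|G - v|.
    by have := ler_normB G (G - v); rewrite subKr.
  by move: GG e1 nv0; rewrite /k0; lra.
(* A negative value would make [q] interior, although [dotv u] is maximal there. *)
have gq0 : 0 <= g q.
  rewrite leNgt; apply/negP => gq.
  have /nbhs_normP[y y0 hy] := sublevel_interior oU Uq cg KU gq.
  have /hy/umax : `|q + (y / 2) *: u - q| < y.
    rewrite addrC addKr normrZ gtr0_norm ?divr_gt0//.
    apply: (@le_lt_trans _ _ (y / 2)); first by rewrite ler_piMr// ltW// divr_gt0.
    by rewrite ltr_pdivrMr// mulr_natr mulr2n ltrDl.
  by rewrite dotvDr dotvZr uu mulr1 gerDl leNgt divr_gt0.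
have local w t : `|w| < r -> U (q + w) -> K (q + w) -> dotv u w = - t -> 0 <= t <= 1 ->
    `|w| ^+ 2 <= C0 * t /\ bil H w w / 2 <= a * t + e * `|w| ^+ 2.
  move=> wr Uw Kw uw t01.
  have B1 : bil H w w / 2 <= a * t + e * `|w| ^+ 2.
    have := hT q w qr wr; rewrite -/G GaU dotvZl uw ler_norml => /andP[h _].
    have := gK _ Uw Kw; move: h gq0; move: (bil _ _ _) (g _) (g _) (e * _) => A1 A2 A3 A4.
    rewrite mulrN; move: (a * t) => A5; lra.
  split => //; apply: (@coercive_bound _ c a k1 e t (bil H w w) `|w| (dotv v w)) => //.
  - exact: ltW.
  - by move: B1; rewrite -mulrA; move: (a * t) => A1; lra.
  - apply: (le_trans (Gv w)); rewrite lerD2r GaU dotvZl uw normrM normrN.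
    by case/andP: t01 => t01 _; rewrite (gtr0_norm a0) (ger0_norm t01).
have hUw w : `|w| <= r / 2 -> U (q + w).
  move=> wr; apply: hU; rewrite addrAC (le_lt_trans (ler_normD _ _))//.
  by move: qp t0b br wr; lra.
have t1 : t0 <= 1 := le_trans t0b b1.
set t := dotv u (q - x) in t_gt0 t_le *.
have uxq : dotv u (x - q) = - t by rewrite /t -dotvNr opprB.
(* Nothing so far places [x] in the chart. If it were far, the point of the segment from [q] to [x]
   at distance exactly [b] would have depth at most [t], against the width bound. *)
have xclose : `|x - q| <= b.
  rewrite leNgt; apply/negP => far.
  have n0 : 0 < `|x - q| := lt_trans b0 far.
  pose th := b / `|x - q|.
  have th1 : 0 < th <= 1 by rewrite divr_gt0//= ler_pdivrMr// mul1r ltW.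
  have nth : `|th *: (x - q)| = b.
    by rewrite normrZ gtr0_norm ?divr_gt0// /th divfK// gt_eqF.
  have Kth : K (q + th *: (x - q)).
    have := cK q x Kq Kx th; case/andP: th1 => th0 th1; rewrite (ltW th0) th1 => /(_ isT).
    by rewrite scalerBl scale1r scalerBr addrAC -addrA.
  have [||||h _] := local (th *: (x - q)) (th * t) _ _ Kth.
  - by rewrite nth; move: br r0; lra.
  - by apply: hUw; rewrite nth.
  - by rewrite dotvZr uxq mulrN.
  - case/andP: th1 => th0 th1; rewrite mulr_ge0 ?(ltW th0) ?(ltW t_gt0)//=.
    by apply: mulr_ile1; rewrite ?(ltW th0) ?(ltW t_gt0)// (le_trans t_le).
  move: h; rewrite nth leNgt => /negP; apply.
  apply: le_lt_trans t0C; rewrite ler_wpM2l ?(ltW C00)// (le_trans _ t_le)//.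
  by rewrite ler_piMl ?(ltW t_gt0)//; case/andP: th1.
have xE : x = q + (x - q) by rewrite addrC subrK.
have [|||||W2 B1] := local (x - q) t.
- by move: xclose br r0; lra.
- by apply: hUw; exact: le_trans xclose br.
- by rewrite -xE.
- exact: uxq.
- by rewrite (ltW t_gt0) (le_trans t_le).
set w := x - q in xclose W2 B1 uxq *; set w' := s *: w + _.
have w'n : `|w'| <= s * `|w| + `|s - lam| * t.
  have e5 : `|((s - lam) * t) *: u| = `|s - lam| * t * `|u|.
    by rewrite normrZ normrM (gtr0_norm t_gt0).
  have e6 : `|s *: w| = s * `|w| by rewrite normrZ (gtr0_norm s0).
  apply: (le_trans (ler_normD _ _)); rewrite e5 e6.
  by rewrite lerD2l ler_piMr// mulr_ge0// ltW.
have w'b : `|w'| < r / 2.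
  apply: le_lt_trans bs; apply: (le_trans w'n); apply: lerD.
    by rewrite ler_wpM2l// ltW.
  by rewrite ler_wpM2l// (le_trans t_le).
apply: inK; first by apply: hUw; exact: ltW.
apply: (@depth_scaling R s lam a k0 e b t C C0 `|w| (bil H w w) (bil H w u) (bil H u u) `|w'|) => //.
- by rewrite b0.
- by rewrite t_gt0 (le_trans t_le).
- by rewrite normr_ge0.
- apply: (le_trans (hC _ _)); rewrite ler_piMr ?mulr_ge0// ltW//.
- apply: (le_trans (hC _ _)); rewrite -[X in _ <= X]mulr1; apply: ler_pM => //.
    by rewrite mulr_ge0// ltW.
  by rewrite ler_piMr// ltW.
- by rewrite normr_ge0.
have w'r : `|w'| < r by move: w'b r0; lra.
have := hT q w' qr w'r; rewrite -/G GaU dotvZl.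
have -> : dotv u w' = - (lam * t).
  by rewrite /w' dotvDr !dotvZr uxq uu; ring.
have -> : bil H w' w' = s ^+ 2 * bil H w w + 2 * s * ((s - lam) * t) * bil H w u +
    ((s - lam) * t) ^+ 2 * bil H u u.
  exact: bil_square (hessian_sym oU cU Up).
have gq : g q = 0 by apply/eqP; rewrite eq_le gq0 gK.
rewrite gq subr0 ler_norml => /andP[_].
have -> : a * - (lam * t) = - (a * lam * t) by rewrite mulrN mulrA.
rewrite lerBlDr lerBlDr => /le_trans; apply.
by rewrite [X in X <= _]addrC [e * _ + _]addrC addrA.
Qed.

End local_cap.

Section cap_scaling.
Variables (R : realType) (d : nat).
Local Notation E := 'rV[R]_d.
Implicit Types (K : set E) (p q x w u : E).

Lemma support_boundary K q u : dotv u u = 1 ->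
  (forall x, K x -> dotv u x <= dotv u q) -> ~ K° q.
Proof.
move=> uu umax /nbhs_normP[y y0 hy].
have /hy/umax : `|q + (y / 2) *: u - q| < y.
  rewrite addrC addKr normrZ gtr0_norm ?divr_gt0//.
  apply: (@le_lt_trans _ _ (y / 2)).
    by rewrite ler_piMr ?norm_le_dotv1// ltW// divr_gt0.
  by rewrite ltr_pdivrMr// mulr_natr mulr2n ltrDl.
by rewrite dotvDr dotvZr uu mulr1 gerDl leNgt divr_gt0.
Qed.

Lemma body_closed K : convex_body K -> closed K.
Proof. by move=> [_ [cK _]]; apply: compact_closed => //; exact: norm_hausdorff. Qed.

(* Near [q], [K] looks like a paraboloid [dotv u (q - x) >= |w|^2], which is invariant
   under scaling depth by [nu ^ 2] and width by [nu]; [s ^ 2 < lam] leaves room for the error.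
   The map moves the plane at depth [t] to depth [lam * t] and contracts by [s] in it. *)
Lemma cap_scaling K (s lam : R) : smooth_convex_body K -> 0 < s -> s ^+ 2 < lam ->
  exists2 t0, 0 < t0 & forall u q, dotv u u = 1 -> K q ->
    (forall x, K x -> dotv u x <= dotv u q) -> forall x, K x -> 0 < dotv u (q - x) <= t0 ->
    K (q + (s *: (x - q) + ((s - lam) * dotv u (q - x)) *: u)).
Proof.
move=> [bK chart] s0 slam; have clK := body_closed bK; have [cvK [cpK _]] := bK.
pose B := K `\` K°.
have cB : compact B.
  apply: (@subclosed_compact _ _ K) => //; last by move=> x [].
  by rewrite /B setDE; apply: closedI => //; apply: open_closedC; exact: open_interior.
pose P (t : R) q := forall u, dotv u u = 1 -> K q ->
    (forall x, K x -> dotv u x <= dotv u q) -> forall x, K x -> 0 < dotv u (q - x) <= t ->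
    K (q + (s *: (x - q) + ((s - lam) * dotv u (q - x)) *: u)).
(* The local statement holds uniformly for base points near [p], so compactness of the boundary
   yields one depth for all support points and directions. *)
have key : forall p, B p -> \forall q \near p & t \near 0^'+, P t q.
  move=> p [Kp nKp].
  have [|U [g [oU Up cU KU [v0 curv]]]] := chart p.
    by split => //; exact: subset_closure.
  have [t0 t00 h] := local_cap_scaling cvK oU Up cU KU Kp nKp v0 curv s0 slam.
  exists ([set q | `|q - p| < t0], [set t | t < t0]) => /=.
    by split; [apply/nbhs_normP; exists t0|exact: nbhs_right_lt].
  move=> [q t]/= [qp tt0] u uu Kq umax x Kx /andP[u0 ut].
  by apply: (h q qp Kq u uu umax x Kx); rewrite u0 (le_trans ut)// ltW.
have := (compact_near_coveringP B).1 cB R (0^'+) P _ key => near.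
have : \forall t \near 0^'+, 0 < t /\ B `<=` P t.
  by apply: filterI; [exact: nbhs_right_gt|exact: near].
move=> /filter_ex[t [t0 ht]]; exists t => // u q uu Kq umax.
by apply: ht => //; split => //; exact: support_boundary uu umax.
Qed.

Lemma support_point K u : convex_body K -> exists2 q, K q & forall x, K x -> dotv u x <= dotv u q.
Proof.
move=> [_ [cK [x0 /interior_subset Kx0]]].
have [||q /set_mem Kq hq] := @compact_EVT_max _ R (dotv u) K _ cK.
- by exists x0.
- apply: continuous_subspaceT => x; apply/(@cvgrPdist_le R R^o E _ (nbhs_filter x)) => e e0.
  pose N : R := d%:R * `|u| + 1; have N0 : 0 < N by rewrite ltr_wpDl// mulr_ge0.
  apply/nbhs_normP; exists (e / N); first exact: divr_gt0.
  move=> z zx; rewrite -dotvNr -dotvDr (le_trans (dotv_le _ _))// distrC.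
  apply: (@le_trans _ _ (N * (e / N))); last by rewrite mulrC divfK// gt_eqF.
  by apply: ler_pM => //; [rewrite lerDl|exact: ltW].
by exists q => // x Kx; apply: hq; exact: mem_set.
Qed.

End cap_scaling.

(** * Tuples of points on hyperplanes *)

Section vmu_linear.
Import fingroup perm.
Variable R : realType.
Local Notation leb := (@lebesgue_measure R).

Lemma measurable_dotv_mul (m n : nat) (M : 'M[R]_(m, n)) :
  measurable_fun setT (fun v : 'rV[R]_m => v *m M).
Proof.
apply: measurable_into_mx => i j; rewrite (ord1 i).
under eq_fun do rewrite mxE; apply: measurable_sum => k.
by apply: measurable_funM; [exact: measurable_coord|exact: measurable_cst].
Qed.

Lemma cons_row_eq d (v : 'rV[R]_d.+1) x (w : 'rV[R]_d) : v 0 0 = x ->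
  (forall k, v 0 (lift ord0 k) = w 0 k) -> v = cons_row (x, w).
Proof.
move=> h0 hS; apply/rowP => j; case: (unliftP ord0 j) => [k ->|->].
  by rewrite hS cons_rowS.
by rewrite cons_row0.
Qed.

(** Both coordinates are split off as one-dimensional integrals, where Tonelli exchanges them. *)
Lemma vmu_swap d (i : 'I_d.+1) (G : 'rV[R]_d.+1 -> \bar R) :
  measurable_fun setT G -> (forall v, 0 <= G v)%E ->
  (\int[vmu R d.+1]_v G v = \int[vmu R d.+1]_v G (v *m tperm_mx ord0 i))%E.
Proof.
move=> mG G0; have mG' := measurableT_comp mG (measurable_dotv_mul (@tperm_mx R _ ord0 i)).
case: (unliftP ord0 i) mG' => [i' ->|->] mG'; last first.
  apply: eq_integral => v _.
  by rewrite /tperm_mx (_ : tperm ord0 ord0 = 1%g) ?perm_mx1 ?mulmx1//; apply/permP => j; rewrite permE /= perm1; case: eqP.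
case: d G mG G0 i' mG' {i} => [|d] G mG G0 i' mG'; first by have [] := i'.
pose H (p : (R * R) * 'rV[R]_d) := G (cons_row (p.1.1, ins_row i' (p.2, p.1.2))).
have mH : measurable_fun setT H.
  apply: (measurableT_comp mG); apply: (measurableT_comp (@measurable_cons_row R d.+1)).
  apply: measurable_fun_pair; first exact: (measurableT_comp measurable_fst measurable_fst).
  apply: (measurableT_comp (@measurable_ins_row R d i')).
  apply: measurable_fun_pair; first exact: measurable_snd.
  exact: (measurableT_comp measurable_snd measurable_fst).
have H0 p : (0 <= H p)%E by exact: G0.
pose F (p : R * R) : \bar R := (\int[vmu R d]_s H (p, s))%E.
have mF : measurable_fun setT F by exact: (measurable_integral_param (vmu R d) mH H0).
have F0 p : (0 <= F p)%E by apply: integral_ge0.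
have E1 : (\int[vmu R d.+2]_v G v = \int[leb]_x \int[leb]_z F (x, z))%E.
  rewrite vmuS//; apply: eq_integral => x _.
  rewrite (vmu_ins i'); first last.
  - by move=> v; exact: G0.
  - exact: (measurable_section_l x (measurableT_comp mG (@measurable_cons_row R d.+1))).
  rewrite (@tonelli_swap _ _ _ _ _ (vmu R d) leb (fun p => H ((x, p.2), p.1)))//.
  apply: (measurableT_comp mH); apply: measurable_fun_pair; last exact: measurable_fst.
  by apply: measurable_fun_pair; [exact: measurable_cst|exact: measurable_snd].
have E2 : (\int[vmu R d.+2]_v G (v *m tperm_mx ord0 (lift ord0 i')) = \int[leb]_x \int[leb]_z F (z, x))%E.
  rewrite (@vmuS R _ (fun v => G (v *m tperm_mx ord0 (lift ord0 i'))) mG' (fun v => G0 _)).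
  apply: eq_integral => x _.
  rewrite (vmu_ins i'); first last.
  - by move=> v; exact: G0.
  - exact: (measurable_section_l x (measurableT_comp mG' (@measurable_cons_row R d.+1))).
  have mHx : measurable_fun setT (fun p : 'rV[R]_d * R => H ((p.2, x), p.1)).
    apply: (measurableT_comp mH); apply: measurable_fun_pair; last exact: measurable_fst.
    by apply: measurable_fun_pair; [exact: measurable_snd|exact: measurable_cst].
  rewrite -(tonelli_swap (vmu R d) leb mHx (fun p => H0 _)).
  apply: eq_integral => s _; apply: eq_integral => z _; rewrite /H/=; congr G.
  rewrite -xcolE; apply: cons_row_eq.
    by rewrite mxE tpermL cons_rowS ins_row_at.
  move=> k; rewrite mxE; have [->|ki] := eqVneq k i'.
    by rewrite tpermR cons_row0 ins_row_at.
  rewrite tpermD ?(inj_eq lift_inj)// 1?eq_sym// cons_rowS.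
  by rewrite !mxE; case: unliftP ki => // ->; rewrite eqxx.
rewrite E1 E2; exact: (@tonelli_swap _ _ _ _ _ leb leb F mF F0).
Qed.

(** One step of Gaussian elimination: with the other coordinates fixed, the first undergoes an
    affine substitution of slope [a]; with the first fixed, the others transform by the Schur
    complement [N - a^-1 *: (c *m r)]. *)
Lemma vmu_pivot d (a : R) (r : 'rV[R]_d) (c : 'cV[R]_d) (N : 'M[R]_d) (G : 'rV[R]_d.+1 -> \bar R) :
  a != 0 ->
  (forall F : 'rV[R]_d -> \bar R, measurable_fun setT F -> (forall v, 0 <= F v)%E ->
    \int[vmu R d]_v F v = (`|\det (N - a^-1 *: (c *m r))|)%:E *
      \int[vmu R d]_v F (v *m (N - a^-1 *: (c *m r))))%E ->
  measurable_fun setT G -> (forall v, 0 <= G v)%E ->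
  (\int[vmu R d.+1]_v G v = (`|a * \det (N - a^-1 *: (c *m r))|)%:E *
     \int[vmu R d.+1]_v G ((v : 'rV_(1 + d)) *m block_mx a%:M r c N : 'rV_(1 + d)))%E.
Proof.
move=> a0 IH mG G0; set N' := N - _ in IH *.
have blockE x w : (cons_row (x, w) : 'rV_(1 + d)) *m block_mx a%:M r c N =
    cons_row (a * x + (w *m c) 0 0, x *: r + w *m N).
  rewrite /cons_row/= mul_row_block mul_scalar_mx; congr row_mx.
    apply/matrixP => i j; rewrite !ord1 [LHS]mxE [RHS]mxE eqxx mulr1n mxE mulrC.
    by rewrite [a%:M _ _]mxE eqxx mulr1n.
  by rewrite mul_scalar_mx.
have mGb : measurable_fun setT (fun v : 'rV[R]_d.+1 => G ((v : 'rV_(1 + d)) *m block_mx a%:M r c N : 'rV_(1 + d))).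
  exact: (measurableT_comp mG (measurable_dotv_mul (block_mx a%:M r c N : 'M[R]_(1 + d)))).
have mc : measurable_fun setT (fun w : 'rV[R]_d => (w *m c) 0 0).
  exact: (measurableT_comp (@measurable_coord R 1 1 0 0) (measurable_dotv_mul c)).
(* The shift by [(a^-1 * p.1) *: r] is chosen so that substituting [a * x + (w *m c) 0 0] for the
   first coordinate restores the block product. *)
pose H (p : R * 'rV[R]_d) := G (cons_row (p.1, (a^-1 * p.1) *: r + p.2 *m N')).
have mH : measurable_fun setT H.
  apply: (measurableT_comp mG); apply: (measurableT_comp (@measurable_cons_row R d)).
  apply: measurable_fun_pair; first exact: measurable_fst.
  apply: measurable_into_mx => i j; rewrite (ord1 i); under eq_fun do rewrite !mxE.
  apply: measurable_funD.
    apply: measurable_funM; last exact: measurable_cst.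
    by apply: measurable_funM; [exact: measurable_cst|exact: measurable_fst].
  apply: measurable_sum => k; apply: measurable_funM; last exact: measurable_cst.
  exact: (measurableT_comp (@measurable_coord R 1 d 0 k) measurable_snd).
have H0 p : (0 <= H p)%E by exact: G0.
have L : (\int[vmu R d.+1]_v G v = (`|\det N'|)%:E * \int[leb]_x \int[vmu R d]_w H (x, w))%E.
  rewrite vmuS// integral_scale//; first last.
  - by move=> x; apply: integral_ge0.
  - exact: (measurable_integral_param (vmu R d) mH H0).
  apply: eq_integral => x _.
  have mGx : measurable_fun setT (fun w => G (cons_row (x, w))).
    exact: (measurable_section_l x (measurableT_comp mG (@measurable_cons_row R d))).
  have mGq : measurable_fun setT (fun w => G (cons_row (x, (a^-1 * x) *: r + w))).
    have := measurableT_comp mGx (@measurable_affine_vec R d 1 ((a^-1 * x) *: r)).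
    by apply: eq_measurable_fun => w _ /=; rewrite scale1r.
  rewrite (vmu_scale ((a^-1 * x) *: r) (oner_neq0 R) mGx); last by move=> v; exact: G0.
  rewrite normr1 expr1n mul1e; under eq_integral do rewrite scale1r.
  by rewrite [LHS](IH _ mGq)// => v; exact: G0.
rewrite L normrM [(`|a| * _)%R]mulrC EFinM -muleA; congr (_ * _)%E.
rewrite (@tonelli_swap _ _ _ _ _ leb (vmu R d) H)// vmuS//.
pose H2 (p : R * 'rV[R]_d) := G (cons_row (a * p.1 + (p.2 *m c) 0 0, p.1 *: r + p.2 *m N)).
have mH2 : measurable_fun setT H2.
  have := measurableT_comp mGb (@measurable_cons_row R d).
  by apply: eq_measurable_fun => -[x w] _ /=; rewrite blockE.
have H20 p : (0 <= H2 p)%E by exact: G0.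
transitivity (`|a|%:E * \int[leb]_x \int[vmu R d]_w H2 (x, w))%E; last first.
  by congr (_ * _)%E; apply: eq_integral => x _; apply: eq_integral => w _; rewrite blockE.
rewrite (@tonelli_swap _ _ _ _ _ leb (vmu R d) H2)// integral_scale//; first last.
- by move=> x; apply: integral_ge0.
- apply: (measurable_integral_param leb (G := fun p => H2 (p.2, p.1))) => //.
  by apply: (measurableT_comp mH2); exact: measurable_fun_pair.
apply: eq_integral => w _.
rewrite (@leb_affine R a ((w *m c) 0 0) (fun x => H (x, w)))//.
  congr (_ * _)%E; apply: eq_integral => x _; rewrite /H /H2/=; congr (G (cons_row (_, _))).
  rewrite /N' mulmxBr -scalemxAr mulrDr mulKf// scalerDl mulmxA.
  rewrite (_ : (w *m c) *m r = ((w *m c) 0 0) *: r); last by rewrite {1}[w *m c]mx11_scalar mul_scalar_mx.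
  by rewrite -addrA; congr (_ + _); rewrite addrC scalerA subrK.
apply: (measurableT_comp mH); exact: measurable_fun_pair.
Qed.

(** Induction on the dimension by elimination; a zero pivot is repaired by a row exchange, which
    preserves the integral and the absolute value of the determinant. *)
Lemma vmu_linear d (M : 'M[R]_d) (G : 'rV[R]_d -> \bar R) : M \in unitmx ->
  measurable_fun setT G -> (forall v, 0 <= G v)%E ->
  (\int[vmu R d]_v G v = (`|\det M|)%:E * \int[vmu R d]_v G (v *m M))%E.
Proof.
elim: d M G => [|d IH] M G uM mG G0.
  rewrite !vmu0//; last exact: (measurableT_comp mG (measurable_dotv_mul M)).
  by rewrite det_mx00 normr1 mul1e mul0mx.
wlog M00 : M G uM mG G0 / M 0 0 != 0.
  move=> gen; have [M00|] := eqVneq (M 0 0) 0; last exact: gen.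
  have [i Mi0] : exists i, M i 0 != 0.
    apply/existsP; apply: contraTT uM => /existsPn h.
    rewrite unitmxE unitfE negbK (expand_det_col _ 0); apply/eqP.
    by apply: big1 => i _; have := h i; rewrite negbK => /eqP ->; rewrite mul0r.
  have tE : tperm_mx ord0 i *m M = xrow ord0 i M by rewrite xrowE.
  have utp : (tperm_mx ord0 i : 'M[R]_d.+1) \in unitmx by exact: unitmx_perm.
  have := gen (tperm_mx ord0 i *m M) G _ mG G0; rewrite unitmx_mul utp uM => /(_ isT).
  rewrite tE mxE tpermL => /(_ Mi0) ->; rewrite -tE det_mulmx normrM.
  have -> : `|\det (tperm_mx ord0 i : 'M[R]_d.+1)| = 1.
    by rewrite /tperm_mx det_perm normrX normrN1 expr1n.
  rewrite mul1r; congr (_ * _)%E.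
  rewrite [RHS](vmu_swap i); first by apply: eq_integral => v _; rewrite mulmxA.
    exact: (measurableT_comp mG (measurable_dotv_mul M)).
  by move=> v; exact: G0.
pose A : 'M[R]_(1 + d) := M.
have ME : M = block_mx (M 0 0)%:M (ursubmx A) (dlsubmx A) (drsubmx A) :> 'M[R]_(1 + d).
  rewrite -[LHS](@submxK _ 1 d 1 d M); congr block_mx.
  apply/matrixP => i j; rewrite !ord1 !mxE eqxx mulr1n; congr (M _ _); exact/val_inj.
set r := ursubmx A in ME; set c := dlsubmx A in ME; set N := drsubmx A in ME.
set a := M 0 0 in M00 ME.
have detE : \det M = a * \det (N - a^-1 *: (c *m r)).
  have -> : \det M = \det (block_mx 1%:M 0 (- (a^-1 *: c)) 1%:M *m (block_mx a%:M r c N : 'M[R]_(1 + d))).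
    by rewrite det_mulmx det_lblock !det1 !mul1r ME.
  rewrite mulmx_block !mul1mx !mul0mx !addr0.
  have -> : - (a^-1 *: c) *m a%:M + c = 0.
    by rewrite mul_mx_scalar scalerN scalerA mulfV// scale1r addNr.
  by rewrite det_ublock det_scalar expr1 mulNmx -scalemxAl addrC.
rewrite (@vmu_pivot d a r c N)//; first by rewrite -detE; congr (_ * _)%E; apply: eq_integral => v _; rewrite -ME.
move=> F mF F0; apply: IH => //.
rewrite unitmxE unitfE; apply: contraTneq uM => d0.
by rewrite unitmxE unitfE detE d0 mulr0 eqxx.
Qed.

End vmu_linear.

(** * Separating the first coordinates of the points from the others *)

Section split_first_coordinate.
Variables (R : realType) (d : nat).
Local Notation E := 'rV[R]_d.
Local Notation leb := (@lebesgue_measure R).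

Definition nthf n (ys : seq E) : 'I_n -> E := fun k => nth 0 ys k.

Definition join n (z : 'rV[R]_n) (Y : 'I_n -> E) : seq 'rV[R]_d.+1 :=
  [seq cons_row (z 0 i, Y i) | i <- enum 'I_n].

Lemma nth_join n (z : 'rV[R]_n) Y (i : 'I_n) : nth 0 (join z Y) i = cons_row (z 0 i, Y i).
Proof.
rewrite /join (nth_map i) ?size_enum_ord//; congr (cons_row (z 0 _, Y _)); exact: nth_ord_enum.
Qed.

Lemma measurable_join_l n Y : measurable_fun setT (fun z : 'rV[R]_n => join z Y).
Proof.
apply: measurable_into_seq => i; have [ni|ni] := ltnP i n.
  rewrite (_ : (fun x => _) = fun z : 'rV[R]_n => cons_row (z 0 (Ordinal ni), Y (Ordinal ni))).
    apply: (measurableT_comp (@measurable_cons_row R d)); apply: measurable_fun_pair.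
      exact: measurable_coord.
    exact: measurable_cst.
  by apply/funext => z; rewrite (nth_join _ _ (Ordinal ni)).
rewrite (_ : (fun x => _) = cst 0); first exact: measurable_cst.
by apply/funext => z; rewrite nth_default// /join size_map size_enum_ord.
Qed.

Lemma join_cons n t (z : 'rV[R]_n) y ys :
  join (cons_row (t, z)) (@nthf n.+1 (y :: ys)) = cons_row (t, y) :: join z (@nthf n ys).
Proof.
rewrite /join enum_ordSl/= cons_row0; congr (_ :: _); rewrite -map_comp; apply: eq_map => i /=.
by rewrite cons_rowS.
Qed.

Lemma measurable_join n :
  measurable_fun setT (fun p : 'rV[R]_n * seq E => join p.1 (@nthf n p.2)).
Proof.
apply: measurable_into_seq => i; have [ni|ni] := ltnP i n.
  rewrite (_ : (fun x => _) = fun p : 'rV[R]_n * seq E => cons_row (p.1 0 (Ordinal ni), nth 0 p.2 (Ordinal ni))).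
    apply: (measurableT_comp (@measurable_cons_row R d)); apply: measurable_fun_pair.
      exact: (measurableT_comp (@measurable_coord R 1 n 0 _) measurable_fst).
    exact: (measurableT_comp (measurable_nth _) measurable_snd).
  by apply/funext => p; rewrite (nth_join _ _ (Ordinal ni)).
rewrite (_ : (fun x => _) = cst 0); first exact: measurable_cst.
by apply/funext => p; rewrite nth_default// /join size_map size_enum_ord.
Qed.

Lemma measurable_join_comp dX (X : measurableType dX) n (f : X -> 'rV[R]_n) (g : X -> seq E) :
  measurable_fun setT f -> measurable_fun setT g ->
  measurable_fun setT (fun x => join (f x) (@nthf n (g x))).
Proof.
move=> mf mg; apply: (@measurableT_comp _ _ _ _ _ _
  (fun p : 'rV[R]_n * seq E => join p.1 (@nthf n p.2)) _ (fun x => (f x, g x))).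
  exact: measurable_join.
exact: measurable_fun_pair.
Qed.

(** The other coordinates [ys] are kept outermost so that, for fixed [ys], the vector of first
    coordinates can be substituted linearly. *)
Lemma pmu_split n (G : seq 'rV[R]_d.+1 -> \bar R) :
  measurable_fun setT G -> (forall v, 0 <= G v)%E ->
  (\int[pmu R d.+1 n]_xs G xs =
   \int[pmu R d n]_ys \int[vmu R n]_z G (join z (@nthf n ys)))%E.
Proof.
elim: n G => [|n IH] G mG G0; have mGj k : measurable_fun setT
    (fun p : seq E * 'rV[R]_k => G (join p.2 (@nthf k p.1))); try
  by apply: (measurableT_comp mG); apply: measurable_join_comp;
    [exact: measurable_snd|exact: measurable_fst].
  have mR : measurable_fun setT (fun ys : seq E => \int[vmu R 0]_z G (join z (@nthf 0 ys)))%E.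
    exact: (measurable_integral_param (vmu R 0) (mGj 0) (fun=> G0 _)).
  rewrite (pmu0E mG G0) (pmu0E mR); last by move=> ys; apply: integral_ge0.
  rewrite vmu0//; first by rewrite /join enum_ord0.
  exact: (measurable_section_l [::] (mGj 0)).
pose H (p : ((R * E) * seq E) * 'rV[R]_n) := G (cons_row p.1.1 :: join p.2 (@nthf n p.1.2)).
have mH : measurable_fun setT H.
  apply: (measurableT_comp mG).
  apply: (@measurableT_comp _ _ _ _ _ _ (@cons_seq R d.+1) _
    (fun p : ((R * E) * seq E) * 'rV[R]_n => (cons_row p.1.1, join p.2 (@nthf n p.1.2)))).
    exact: measurable_cons_seq.
  apply: measurable_fun_pair.
    apply: (measurableT_comp (@measurable_cons_row R d)).
    exact: (measurableT_comp measurable_fst measurable_fst).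
  apply: measurable_join_comp; first exact: measurable_snd.
  exact: (measurableT_comp measurable_snd measurable_fst).
have H0 p : (0 <= H p)%E by exact: G0.
pose Q (p : (R * E) * seq E) : \bar R := (\int[vmu R n]_z H (p, z))%E.
have mQ : measurable_fun setT Q by exact: (measurable_integral_param (vmu R n) mH H0).
have Q0 p : (0 <= Q p)%E by apply: integral_ge0.
pose Q1 (p : R * E) : \bar R := (\int[pmu R d n]_ys Q (p, ys))%E.
have mQ1 : measurable_fun setT Q1 by exact: (measurable_integral_param (pmu R d n) mQ Q0).
have Q10 p : (0 <= Q1 p)%E by apply: integral_ge0.
have L : (\int[pmu R d.+1 n.+1]_xs G xs = \int[leb]_t \int[vmu R d]_y Q1 (t, y))%E.
  rewrite (pmuS n mG G0) vmuS; first last.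
  - by move=> v; apply: integral_ge0.
  - exact: measurable_pmu_section.
  apply: eq_integral => t _; apply: eq_integral => y _.
  rewrite IH//; exact: (measurableT_comp mG (measurable_cons_l _)).
have mR : measurable_fun setT (fun ys : seq E => \int[vmu R n.+1]_z G (join z (@nthf n.+1 ys)))%E.
  exact: (measurable_integral_param (vmu R n.+1) (mGj n.+1) (fun=> G0 _)).
rewrite L (tonelli_swap leb (vmu R d) mQ1 Q10) (pmuS n mR); last by move=> ys; apply: integral_ge0.
apply: eq_integral => y _.
have mQy : measurable_fun setT (fun p : R * seq E => Q ((p.1, y), p.2)).
  apply: (measurableT_comp mQ); apply: measurable_fun_pair; last exact: measurable_snd.
  by apply: measurable_fun_pair; [exact: measurable_fst|exact: measurable_cst].
rewrite /Q1 (tonelli_swap leb (pmu R d n) mQy (fun=> Q0 _)).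
apply: eq_integral => ys _; rewrite vmuS; first last.
- by move=> v; exact: G0.
- exact: (measurable_section_l (y :: ys) (mGj n.+1)).
by apply: eq_integral => t _; apply: eq_integral => z _; rewrite /H join_cons.
Qed.

End split_first_coordinate.

(** * Parametrising tuples of points by the hyperplane through them *)

Section planes.
Variables (R : realType) (m : nat).
Local Notation d := m.+1.
Local Notation D := m.+2.
Local Notation E := 'rV[R]_d.
Local Notation leb := (@lebesgue_measure R).

Definition lmx (Y : 'I_D -> E) : 'M[R]_D := \matrix_(i, j) cons_row (1, Y i) 0 j.

Lemma dotv_cons k (p q : R * 'rV[R]_k) :
  dotv (cons_row p) (cons_row q) = p.1 * q.1 + dotv p.2 q.2.
Proof.
rewrite !dotvE big_ord_recl !cons_row0; congr (_ + _).
by apply: eq_bigr => i _; rewrite !cons_rowS.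
Qed.

Lemma cons_row_surj k (v : 'rV[R]_k.+1) : exists x w, v = cons_row (x, w).
Proof.
exists (v 0 0), (\row_j v 0 (lift ord0 j)).
by apply: cons_row_eq => // j; rewrite mxE.
Qed.

Lemma mul_lmx (c : 'rV[R]_D) Y i : (c *m (lmx Y)^T) 0 i = dotv c (cons_row (1, Y i)).
Proof. by rewrite mxE dotvE; apply: eq_bigr => k _; rewrite !mxE. Qed.

Lemma lmx_inull : inull (D * d) (fun s => \det (lmx (@points_of R d D s)) = 0).
Proof.
pose L (j : 'I_D) (v : E) := cons_row (1, v) 0 j.
apply: (@det_points_inull R m D D id L) => //.
  move=> j v w t; rewrite /L; case: (unliftP ord0 j) => [k ->|->].
    by rewrite !cons_rowS !mxE.
  by rewrite !cons_row0/=; ring.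
(* The origin and the standard basis vectors give a lower triangular matrix with unit diagonal. *)
exists (fun i => if unlift ord0 i is Some k then evec R k else 0).
rewrite det_trig.
  rewrite prodf_seq_neq0; apply/allP => i _; apply/implyP => _; rewrite mxE /L.
  by case: (unliftP ord0 i) => [k ->|->]; rewrite ?cons_rowS ?cons_row0/= ?mxE ?eqxx ?oner_neq0.
apply/is_trig_mxP => i j; rewrite mxE /L.
case: (unliftP ord0 j) => [l ->|->]//; rewrite cons_rowS/=.
case: (unliftP ord0 i) => [k ->|->]; last by rewrite mxE.
by rewrite /= /bump/= !add1n ltnS => kl; rewrite mxE eqxx/= -val_eqE/= (gtn_eqF kl).
Qed.

Lemma measurable_lmx : measurable_fun setT (fun ys : seq E => \det (lmx (@nthf R d D ys))).
Proof.
apply: measurable_det => i j; under eq_fun do rewrite mxE.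
case: (unliftP ord0 j) => [k ->|->]; last by under eq_fun do rewrite cons_row0; exact: measurable_cst.
under eq_fun do rewrite cons_rowS.
exact: (measurableT_comp (@measurable_coord R 1 d 0 k) (measurable_nth i)).
Qed.

(** The points above [Y] on the graph of the affine function with coefficients [c], constant term
    first. *)
Definition on_plane (c : 'rV[R]_D) (Y : 'I_D -> E) : seq 'rV[R]_D := join (c *m (lmx Y)^T) Y.

Lemma measurable_on_plane :
  measurable_fun setT (fun p : seq E * 'rV[R]_D => on_plane p.2 (@nthf R d D p.1)).
Proof.
apply: measurable_join_comp; last exact: measurable_fst.
apply: measurable_into_mx => i j; rewrite (ord1 i); under eq_fun do rewrite mul_lmx dotvE.
apply: measurable_sum => k; apply: measurable_funM.
  exact: (measurableT_comp (@measurable_coord R 1 D 0 k) measurable_snd).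
case: (unliftP ord0 k) => [l ->|->]; last by under eq_fun do rewrite cons_row0; exact: measurable_cst.
under eq_fun do rewrite cons_rowS.
apply: (measurableT_comp (@measurable_coord R 1 d 0 l)).
exact: (measurableT_comp (measurable_nth j) measurable_fst).
Qed.

(** For affinely independent [Y], the heights of the [D] points and the coefficients [c] of the
    graph through them determine each other linearly by the matrix [(lmx Y)^T], whose determinant is
    the Jacobian; the degenerate [Y] form a null set. *)
Lemma pmu_planes (G : seq 'rV[R]_D -> \bar R) :
  measurable_fun setT G -> (forall v, 0 <= G v)%E ->
  (\int[pmu R D D]_xs G xs =
   \int[vmu R D]_c \int[pmu R d D]_ys
     ((`|\det (lmx (@nthf R d D ys))|)%:E * G (on_plane c (@nthf R d D ys))))%E.
Proof.
move=> mG G0.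
pose F (p : seq E * 'rV[R]_D) : \bar R :=
  ((`|\det (lmx (@nthf R d D p.1))|)%:E * G (on_plane p.2 (@nthf R d D p.1)))%E.
have mF : measurable_fun setT F.
  apply: emeasurable_funM; last exact: (measurableT_comp mG measurable_on_plane).
  apply/measurable_EFinP; apply: measurableT_comp => //.
  exact: (measurableT_comp measurable_lmx measurable_fst).
have F0 p : (0 <= F p)%E by rewrite mule_ge0.
rewrite -(tonelli_swap (pmu R d D) (vmu R D) mF F0) pmu_split//.
pose P1 (Y : 'I_D -> E) : \bar R := (\int[vmu R D]_z G (join z Y))%E.
pose P2 (Y : 'I_D -> E) : \bar R :=
  (\int[vmu R D]_c ((`|\det (lmx Y)|)%:E * G (on_plane c Y)))%E.
rewrite -[LHS]/(\int[pmu R d D]_ys P1 (@nthf R d D ys))%E -[RHS]/(\int[pmu R d D]_ys P2 (@nthf R d D ys))%E.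
have P10 Y : (0 <= P1 Y)%E by apply: integral_ge0.
have P20 Y : (0 <= P2 Y)%E by apply: integral_ge0 => c _; rewrite mule_ge0.
have mP1 : measurable_fun setT (fun ys => P1 (@nthf R d D ys)).
  have mGj : measurable_fun setT (fun p : seq E * 'rV[R]_D => G (join p.2 (@nthf R d D p.1))).
    apply: (measurableT_comp mG); apply: measurable_join_comp.
      exact: measurable_snd.
    exact: measurable_fst.
  exact: (measurable_integral_param (vmu R D) mGj (fun=> G0 _)).
have mP2 : measurable_fun setT (fun ys => P2 (@nthf R d D ys)).
  exact: (measurable_integral_param (vmu R D) mF F0).
rewrite (pmuE D mP1 (fun=> P10 _)) (pmuE D mP2 (fun=> P20 _)).
rewrite -(iint_pint P1) -(iint_pint P2).
apply: (eq_iint_inull _ _ _ lmx_inull) => [s|s|s /eqP det0]; [exact: P10|exact: P20|].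
rewrite /P1 /P2; set Y := @points_of R d D s in det0 *.
have uY : (lmx Y)^T \in unitmx by rewrite unitmx_tr unitmxE unitfE.
have mGY : measurable_fun setT (fun z => G (join z Y)).
  exact: (measurableT_comp mG (measurable_join_l Y)).
have mGc : measurable_fun setT (fun c => G (on_plane c Y)).
  exact: (measurableT_comp mGY (measurable_dotv_mul (lmx Y)^T)).
by rewrite (vmu_linear uY mGY (fun=> G0 _)) det_tr (integral_scale (vmu R D) mGc (fun=> G0 _)).
Qed.

End planes.

(** * Cap volumes and the weight of a hyperplane *)

Section plane_caps.
Variables (R : realType) (m : nat).
Local Notation d := m.+1.
Local Notation D := m.+2.
Local Notation E := 'rV[R]_d.
Local Notation leb := (@lebesgue_measure R).
Variable K : set 'rV[R]_D.
Hypothesis mK : measurable K.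
Implicit Types p : R * E.

(** Signed vertical height of [x] above the plane with offset [p.1] and slope [p.2]. *)
Definition dev p (x : 'rV[R]_D) : R := dotv (cons_row (1, - p.2)) x - p.1.

Definition side (s : R) p : \bar R :=
  (\int[vmu R D]_x (\1_K x * (0 < s * dev p x)%R%:R)%:E)%E.

(* The weight of the plane [{(z, y) | z = p.2 . y + p.1}] in the distribution of the
   hyperplane through [D] random points of [K]: a Blaschke-Petkantschin formula. *)
Definition isec p : \bar R := (\int[pmu R d D]_ys
  (`|\det (lmx (@nthf R d D ys))| *
   \prod_(i < D) \1_K (cons_row (p.1 + dotv p.2 (nth 0 ys i), nth 0 ys i)))%:E)%E.

Lemma nth_on_plane p (Y : 'I_D -> E) (i : 'I_D) :
  nth 0 (on_plane (cons_row p) Y) i = cons_row (p.1 + dotv p.2 (Y i), Y i).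
Proof. by rewrite nth_join mul_lmx dotv_cons mulr1. Qed.

(** Both functionals vanish at the same [D] points, so they are proportional; the factor is the
    value at [z0], a point at height one above the plane. *)
Lemma adets_on_plane p (Y : 'I_D -> E) : \det (lmx Y) != 0 ->
  exists2 al, al != 0 & forall x, adets (on_plane (cons_row p) Y) x = al * dev p x.
Proof.
move=> detY; set xs := on_plane _ _.
pose X (i : 'I_D) := nth 0 xs i.
have XE i : X i = cons_row (p.1 + dotv p.2 (Y i), Y i) by exact: nth_on_plane.
have dev0 i : dotv (cons_row (1, - p.2)) (X i) = p.1.
  by rewrite XE dotv_cons mul1r dotvNl addrK.
pose z0 : 'rV[R]_D := cons_row (p.1 + 1, 0).
have devz0 : dotv (cons_row (1, - p.2)) z0 - p.1 = 1.
  by rewrite /z0 dotv_cons mul1r [dotv _ 0]dotvC dotv0l addr0 addrC addKr.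
exists (adet X z0); last first.
  by move=> x; have := adet_prop dev0 x z0; rewrite devz0 mul1r mulrC => ->.
(* If the factor were zero, a kernel vector would give a nonzero affine functional vanishing at the
   points and at [z0]. Restricted to the plane it is an affine function of [Y] with coefficients
   [c]; as [lmx Y] is invertible, [c] is zero, and so is the functional. *)
apply/negP => /eqP a0.
have /eqP/det0P[v v0 vA] : \det (adet_mx X z0)^T = 0 by rewrite det_tr.
have rowE i : (v *m (adet_mx X z0)^T) 0 i = \sum_j v 0 j * adet_mx X z0 i j.
  by rewrite mxE; apply: eq_bigr => j _; rewrite mxE.
have [w0 [w wE]] := cons_row_surj (lsubmx v); pose l := rsubmx v 0 0.
have liftE (y : 'rV[R]_D) : \sum_j v 0 j * lift1 y 0 j = dotv (cons_row (w0, w)) y + l.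
  rewrite big_split_ord/= big_ord1 dotvE; congr (_ + _).
    by apply: eq_bigr => j _; rewrite /lift1 row_mxEl -wE mxE.
  by rewrite /lift1 row_mxEr mxE eqxx mulr1 /l mxE.
have row0 i : \sum_j v 0 j * adet_mx X z0 i j = 0 by rewrite -rowE vA mxE.
have hX i : dotv (cons_row (w0, w)) (X i) + l = 0.
  rewrite -liftE -[RHS](row0 (lshift 1 i)); apply: eq_bigr => j _.
  by rewrite /adet_mx col_mxEu mxE.
have hz : dotv (cons_row (w0, w)) z0 + l = 0.
  rewrite -liftE -[RHS](row0 (rshift D 0)); apply: eq_bigr => j _.
  by rewrite /adet_mx col_mxEd.
pose c : 'rV[R]_D := cons_row (w0 * p.1 + l, w0 *: p.2 + w).
have c0 : c = 0.
  have uY : (lmx Y)^T \in unitmx by rewrite unitmx_tr unitmxE unitfE.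
  rewrite -(mulmxK uY c) (_ : c *m (lmx Y)^T = 0) ?mul0mx//.
  apply/rowP => i; rewrite mul_lmx mxE dotv_cons mulr1 dotvDl dotvZl -(hX i) XE dotv_cons/=.
  ring.
have w00 : w0 = 0.
  have := congr1 (fun x : 'rV[R]_D => x 0 0) c0; rewrite /c cons_row0 mxE /= => e1.
  move: hz; rewrite dotv_cons/= [dotv w 0]dotvC dotv0l addr0 mulrDr mulr1 addrAC e1 add0r.
  by [].
have l0 : l = 0.
  by have := congr1 (fun x : 'rV[R]_D => x 0 0) c0; rewrite /c cons_row0 mxE /= w00 mul0r add0r.
have w_0 : w = 0.
  apply/rowP => j; have := congr1 (fun x : 'rV[R]_D => x 0 (lift ord0 j)) c0.
  by rewrite /c cons_rowS/= w00 scale0r add0r !mxE.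
move/eqP: v0; apply; rewrite -(hsubmxK v) wE w00 w_0.
have -> : rsubmx v = 0 by apply/matrixP => i j; rewrite !ord1 [RHS]mxE.
have -> : cons_row (0 : R, 0 : E) = 0.
  apply/rowP => j; case: (unliftP ord0 j) => [k ->|->]; rewrite ?cons_rowS ?cons_row0 !mxE//.
by rewrite row_mx0.
Qed.

(** The sign of the factor between [adets] and [dev] depends on [Y], but a change of sign only
    exchanges the two sides, and the sum is symmetric in them. *)
Lemma cap_on_plane p (Y : 'I_D -> E) k : \det (lmx Y) != 0 ->
  (cap K 1 (on_plane (cons_row p) Y) ^+ k + cap K (-1) (on_plane (cons_row p) Y) ^+ k =
   side 1 p ^+ k + side (-1) p ^+ k)%E.
Proof.
move=> detY; have [al al0 alE] := adets_on_plane p detY.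
have capE s s' : (forall r, (0 < s * (al * r)) = (0 < s' * r)) ->
    cap K s (on_plane (cons_row p) Y) = side s' p.
  by move=> ss; apply: eq_integral => x _; rewrite /half_ind/= alE ss.
have [al_pos|al_neg] : (0 < al) \/ (al < 0) by move: al0; rewrite neq_lt => /orP[h|h]; [right|left].
- rewrite (capE 1 1) ?(capE (-1) (-1))// => r.
    by rewrite !mulN1r !oppr_gt0 pmulr_rlt0.
  by rewrite !mul1r pmulr_rgt0.
- rewrite (capE 1 (-1)) ?(capE (-1) 1)// 1?addeC// => r.
    by rewrite !mulN1r mul1r oppr_gt0 nmulr_rlt0.
  by rewrite mul1r mulN1r nmulr_rgt0// oppr_gt0.
Qed.

Lemma measurable_dotv_pair k dX (X : measurableType dX) (f g : X -> 'rV[R]_k) :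
  measurable_fun setT f -> measurable_fun setT g ->
  measurable_fun setT (fun x => dotv (f x) (g x)).
Proof.
move=> mf mg; under eq_fun do rewrite dotvE; apply: measurable_sum => j.
apply: measurable_funM; [exact: (measurableT_comp (@measurable_coord R 1 k 0 j) mf)|].
exact: (measurableT_comp (@measurable_coord R 1 k 0 j) mg).
Qed.

Lemma side_ge0 s p : (0 <= side s p)%E.
Proof. by apply: integral_ge0 => x _; rewrite lee_fin mulr_ge0// indicE. Qed.

Lemma measurable_side s : measurable_fun setT (side s).
Proof.
pose F (q : (R * E) * 'rV[R]_D) : \bar R := (\1_K q.2 * (0 < s * dev q.1 q.2)%R%:R)%:E.
have mF : measurable_fun setT F.
  apply/measurable_EFinP; apply: measurable_funM.
    exact: (measurable_indK mK measurable_snd).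
  apply: measurable_gt0; apply: measurable_funM; first exact: measurable_cst.
  apply: measurable_funB; last exact: (measurableT_comp measurable_fst measurable_fst).
  apply: measurable_dotv_pair; last exact: measurable_snd.
  apply: (measurableT_comp (@measurable_cons_row R d)).
  apply: measurable_fun_pair; first exact: measurable_cst.
  apply: measurable_into_mx => i j; under eq_fun do rewrite mxE -mulN1r.
  apply: measurable_funM; first exact: measurable_cst.
  apply: (measurableT_comp (@measurable_coord R 1 d i j)).
  exact: (measurableT_comp measurable_snd measurable_fst).
by apply: (measurable_integral_param (vmu R D) mF) => q; rewrite lee_fin mulr_ge0// indicE.
Qed.

Definition isec_term (q : (R * E) * seq E) : R := `|\det (lmx (@nthf R d D q.2))| *
   \prod_(i < D) \1_K (cons_row (q.1.1 + dotv q.1.2 (nth 0 q.2 i), nth 0 q.2 i)).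

Lemma isec_term_ge0 q : 0 <= isec_term q.
Proof. by rewrite mulr_ge0//; apply: prodr_ge0 => i _; rewrite indicE. Qed.

Lemma measurable_isec_term : measurable_fun setT isec_term.
Proof.
apply: measurable_funM.
  apply: measurableT_comp => //; exact: (measurableT_comp (@measurable_lmx R m) measurable_snd).
apply: measurable_prod => i _; apply: (measurable_indK mK).
have mn : measurable_fun setT (fun q : (R * E) * seq E => nth 0 q.2 i).
  exact: (measurableT_comp (measurable_nth i) measurable_snd).
apply: (measurableT_comp (@measurable_cons_row R d)); apply: measurable_fun_pair => //.
apply: measurable_funD; first exact: (measurableT_comp measurable_fst measurable_fst).
by apply: measurable_dotv_pair => //; exact: (measurableT_comp measurable_snd measurable_fst).
Qed.

Lemma isec_ge0 p : (0 <= isec p)%E.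
Proof. by apply: integral_ge0 => ys _; rewrite lee_fin (isec_term_ge0 (p, ys)). Qed.

Lemma measurable_isec : measurable_fun setT isec.
Proof.
have mF : measurable_fun setT (fun q => (isec_term q)%:E).
  by apply/measurable_EFinP; exact: measurable_isec_term.
by apply: (measurable_integral_param (pmu R d D) mF) => q; rewrite lee_fin isec_term_ge0.
Qed.

Lemma facet_int_planes n : facet_int n K = (\int[vmu R d]_a \int[leb]_b
  (isec (b, a) * (side 1 (b, a) ^+ (n - D) + side (-1) (b, a) ^+ (n - D))))%E.
Proof.
set k := (n - D)%N.
pose G (xs : seq 'rV[R]_D) : \bar R := ((all_in K xs)%:E * (cap K 1 xs ^+ k + cap K (-1) xs ^+ k))%E.
have mG : measurable_fun setT G.
  apply: emeasurable_funM; first by apply/measurable_EFinP; exact: measurable_all_in.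
  by apply: emeasurable_funD; apply: measurable_pow; exact: measurable_cap.
have G0 xs : (0 <= G xs)%E.
  by rewrite mule_ge0 ?lee_fin ?all_in_ge0// adde_ge0// expe_ge0// cap_ge0.
rewrite /facet_int -/k (pmu_planes mG G0).
pose S p : \bar R := (side 1 p ^+ k + side (-1) p ^+ k)%E.
have S0 p : (0 <= S p)%E by rewrite adde_ge0// expe_ge0// side_ge0.
have mS : measurable_fun setT S.
  by apply: emeasurable_funD; apply: measurable_pow; exact: measurable_side.
pose H p : \bar R := (isec p * S p)%E.
have mH : measurable_fun setT H by apply: emeasurable_funM => //; exact: measurable_isec.
have H0 p : (0 <= H p)%E by rewrite mule_ge0// isec_ge0.
have cE p : (\int[pmu R d D]_ys ((`|\det (lmx (@nthf R d D ys))|)%:E *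
    G (on_plane (cons_row p) (@nthf R d D ys))) = H p)%E.
  rewrite /H /isec -ge0_integralZr//; first last.
  - by move=> ys _; rewrite lee_fin (isec_term_ge0 (p, ys)).
  - apply/measurable_EFinP; exact: (measurable_section_l p measurable_isec_term).
  apply: eq_integral => ys _; have [det0|detY] := eqVneq (\det (lmx (@nthf R d D ys))) 0.
    by rewrite det0 normr0 mul0r !mul0e.
  rewrite /G cap_on_plane// muleA -EFinM; congr (_%:E * _)%E; congr (_ * _).
  by apply: eq_bigr => i _; rewrite nth_on_plane.
have mL : measurable_fun setT (fun c : 'rV[R]_D => \int[pmu R d D]_ys
    ((`|\det (lmx (@nthf R d D ys))|)%:E * G (on_plane c (@nthf R d D ys))))%E.
  have mF : measurable_fun setT (fun q : 'rV[R]_D * seq E =>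
      (`|\det (lmx (@nthf R d D q.2))|)%:E * G (on_plane q.1 (@nthf R d D q.2)))%E.
    apply: emeasurable_funM.
      apply/measurable_EFinP; apply: measurableT_comp => //.
      exact: (measurableT_comp (@measurable_lmx R m) measurable_snd).
    apply: (measurableT_comp mG).
    apply: (@measurableT_comp _ _ _ _ _ _ (fun p : seq E * 'rV[R]_D => on_plane p.2 (@nthf R d D p.1)) _
      (fun q : 'rV[R]_D * seq E => (q.2, q.1))); first exact: measurable_on_plane.
    exact: measurable_fun_pair.
  by apply: (measurable_integral_param (pmu R d D) mF) => q; rewrite mule_ge0.
rewrite vmuS//; last by move=> c; apply: integral_ge0 => ys _; rewrite mule_ge0.
transitivity (\int[leb]_b \int[vmu R d]_a H (b, a))%E.
  by apply: eq_integral => b _; apply: eq_integral => a _; exact: cE.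
by rewrite (tonelli_swap leb (vmu R d) mH H0).
Qed.

End plane_caps.

(** * Parallel planes *)

Section line_scaling.
Variable R : realType.
Local Notation leb := (@lebesgue_measure R).
Implicit Types (A I F G : R -> \bar R) (v : R -> R).

Lemma bernoulli_convex (w x : R) k : 0 <= w -> 0 <= x ->
  w ^+ k.+1 + k.+1%:R * x * w ^+ k <= (w + x) ^+ k.+1.
Proof.
move=> w0 x0; elim: k => [|k IH]; first by rewrite !expr1 expr0 mulr1 mul1r.
have h := ler_wpM2r (addr_ge0 w0 x0) IH; rewrite [X in _ <= X]exprSr.
apply: le_trans h.
have wk : 0 <= w ^+ k by exact: exprn_ge0.
have : 0 <= k.+1%:R * x * w ^+ k * x by rewrite !mulr_ge0.
rewrite (_ : k.+2%:R = k.+1%:R + 1 :> R) ?[w ^+ k.+2]exprSr ?[w ^+ k.+1]exprSr; last by rewrite -natr1.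
move: (w ^+ k) (k.+1%:R) => y z; lra.
Qed.

Lemma eq_integral_off (c : R) F G : (forall t, 0 <= F t)%E -> (forall t, 0 <= G t)%E ->
  (forall t, t != c -> F t = G t) -> (\int[leb]_t F t = \int[leb]_t G t)%E.
Proof.
move=> F0 G0 FG; apply: eq_integral_ae_nonmeas => //.
exists [set c]; split; [exact: measurable_set1|exact: lebesgue_measure_set1|].
by move=> t /= h; apply/eqP; apply: contrapT => /negP tc; apply: h; exact: FG.
Qed.

Lemma le_integral_off0 F G : measurable_fun setT F -> measurable_fun setT G ->
  (forall t, 0 <= F t)%E -> (forall t, 0 <= G t)%E ->
  (forall t : R, (t != 0)%R -> F t <= G t)%E -> (\int[leb]_t F t <= \int[leb]_t G t)%E.
Proof.
move=> mF mG F0 G0 FG.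
rewrite (@eq_integral_off 0 F (fun t => Order.min (F t) (G t)))//; last first.
- by move=> t t0; rewrite min_l// FG.
- by move=> t; rewrite le_min F0 G0.
apply: ge0_le_integral => //.
- by move=> t _; rewrite le_min F0 G0.
- exact: measurable_mine.
- by move=> t _; rewrite ge_min lexx orbT.
Qed.

Lemma integral_dilate lam F : 0 < lam -> measurable_fun setT F -> (forall t, 0 <= F t)%E ->
  (\int[leb]_t F t = lam%:E * \int[leb]_t F (lam * t)%R)%E.
Proof.
move=> lam0 mF F0; rewrite (@leb_affine R lam 0 F) ?gt_eqF// gtr0_norm//.
by congr (_ * _)%E; apply: eq_integral => t _; rewrite addr0.
Qed.

Lemma measurable_lt_cst (t : R) : measurable_fun [set: R] (fun x : R => (x < t)%R%:R : R).
Proof.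
rewrite (_ : (fun x => _) = (fun x : R => (0 < t - x)%R%:R)); last by apply/funext => x; rewrite subr_gt0.
by apply: measurable_gt0; apply: measurable_funB => //; exact: measurable_cst.
Qed.

Lemma measurable_le_cst (v : R -> R) (t : R) : measurable_fun setT v ->
  measurable_fun setT (fun x : R => (v x <= t)%R%:R : R).
Proof.
move=> mv; rewrite (_ : (fun x => _) = (fun x : R => 1 - (0 < v x - t)%R%:R)).
  apply: measurable_funB; first exact: measurable_cst.
  by apply: measurable_gt0; apply: measurable_funB => //; exact: measurable_cst.
by apply/funext => x; rewrite subr_gt0 ltNge; case: (_ <= _); rewrite ?subr0 ?subrr.
Qed.

Lemma measurable_dilate (lam : R) : measurable_fun [set: R] (fun t : R => lam * t).
Proof. by apply: measurable_funM; [exact: measurable_cst|exact: measurable_id]. Qed.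

(** * Scaling in the depth of section areas [A], plane weights [I] and cap volumes [v] *)

Section scaling.
Variables (A I : R -> \bar R) (v : R -> R) (l vol lam kap mu t0 v0 : R).
Hypotheses (mA : measurable_fun setT A) (mI : measurable_fun setT I) (mv : measurable_fun setT v).
Hypotheses (A0 : forall t, (0 <= A t)%E) (I0 : forall t, (0 <= I t)%E).
Hypotheses (Aneg : forall t, t < 0 -> A t = 0%E) (Ineg : forall t, t < 0 -> I t = 0%E).
Hypotheses (l0 : 0 <= l) (vE : forall t, (v t)%:E = (l%:E * \int[leb]_x (A x * (x < t)%R%:R%:E))%E).
Hypotheses (lam0 : 0 < lam) (kap0 : 0 <= kap) (mu0 : 0 <= mu) (mu1 : lam * mu <= 1).
Hypothesis HI : forall t, 0 < t <= t0 -> (kap%:E * I t <= I (lam * t)%R)%E.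
Hypothesis HA : forall t, 0 < t <= t0 -> (A (lam * t)%R <= mu%:E * A t)%E.
Hypothesis vvol : forall t, v t <= vol.

Lemma v_ge0 t : 0 <= v t.
Proof.
by rewrite -lee_fin vE mule_ge0// integral_ge0// => x _; rewrite mule_ge0// lee_fin.
Qed.

Let mAlt t : measurable_fun setT (fun x : R => A x * (x < t)%R%:R%:E)%E.
Proof. by apply: emeasurable_funM => //; apply/measurable_EFinP; exact: measurable_lt_cst. Qed.

(** The depth substitution contributes the factor [lam] and the section areas the factor [mu]. *)
Lemma v_scaling t : t <= t0 -> v (lam * t) <= lam * mu * v t.
Proof.
move=> tt0; rewrite -lee_fin EFinM !vE muleCA lee_wpmul2l// (integral_dilate lam0 (mAlt _)); last first.
  by move=> x; rewrite mule_ge0// lee_fin.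
have At0 x : (0 <= A x * (x < t)%R%:R%:E)%E by rewrite mule_ge0// lee_fin.
rewrite EFinM -muleA lee_wpmul2l ?lee_fin ?(ltW lam0)// (integral_scale leb (mAlt t) At0 mu0).
apply: le_integral_off0.
- apply: (measurableT_comp (mAlt _)); exact: measurable_dilate.
- by apply: emeasurable_funM => //; exact: measurable_cst.
- by move=> x; rewrite mule_ge0// lee_fin.
- by move=> x; rewrite !mule_ge0// lee_fin.
move=> x x0; rewrite ltr_pM2l// muleA.
have [xt|] := ltP x t; last by rewrite !mule0.
rewrite !mule1; have [xneg|xpos] := ltP x 0.
  by rewrite Aneg ?pmulr_rlt0// mule_ge0.
by apply: HA; rewrite lt_neqAle eq_sym x0 xpos/= (le_trans (ltW xt)).
Qed.

Hypothesis Hcut : forall t, v t <= v0 -> t <= t0.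

(** The contribution to Phi(k) of the parallel planes of one slope, up to the factor [len]. *)
Definition thin_int (k : nat) : \bar R :=
  (\int[leb]_t (I t * ((vol - v t) ^+ k * (v t <= v0)%R%:R)%:E))%E.

Let wt k t : 0 <= (vol - v t) ^+ k * (v t <= v0)%R%:R.
Proof. by rewrite mulr_ge0// exprn_ge0// subr_ge0. Qed.

Lemma measurable_thin k : measurable_fun setT
  (fun t => I t * ((vol - v t) ^+ k * (v t <= v0)%R%:R)%:E)%E.
Proof.
apply: emeasurable_funM => //; apply/measurable_EFinP; apply: measurable_funM.
  by apply: measurable_funX; apply: measurable_funB => //; exact: measurable_cst.
exact: measurable_le_cst.
Qed.

Lemma thin_int_ge0 k : (0 <= thin_int k)%E.
Proof. by apply: integral_ge0 => t _; rewrite mule_ge0// lee_fin. Qed.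

(* Substitute [t -> lam * t] in [thin_int k.+1] and expand
   [(vol - lam * mu * v t) ^ k.+1] by Bernoulli's inequality at [vol - v t]. *)
Lemma scaling_inequality k :
  ((lam * kap)%:E * (thin_int k.+1 + (k.+1%:R * (1 - lam * mu) * vol)%:E * thin_int k) <=
   (1 + lam * kap * (k.+1%:R * (1 - lam * mu)))%:E * thin_int k.+1)%E.
Proof.
set c := k.+1%:R * (1 - lam * mu).
have c0 : 0 <= c by rewrite mulr_ge0// subr_ge0.
have vol0 : 0 <= vol by exact: le_trans (v_ge0 0) (vvol 0).
have lk0 : 0 <= lam * kap by rewrite mulr_ge0// ltW.
have mu2 : 0 <= lam * mu by rewrite mulr_ge0// ltW.
pose psi t := (vol - lam * mu * v t) ^+ k.+1 * (v t <= v0)%R%:R.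
have psi0 t : 0 <= psi t.
  rewrite mulr_ge0// exprn_ge0// subr_ge0 (le_trans _ (vvol t))// ler_piMl// v_ge0//.
have mpsi : measurable_fun setT (fun t => I t * (psi t)%:E)%E.
  apply: emeasurable_funM => //; apply/measurable_EFinP; apply: measurable_funM.
    apply: measurable_funX; apply: measurable_funB; first exact: measurable_cst.
    by apply: measurable_funM => //; exact: measurable_cst.
  exact: measurable_le_cst.
pose J := (\int[leb]_t (I t * (psi t)%:E))%E.
have step1 : ((lam * kap)%:E * J <= thin_int k.+1)%E.
  rewrite /thin_int (integral_dilate lam0 (measurable_thin _)); last first.
    by move=> t; rewrite mule_ge0// lee_fin.
  have It0 x : (0 <= I x * (psi x)%:E)%E by rewrite mule_ge0// lee_fin.
  rewrite EFinM -muleA lee_wpmul2l ?lee_fin ?(ltW lam0)// (integral_scale leb mpsi It0 kap0).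
  apply: le_integral_off0.
  - by apply: emeasurable_funM => //; exact: measurable_cst.
  - apply: (measurableT_comp (measurable_thin _)); exact: measurable_dilate.
  - by move=> t; rewrite !mule_ge0// lee_fin.
  - by move=> t; rewrite mule_ge0// lee_fin.
  move=> t tn0; have [tneg|tpos] := ltP t 0.
    by rewrite Ineg// mul0e mule0 mule_ge0// lee_fin.
  rewrite muleA /psi; have [vt|] := boolP (v t <= v0); last first.
    by rewrite mulr0 mule0 mule_ge0// lee_fin.
  have tt0 := Hcut vt.
  have vl := v_scaling tt0.
  have vlt : v (lam * t) <= v t by rewrite (le_trans vl)// ler_piMl// v_ge0.
  rewrite (le_trans vlt vt) !mulr1; apply: lee_pmul => //.
  - by rewrite mule_ge0.
  - by rewrite lee_fin exprn_ge0// subr_ge0 (le_trans _ (vvol t))// ler_piMl// v_ge0.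
  - by apply: HI; rewrite lt_neqAle eq_sym tn0 tpos.
  rewrite lee_fin lerXn2r ?nnegrE ?subr_ge0 ?lerB//.
  by rewrite (le_trans _ (vvol t))// ler_piMl// v_ge0.
have step2 : (thin_int k.+1 + (c * vol)%:E * thin_int k <= J + c%:E * thin_int k.+1)%E.
  pose f j t : \bar R := (I t * ((vol - v t) ^+ j * (v t <= v0)%R%:R)%:E)%E.
  have mf j : measurable_fun setT (f j) by exact: measurable_thin.
  have f0 j t : (0 <= f j t)%E by rewrite mule_ge0// lee_fin.
  have cv0 : 0 <= c * vol by rewrite mulr_ge0.
  have mcf e j : measurable_fun setT (fun t => e%:E * f j t)%E.
    by apply: emeasurable_funM => //; exact: measurable_cst.
  have cf0 e j t : 0 <= e -> (0 <= e%:E * f j t)%E by move=> e0; rewrite mule_ge0.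
  have Jf0 t : (0 <= I t * (psi t)%:E)%E by rewrite mule_ge0// lee_fin.
  rewrite -[thin_int k]/(\int[leb]_t f k t)%E -[thin_int k.+1]/(\int[leb]_t f k.+1 t)%E.
  rewrite (integral_scale leb (mf k) (f0 k) cv0) (integral_scale leb (mf k.+1) (f0 k.+1) c0).
  rewrite -(ge0_integralD leb measurableT (fun t _ => f0 _ t) (mf _) (fun t _ => cf0 _ _ t cv0) (mcf _ _)).
  rewrite /J -(ge0_integralD leb measurableT (fun t _ => Jf0 t) mpsi (fun t _ => cf0 _ _ t c0) (mcf _ _)).
  apply: ge0_le_integral => //.
  - by move=> t _; rewrite adde_ge0// cf0.
  - by apply: emeasurable_funD; [exact: mf|exact: mcf].
  - by apply: emeasurable_funD; [exact: mpsi|exact: mcf].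
  move=> t _; rewrite /f ![(_%:E * (I t * _))%E]muleCA -!EFinM.
  rewrite -!ge0_muleDr ?lee_fin ?(mulr_ge0 cv0) ?(mulr_ge0 c0)//.
  rewrite lee_wpmul2l// -!EFinD lee_fin /psi.
  case: (v t <= v0); last by rewrite !mulr0 !addr0.
  rewrite !mulr1; have := @bernoulli_convex (vol - v t) ((1 - lam * mu) * v t) k _ _.
  rewrite subr_ge0 vvol mulr_ge0 ?subr_ge0 ?v_ge0// => /(_ isT isT).
  have -> : vol - v t + (1 - lam * mu) * v t = vol - lam * mu * v t by ring.
  rewrite /c exprS; move: (v t) ((vol - _) ^+ k) (_ ^+ k.+1) (k.+1%:R) => x y z n h.
  nra.
have T0 := thin_int_ge0; have J0 : (0 <= J)%E by apply: integral_ge0 => t _; rewrite mule_ge0// lee_fin.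
apply: (le_trans (lee_wpmul2l _ step2)); first by rewrite lee_fin.
have cT0 : (0 <= c%:E * thin_int k.+1)%E by rewrite mule_ge0 ?lee_fin.
rewrite (ge0_muleDr _ J0 cT0) EFinD ge0_muleDl ?lee_fin ?(mulr_ge0 lk0 c0)// mul1e.
by apply: leeD; rewrite // muleA -EFinM.
Qed.

(** Provides an explicit depth, the same for all slopes, at which caps are as small as desired. *)
Lemma v_iter j : 0 < t0 -> lam <= 1 -> v (lam ^+ j * t0) <= (lam * mu) ^+ j * vol.
Proof.
move=> t00 lam1; elim: j => [|j IH]; first by rewrite !expr0 !mul1r.
have h : v (lam * (lam ^+ j * t0)) <= lam * mu * v (lam ^+ j * t0).
  by apply: v_scaling; rewrite ler_piMl ?(ltW t00)// exprn_ile1// ltW.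
rewrite exprS -mulrA; apply: (le_trans h); rewrite exprS -[X in _ <= X]mulrA.
by rewrite ler_wpM2l// mulr_ge0// ltW.
Qed.

End scaling.

Section dilation.
Variables (F : R -> \bar R) (v : R -> R) (th T c : R).
Hypotheses (mF : measurable_fun setT F) (F0 : forall t, (0 <= F t)%E).
Hypotheses (Fneg : forall t, t < 0 -> F t = 0%E) (Ffar : forall t, T < t -> F t = 0%E).
Hypotheses (th0 : 0 < th) (c0 : 0 <= c).
Hypothesis HF : forall t, 0 < t -> (c%:E * F t <= F (th * t)%R)%E.

(** Dilation by [th] carries depths up to [T], beyond which [F] vanishes, to depths up to [th * T],
    so a fixed fraction of the mass sits there. It serves twice: to bound cap volumes from below,
    and to bound the weight of thin caps from below. *)
Lemma dilation_mass (g : R -> R) : measurable_fun setT g -> (forall t, 0 <= g t) ->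
  (forall t, t <= th * T -> 1 <= g t) ->
  ((th * c)%:E * \int[leb]_t F t <= \int[leb]_t (F t * (g t)%:E))%E.
Proof.
move=> mg g0 g1.
have mFg : measurable_fun setT (fun t => F t * (g t)%:E)%E.
  by apply: emeasurable_funM => //; apply/measurable_EFinP.
have Fg0 t : (0 <= F t * (g t)%:E)%E by rewrite mule_ge0// lee_fin.
rewrite (integral_dilate th0 mFg Fg0) EFinM -muleA lee_wpmul2l ?lee_fin ?(ltW th0)//.
rewrite (integral_scale leb mF F0 c0); apply: le_integral_off0.
- by apply: emeasurable_funM => //; exact: measurable_cst.
- exact: (measurableT_comp mFg (@measurable_dilate th)).
- by move=> t; rewrite mule_ge0.
- by move=> t; exact: Fg0.
move=> t tn0; have [tneg|tpos] := ltP t 0; first by rewrite Fneg// mule0.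
have [tT|Tt] := leP t T; last by rewrite Ffar// mule0.
apply: (@le_trans _ _ (F (th * t)%R)); first by apply: HF; rewrite lt_neqAle eq_sym tn0 tpos.
by rewrite -[X in (X <= _)%E]mule1 lee_wpmul2l// lee_fin g1// ler_wpM2l// ltW.
Qed.

End dilation.
End line_scaling.

Section points_scale.
Variables (R : realType) (d : nat).
Local Notation E := 'rV[R]_d.

Definition mapn n (f : E -> E) (ys : seq E) : seq E := mkseq (fun i => f (nth 0 ys i)) n.

Lemma mapn_cons n f y ys : mapn n.+1 f (y :: ys) = f y :: mapn n f ys.
Proof. by rewrite /mapn /mkseq /= (iotaDl 1 0) -map_comp. Qed.

Lemma measurable_mapn n f : measurable_fun setT f -> measurable_fun setT (mapn n f).
Proof.
move=> mf; apply: measurable_into_seq => i; have [ni|ni] := ltnP i n.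
  rewrite (_ : (fun x => _) = fun ys : seq E => f (nth 0 ys i)).
    exact: (measurableT_comp mf (measurable_nth i)).
  by apply/funext => ys; rewrite nth_mkseq.
rewrite (_ : (fun x => _) = cst 0); first exact: measurable_cst.
by apply/funext => ys; rewrite nth_default// size_mkseq.
Qed.

Lemma pmu_scale n (e : R) (q : E) (G : seq E -> \bar R) : 0 < e ->
  measurable_fun setT G -> (forall v, 0 <= G v)%E ->
  (\int[pmu R d n]_ys G ys =
   (e ^+ (d * n))%:E * \int[pmu R d n]_ys G (mapn n (fun y => q + e *: y)%R ys))%E.
Proof.
move=> e0; have mf := @measurable_affine_vec R d e q.
elim: n G => [|n IH] G mG G0.
  rewrite muln0 expr0 mul1e (pmu0E mG G0) pmu0E//.
  exact: (measurableT_comp mG (measurable_mapn 0 mf)).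
have mGm := measurableT_comp mG (measurable_mapn n.+1 mf).
rewrite (pmuS n mG G0) (pmuS n mGm (fun=> G0 _)).
pose H (y : E) : \bar R := (\int[pmu R d n]_ys G (y :: ys))%E.
have mH : measurable_fun setT H by exact: measurable_pmu_section.
have H0 y : (0 <= H y)%E by apply: integral_ge0.
pose H2 (y : E) : \bar R := (\int[pmu R d n]_ys G (y :: mapn n (fun y => q + e *: y)%R ys))%E.
have HH2 y : H y = ((e ^+ (d * n))%:E * H2 y)%E.
  rewrite /H (IH (fun ys => G (y :: ys)) _ (fun=> G0 _))//.
  exact: (measurableT_comp mG (measurable_cons_l y)).
have en0 : 0 < e ^+ (d * n) by exact: exprn_gt0.
have mH2 : measurable_fun setT (fun y : E => H2 (q + e *: y)).
  rewrite (_ : (fun y : E => _) = fun y => ((e ^+ (d * n))^-1%:E * H (q + e *: y)%R)%E).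
    apply: emeasurable_funM; first exact: measurable_cst.
    exact: (measurableT_comp mH mf).
  by apply/funext => y; rewrite HH2 muleA -EFinM mulVf ?gt_eqF// mul1e.
have H20 y : (0 <= H2 y)%E by apply: integral_ge0.
rewrite -[LHS]/(\int[vmu R d]_y H y)%E (vmu_scale q (lt0r_neq0 e0) mH H0) (gtr0_norm e0).
under eq_integral do rewrite HH2.
rewrite -(integral_scale (vmu R d) mH2 (fun=> H20 _) (ltW en0)) muleA -EFinM -exprD -mulnS.
have E2 : (\int[vmu R d]_y \int[pmu R d n]_ys (G \o mapn n.+1 (fun s => (q + e *: s)%R)) (y :: ys) =
    \int[vmu R d]_y H2 (q + e *: y)%R)%E.
  by apply: eq_integral => y _; apply: eq_integral => ys _ /=; rewrite mapn_cons.
by rewrite E2.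
Qed.

End points_scale.

(** * Sections of the body by parallel planes *)

Section slices.
Variables (R : realType) (m : nat).
Local Notation d := m.+1.
Local Notation D := m.+2.
Local Notation E := 'rV[R]_d.
Local Notation leb := (@lebesgue_measure R).
Variable K : set 'rV[R]_D.
Hypothesis mK : measurable K.
Variables (a : E) (s : R) (q : 'rV[R]_D).
Hypothesis ss : s * s = 1.

Definition nrm : 'rV[R]_D := cons_row (1, - a).
Definition len : R := Num.sqrt (dotv nrm nrm).
(** Unit normal of the planes of slope [a]; the sign [s] selects which of the two sides is treated
    as the cap. *)
Definition dir : 'rV[R]_D := (s / len) *: nrm.

(* The parameters of the plane at depth [t] below the support plane at [q]. *)
Definition level (t : R) : R := s * len * (dotv dir q - t).
Definition pl (t : R) (y : E) : 'rV[R]_D := cons_row (level t + dotv a y, y).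
(** The section is measured after projection to the coordinates [y]; its true area is larger by the
    factor [len]. *)
Definition slice (t : R) : \bar R := (\int[vmu R d]_y (\1_K (pl t y))%:E)%E.

Lemma len2 : len * len = dotv nrm nrm.
Proof. by rewrite -expr2 sqr_sqrtr// dotv_ge0. Qed.

Lemma len_gt0 : 0 < len.
Proof.
rewrite sqrtr_gt0 dotv_gt0//; apply/negP => /eqP/(congr1 (fun x : 'rV[R]_D => x 0 0)).
by rewrite /nrm cons_row0 mxE => /eqP; rewrite oner_eq0.
Qed.

Lemma dir_unit : dotv dir dir = 1.
Proof.
have l0 := len_gt0; rewrite /dir dotvZl dotvZr -len2.
have -> : s / len * (s / len * (len * len)) = s * s by field; rewrite gt_eqF.
exact: ss.
Qed.

Lemma dir_cons z y : dotv dir (cons_row (z, y)) = s / len * (z - dotv a y).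
Proof. by rewrite /dir dotvZl /nrm dotv_cons mul1r dotvNl. Qed.

Lemma dir_pl t y : dotv dir (pl t y) = dotv dir q - t.
Proof.
have l0 := len_gt0; rewrite dir_cons addrK /level.
have -> : s / len * (s * len * (dotv dir q - t)) = s * s * (dotv dir q - t) by field; rewrite gt_eqF.
by rewrite ss mul1r.
Qed.

Lemma pl_surj t z y : dotv dir (cons_row (z, y)) = dotv dir q - t -> cons_row (z, y) = pl t y.
Proof.
have l0 := len_gt0; rewrite dir_cons => e1; congr (cons_row (_, _)); rewrite /level -e1.
have -> : s * len * (s / len * (z - dotv a y)) = s * s * (z - dotv a y) by field; rewrite gt_eqF.
by rewrite ss mul1r subrK.
Qed.

Lemma measurable_level : measurable_fun setT level.
Proof.
apply: measurable_funM; first exact: measurable_cst.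
by apply: measurable_funB; [exact: measurable_cst|exact: measurable_id].
Qed.

Lemma measurable_pl : measurable_fun setT (fun p : R * E => pl p.1 p.2).
Proof.
apply: (measurableT_comp (@measurable_cons_row R d)); apply: measurable_fun_pair; last exact: measurable_snd.
apply: measurable_funD; first exact: (measurableT_comp measurable_level measurable_fst).
by apply: measurable_dotv_pair; [exact: measurable_cst|exact: measurable_snd].
Qed.

Lemma measurable_slice_term : measurable_fun setT (fun p : R * E => (\1_K (pl p.1 p.2) : R)%:E).
Proof. by apply/measurable_EFinP; apply: (measurable_indK mK); exact: measurable_pl. Qed.

Lemma slice_term_ge0 (p : R * E) : (0 <= (\1_K (pl p.1 p.2) : R)%:E)%E.
Proof. by rewrite lee_fin indicE. Qed.

Lemma slice_ge0 t : (0 <= slice t)%E.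
Proof. by apply: integral_ge0 => y _; exact: (slice_term_ge0 (t, y)). Qed.

Lemma measurable_slice : measurable_fun setT slice.
Proof. exact: (measurable_integral_param (vmu R d) measurable_slice_term slice_term_ge0). Qed.

Lemma level_subst (F : R -> \bar R) : measurable_fun setT F -> (forall b, 0 <= F b)%E ->
  (\int[leb]_b F b = len%:E * \int[leb]_t F (level t))%E.
Proof.
move=> mF F0; have l0 := len_gt0.
have s1 : `|s| = 1.
  by apply/eqP; rewrite -(@eqrXn2 _ 2)// expr1n real_normK ?num_real// expr2 ss.
have sl0 : - (s * len) != 0.
  have s0 : s != 0 by rewrite -normr_gt0 s1.
  by rewrite oppr_eq0 mulf_neq0// gt_eqF.
rewrite (@leb_affine R (- (s * len)) (s * len * dotv dir q) F)// normrN normrM s1 mul1r gtr0_norm//.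
by congr (_ * _)%E; apply: eq_integral => t _; congr F; rewrite /level; ring.
Qed.

Lemma integral_slices (g : R -> R) : measurable_fun setT g -> (forall t, 0 <= g t) ->
  (\int[vmu R D]_x (\1_K x * g (dotv dir q - dotv dir x)%R)%:E =
   len%:E * \int[leb]_t (slice t * (g t)%:E))%E.
Proof.
move=> mg g0; have l0 := len_gt0.
pose H (p : R * E) : \bar R := (\1_K (cons_row p) * g (dotv dir q - dotv dir (cons_row p)))%:E.
have mdir : measurable_fun setT (fun x : 'rV[R]_D => g (dotv dir q - dotv dir x)).
  apply: (measurableT_comp mg); apply: measurable_funB; first exact: measurable_cst.
  by apply: measurable_dotv_pair; [exact: measurable_cst|exact: measurable_id].
have mG : measurable_fun setT (fun x : 'rV[R]_D => (\1_K x * g (dotv dir q - dotv dir x)%R)%:E).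
  apply/measurable_EFinP; apply: measurable_funM => //.
have G0 x : (0 <= (\1_K x * g (dotv dir q - dotv dir x)%R)%:E)%E by rewrite lee_fin mulr_ge0// indicE.
have mH : measurable_fun setT H by exact: (measurableT_comp mG (@measurable_cons_row R d)).
have H0 p : (0 <= H p)%E by exact: G0.
rewrite vmuS// -[LHS]/(\int[leb]_z \int[vmu R d]_y H (z, y))%E (tonelli_swap leb (vmu R d) mH H0).
pose Q (p : E * R) : \bar R := ((\1_K (pl p.2 p.1) : R)%:E * (g p.2)%:E)%E.
have mQ : measurable_fun setT Q.
  apply: emeasurable_funM; last first.
    by apply/measurable_EFinP; exact: (measurableT_comp mg measurable_snd).
  apply: (@measurableT_comp _ _ _ _ _ _ (fun p : R * E => (\1_K (pl p.1 p.2) : R)%:E) _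
    (fun p : E * R => (p.2, p.1))); first exact: measurable_slice_term.
  exact: measurable_fun_pair.
have Q0 p : (0 <= Q p)%E by rewrite mule_ge0 ?lee_fin ?indicE.
have inner y : (\int[leb]_z H (z, y) = len%:E * \int[leb]_t Q (y, t))%E.
  have mHy : measurable_fun setT (fun z : R => H (z, y)).
    by apply: (measurableT_comp mH); apply: measurable_fun_pair; [exact: measurable_id|exact: measurable_cst].
  have mHs : measurable_fun setT (fun z : R => H (z + dotv a y, y)).
    apply: (measurableT_comp mH); apply: measurable_fun_pair; last exact: measurable_cst.
    by apply: measurable_funD; [exact: measurable_id|exact: measurable_cst].
  rewrite (@leb_affine R 1 (dotv a y) (fun z => H (z, y)) (oner_neq0 _) mHy (fun=> H0 _)) normr1 mul1e.
  under eq_integral do rewrite mul1r.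
  rewrite (level_subst mHs (fun=> H0 _)); congr (_ * _)%E; apply: eq_integral => t _.
  by rewrite /H /Q -/(pl t y) dir_pl subKr EFinM.
under eq_integral do rewrite inner.
rewrite -(integral_scale (vmu R d) _ _ (ltW l0)); first last.
- by move=> y; apply: integral_ge0.
- exact: (measurable_integral_param leb mQ Q0).
congr (_ * _)%E; rewrite (tonelli_swap (vmu R d) leb mQ Q0); apply: eq_integral => t _.
by rewrite /slice -ge0_integralZr// ?lee_fin//; exact: (measurable_section_l t measurable_slice_term).
Qed.

(** [e = 1] gives the cap of depth [t], [e = -1] the rest of the body. *)
Lemma side_slices (e : R) t :
  side K (e * s) (level t, a) =
  (len%:E * \int[leb]_x (slice x * (0 < e * (t - x))%R%:R%:E))%E.
Proof.
have l0 := len_gt0.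
rewrite -(@integral_slices (fun x => (0 < e * (t - x))%R%:R))//; last first.
  apply: measurable_gt0; apply: measurable_funM; first exact: measurable_cst.
  by apply: measurable_funB; [exact: measurable_cst|exact: measurable_id].
apply: eq_integral => x _; congr (_ * _%:R)%:E; congr (nat_of_bool _).
have devE : s * dev (level t, a) x = len * (t - (dotv dir q - dotv dir x)).
  rewrite /dev /= -/nrm /level /dir !dotvZl.
  move: (dotv nrm x) (dotv nrm q) => X Q.
  field: ss; by rewrite gt_eqF.
by rewrite -mulrA devE mulrCA pmulr_rgt0.
Qed.

Lemma volume_slices : (\int[vmu R D]_x (\1_K x : R)%:E = len%:E * \int[leb]_t slice t)%E.
Proof.
have := @integral_slices (cst 1) (measurable_cst _) (fun=> ler01) => /= h.
under eq_integral do rewrite -[\1_K _]mulr1; rewrite h.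
by congr (_ * _)%E; apply: eq_integral => t _; rewrite mule1.
Qed.

Lemma slice_scale (e : R) c t t' : 0 < e -> (forall y, K (pl t y) -> K (pl t' (c + e *: y))) ->
  ((e ^+ d)%:E * slice t <= slice t')%E.
Proof.
move=> e0 h.
have mt t1 : measurable_fun setT (fun y => (\1_K (pl t1 y) : R)%:E).
  exact: (measurable_section_l t1 measurable_slice_term).
have t0 t1 y : (0 <= (\1_K (pl t1 y) : R)%:E)%E by exact: (slice_term_ge0 (t1, y)).
rewrite [X in (_ <= X)%E]/slice (vmu_scale c (lt0r_neq0 e0) (mt t') (t0 t')) (gtr0_norm e0).
rewrite lee_wpmul2l ?lee_fin ?exprn_ge0 ?(ltW e0)//; apply: ge0_le_integral => //.
  exact: (measurableT_comp (mt t') (@measurable_affine_vec R d e c)).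
move=> y _; rewrite lee_fin !indicE; by have [/set_mem/h/mem_set ->|] := boolP (pl t y \in K).
Qed.

Lemma det_lmx_scale (e : R) c (Y : 'I_D -> E) :
  \det (lmx (fun i => c + e *: Y i)) = e ^+ d * \det (lmx Y).
Proof.
pose T : 'M[R]_(1 + d) := block_mx 1%:M c 0 e%:M.
have -> : lmx (fun i => c + e *: Y i) = lmx Y *m (T : 'M[R]_D).
  apply/row_matrixP => i; rewrite row_mul.
  have rE (Z : 'I_D -> E) : row i (lmx Z) = cons_row (1, Z i).
    by apply/rowP => j; rewrite !mxE.
  rewrite !rE /cons_row/=; apply: etrans (esym (@mul_row_block R 1 1 d 1 d _ _ _ _ _ _)).
  by rewrite mulmx1 mulmx0 addr0 mul1mx mul_mx_scalar.
have detT : \det (T : 'M[R]_D) = e ^+ d.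
  by apply: etrans (@det_ublock R 1 d 1%:M c e%:M) _; rewrite det1 det_scalar mul1r.
by rewrite det_mulmx detT mulrC.
Qed.

(** The exponent is [d * D] for moving [D] points in a section of dimension [d], plus [d] for the
    determinant. *)
Lemma isec_scale (e : R) c t t' : 0 < e -> (forall y, K (pl t y) -> K (pl t' (c + e *: y))) ->
  ((e ^+ (d * D + d))%:E * isec K (level t, a) <= isec K (level t', a))%E.
Proof.
move=> e0 h.
pose F t1 ys : \bar R := (isec_term K ((level t1, a), ys))%:E.
have mF t1 : measurable_fun setT (F t1).
  apply/measurable_EFinP; exact: (measurable_section_l (level t1, a) (measurable_isec_term mK)).
have F0 t1 ys : (0 <= F t1 ys)%E by rewrite lee_fin isec_term_ge0.
rewrite -[isec K (level t, a)]/(\int[pmu R d D]_ys F t ys)%E.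
rewrite -[isec K (level t', a)]/(\int[pmu R d D]_ys F t' ys)%E.
rewrite (pmu_scale D c e0 (mF t') (F0 t')) exprD EFinM -muleA.
rewrite lee_wpmul2l ?lee_fin ?exprn_ge0 ?(ltW e0)//.
rewrite (integral_scale (pmu R d D) (mF t) (F0 t) (exprn_ge0 _ (ltW e0))).
apply: ge0_le_integral => //.
- by move=> ys _; rewrite mule_ge0// lee_fin exprn_ge0// ltW.
- by apply: emeasurable_funM; [exact: measurable_cst|exact: mF].
- exact: (measurableT_comp (mF t') (measurable_mapn D (@measurable_affine_vec R d e c))).
move=> ys _; rewrite /F /isec_term/= -EFinM lee_fin.
have -> : lmx (@nthf R d D (mapn D (fun y => c + e *: y) ys)) = lmx (fun i => c + e *: @nthf R d D ys i).
  by congr lmx; apply/funext => i; rewrite /nthf nth_mkseq.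
rewrite det_lmx_scale normrM (ger0_norm (exprn_ge0 _ (ltW e0))) -mulrA.
rewrite ler_wpM2l ?exprn_ge0 ?(ltW e0)// ler_wpM2l//; apply: ler_prod => i _.
rewrite nth_mkseq// !indicE ler0n/=.
have [/set_mem Ky|] := boolP (cons_row (level t + dotv a (nth 0 ys i), nth 0 ys i) \in K); last by rewrite ler0n.
by have /mem_set := h _ Ky; rewrite /pl => ->.
Qed.

End slices.

(** The power of [nu] gained by the plane weights together with the depth substitution, which
    accounts for the 2. *)
Lemma degree_count m : (2 + (m.+1 * m.+2 + m.+1) = m.+2 ^ 2 + 1)%N.
Proof. rewrite -mulnn; lia. Qed.

(** * Choice of the scaling parameters *)

Section parameters.
Variable R : realType.

Lemma bernoulli_sub (x : R) n : 0 <= x <= 1 -> 1 - n%:R * x <= (1 - x) ^+ n.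
Proof.
move=> /andP[x0 x1]; elim: n => [|n IH]; first by rewrite mul0r subr0 expr0.
rewrite exprS -natr1; apply: (@le_trans _ _ ((1 - x) * (1 - n%:R * x))).
  have : 0 <= n%:R * x * x by rewrite !mulr_ge0.
  move: (n%:R : R) => y; lra.
by rewrite ler_wpM2l// subr_ge0.
Qed.

Lemma bernoulli_add (x : R) n : 0 <= x -> 1 + n%:R * x <= (1 + x) ^+ n.
Proof.
move=> x0; elim: n => [|n IH]; first by rewrite mul0r addr0 expr0.
rewrite exprS -natr1; apply: (@le_trans _ _ ((1 + x) * (1 + n%:R * x))).
  have : 0 <= n%:R * x * x by rewrite !mulr_ge0.
  move: (n%:R : R) => y; lra.
by rewrite ler_wpM2l// addr_ge0.
Qed.

(** To first order [kap] is [1 - p x] and [mu] is [1 - r x], so the claim reads [p x < D r x], where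
    [D r >= p + 1]. With [u = p x], the surplus [x] equals [40 u^2], while the second-order errors
    total at most [12 u^2]. *)
Lemma scaling_parameters_real (D p r x kap mu : R) : 2 <= D -> p = D ^+ 2 + 1 -> r = D + 1 ->
  0 < x -> 40 * (p * (p * x)) = 1 -> 1 - p * x - p * x * x <= kap -> 0 <= mu ->
  mu * ((1 + r * x) * (1 - r * x * x)) <= 1 -> mu < 1 /\ kap^-1 - 1 < D * (1 - mu).
Proof.
move=> D2 pE rE x0 px kapge mu0 mule.
have DD : D * 2 <= D ^+ 2 by rewrite expr2 ler_wpM2l// (le_trans _ D2).
have r3 : 3 <= r by rewrite rE; move: D2; lra.
have p5 : 5 <= p by rewrite pE; move: D2 DD; lra.
have rp : r <= p by rewrite rE pE; move: D2 DD; lra.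
have DrE : D * r = D ^+ 2 + D by rewrite rE; ring.
have Dr1 : p + 1 <= D * r by rewrite DrE pE; move: D2; lra.
have Dr2 : D * r <= 2 * p by rewrite DrE pE; move: DD D2; lra.
set u := p * x in px kapge; pose w := r * x.
have u0 : 0 < u by rewrite mulr_gt0//; move: p5; lra.
have u5 : 5 * u <= p * u by rewrite ler_wpM2r// ltW.
have u200 : 200 * u <= 1 by move: u5 px; lra.
have xu : 5 * x <= u by rewrite /u ler_wpM2r// ltW.
have w0 : 0 < w by rewrite mulr_gt0//; move: r3; lra.
have wu : w <= u by rewrite ler_wpM2r// ltW.
have xw : x <= w by rewrite /w ler_peMl ?(ltW x0)//; move: r3; lra.
have uu : u * u <= u / 200.
  by have := ler_wpM2l (ltW u0) u200; move: u0; lra.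
have uu0 : 0 < u * u by rewrite mulr_gt0.
have kap1 : 1 - u - u * u / 5 <= kap.
  have := ler_wpM2l (ltW u0) xu; move: kapge; lra.
have kap0 : 0 < kap by move: kap1 uu u200 u0; lra.
have kinv : kap^-1 <= 1 + u + 6 * (u * u).
  rewrite -[X in X <= _]mulr1 ler_pdivrMl//.
  apply: (@le_trans _ _ ((1 - u - u * u / 5) * (1 + u + 6 * (u * u)))).
    have -> : (1 - u - u * u / 5) * (1 + u + 6 * (u * u)) =
      1 + 24 / 5 * (u * u) - 31 / 5 * (u * (u * u)) - 6 / 5 * (u * (u * (u * u))) by field.
    have h1 := ler_wpM2r (ltW uu0) u200.
    have h2 := ler_wpM2r (ltW (mulr_gt0 u0 uu0)) u200.
    move: h1 h2 uu0; move: (u * (u * u)) (u * (u * (u * u))) (u * u) => *; lra.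
  by rewrite ler_wpM2r//; move: u0 uu0; lra.
have ww0 : 0 < w * w by rewrite mulr_gt0.
have w200 : 200 * w <= 1 by move: wu u200; lra.
have y1 : 1 + w - w * w - w * (w * w) <= (1 + w) * (1 - w * x).
  have := ler_wpM2l (mulr_ge0 (addr_ge0 ler01 (ltW w0)) (ltW w0)) xw; lra.
have mu1 : mu <= 1 - w + 3 * (w * w).
  have yp : 0 < 1 + w - w * w - w * (w * w).
    have h1 := ler_wpM2r (ltW w0) w200; have h2 := ler_wpM2r (ltW ww0) w200.
    by move: h1 h2 w0 w200; lra.
  rewrite -(ler_pM2r yp); apply: (@le_trans _ _ 1).
    by apply: le_trans mule; rewrite ler_wpM2l.
  have -> : (1 - w + 3 * (w * w)) * (1 + w - w * w - w * (w * w)) =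
    1 + w * w + 3 * (w * (w * w)) - 2 * (w * (w * (w * w))) - 3 * (w * (w * (w * (w * w)))) by ring.
  have w30 : 0 < w * (w * w) by rewrite mulr_gt0.
  have h1 := ler_wpM2r (ltW w30) w200.
  have h2 := ler_wpM2r (ltW (mulr_gt0 w0 w30)) w200.
  move: h1 h2 ww0 w30; move: (w * (w * (w * (w * w)))) (w * (w * (w * w))) (w * (w * w)) (w * w) => *; lra.
split.
  by move: mu1 w200 w0 (ler_wpM2r (ltW w0) w200); lra.
have Dmu : D * (w - 3 * (w * w)) <= D * (1 - mu).
  by rewrite ler_wpM2l ?(le_trans _ D2)//; move: mu1; lra.
have h1 : u + x <= D * w.
  have := ler_wpM2r (ltW x0) Dr1; rewrite /w /u; lra.
have h2 : D * (w * w) <= 2 * (u * u).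
  have -> : D * (w * w) = D * r * x * w by rewrite /w; ring.
  have h3 : D * r * x <= 2 * u by have := ler_wpM2r (ltW x0) Dr2; rewrite /u; lra.
  have := ler_pM _ (ltW w0) h3 wu; rewrite !mulr_ge0 ?(ltW x0) ?(le_trans _ D2) ?(le_trans _ r3)// => /(_ isT); lra.
have h3 : 40 * (u * u) = x.
  have -> : 40 * (u * u) = x * (40 * (p * u)) by rewrite {1}/u; ring.
  by rewrite px mulr1.
move: kinv Dmu h1 h2 h3 x0; move: (kap^-1) => K; rewrite mulrBr; lra.
Qed.

(* As [nu] tends to 1 with [e = (1 - nu)^2], the quotient [(1/kap - 1) / (1 - mu)]
   tends to [(D^2 + 1) / (D + 1)], which is less than [D]. *)
Lemma scaling_parameters (m : nat) : let D := m.+2 in let d := m.+1 in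
  exists nu e : R, [/\ 0 < nu < 1, 0 < e < 1 &
    let kap := nu ^+ 2 * ((1 - e) * nu) ^+ (d * D + d) in
    let mu := nu ^+ 2 / ((1 - e) / nu) ^+ d in
    mu < 1 /\ kap^-1 - 1 < D%:R * (1 - mu)].
Proof.
move=> D d.
pose Dr : R := D%:R; pose p : R := (D ^ 2 + 1)%:R; pose r : R := D.+1%:R.
have D2 : 2 <= Dr by rewrite ler_nat.
have pE : p = Dr ^+ 2 + 1 by rewrite /p natrD natrX.
have rE : r = Dr + 1 by rewrite /r -natr1.
have p5 : 5 <= p by rewrite ler_nat -(addn1 4) leq_add2r (leq_trans _ (leq_mul (isT : 2 <= D)%N (isT : 2 <= D)%N)).
have p0 : 0 < p by exact: lt_le_trans p5.
pose x := (40 * (p * p))^-1.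
have x0 : 0 < x by rewrite invr_gt0 !mulr_gt0.
have px : 40 * (p * (p * x)) = 1 by rewrite /x; field; rewrite gt_eqF.
have x1 : 1000 * x <= 1.
  have h1 : 5 * (p * x) <= p * (p * x) by rewrite ler_wpM2r// mulr_ge0 ?ltW.
  have h2 : 5 * x <= p * x by rewrite ler_wpM2r// ltW.
  move: h1 h2 px; lra.
pose e := x ^+ 2; pose nu := 1 - x.
have e0 : 0 < e by rewrite exprn_gt0.
have eE : e = x * x by rewrite /e expr2.
have ex : 1000 * e <= x by rewrite eE; have := ler_wpM2r (ltW x0) x1; lra.
exists nu, e; split; [by rewrite /nu; apply/andP; split; move: x0 x1; lra|by apply/andP; split => //; move: ex x1; lra|].
have nu0 : 0 < nu by rewrite /nu; move: x1; lra.
have e1 : 0 < 1 - e by move: ex x1; lra.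
have eI : 0 <= e <= 1 by rewrite (ltW e0)/=; move: e1; lra.
have xI : 0 <= x <= 1 by rewrite (ltW x0)/=; move: x1; lra.
apply: (@scaling_parameters_real Dr p r x) => //.
- have h1 : 1 - p * x <= nu ^+ (D ^ 2 + 1) by exact: bernoulli_sub.
  have h2 : 1 - p * e <= (1 - e) ^+ (d * D + d).
    apply: (@le_trans _ _ (1 - (d * D + d)%:R * e)); last exact: bernoulli_sub.
    rewrite lerB// ler_wpM2r ?(ltW e0)// ler_nat.
    by rewrite /D -degree_count leq_addl.
  have h3 : 0 <= 1 - p * x.
    have := ler_wpM2r (mulr_ge0 (ltW p0) (ltW x0)) p5; move: px; lra.
  have h6 : p * e <= p * x by rewrite ler_wpM2l ?(ltW p0)//; move: ex e0; lra.
  have -> : nu ^+ 2 * ((1 - e) * nu) ^+ (d * D + d) = (1 - e) ^+ (d * D + d) * nu ^+ (D ^ 2 + 1).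
    rewrite exprMn mulrCA -exprD; congr (_ * nu ^+ _).
    exact: degree_count.
  apply: (@le_trans _ _ ((1 - p * e) * (1 - p * x))).
    have : 0 <= p * x * (p * e) by rewrite !mulr_ge0 ?ltW.
    rewrite eE; lra.
  by apply: ler_pM => //; move: h3 h6; lra.
- by rewrite divr_ge0 ?exprn_ge0 ?divr_ge0 ?ltW.
have ebern : 1 - r * x * x <= (1 - e) ^+ d.
  apply: (@le_trans _ _ (1 - d%:R * e)); last exact: bernoulli_sub.
  by rewrite -mulrA -eE lerB// ler_wpM2r ?(ltW e0)// ler_nat /d /D -(addn2 m.+1) leq_addr.
have nubern : (1 + r * x) * nu ^+ D.+1 <= 1.
  apply: (@le_trans _ _ ((1 + x) ^+ D.+1 * nu ^+ D.+1)).
    by rewrite ler_wpM2r ?exprn_ge0 ?(ltW nu0)// bernoulli_add// ltW.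
  rewrite -exprMn exprn_ile1 ?mulr_ge0 ?(ltW nu0) ?addr_ge0 ?(ltW x0)//.
  have -> : (1 + x) * nu = 1 - x * x by rewrite /nu; ring.
  by rewrite gerBl mulr_ge0 ?(ltW x0).
have -> : nu ^+ 2 / ((1 - e) / nu) ^+ d = nu ^+ D.+1 / (1 - e) ^+ d.
  rewrite expr_div_n invf_div mulrA -exprD; congr (nu ^+ _ / _).
apply: (@le_trans _ _ (nu ^+ D.+1 / (1 - e) ^+ d * ((1 + r * x) * (1 - e) ^+ d))).
  rewrite ler_wpM2l ?divr_ge0 ?exprn_ge0 ?(ltW nu0) ?(ltW e1)// ler_wpM2l// addr_ge0// mulr_ge0 ?ler0n ?ltW//.
have -> : nu ^+ D.+1 / (1 - e) ^+ d * ((1 + r * x) * (1 - e) ^+ d) = (1 + r * x) * nu ^+ D.+1.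
  by field; rewrite expf_neq0// gt_eqF.
exact: nubern.
Qed.

End parameters.

Section volume_bounds.
Variables (R : realType) (n : nat).
Local Notation leb := (@lebesgue_measure R).

Lemma integral_interval (a b : R) : a <= b ->
  (\int[leb]_x ((a <= x <= b)%R%:R : R)%:E = (b - a)%:E)%E.
Proof.
move=> ab; transitivity (\int[leb]_x (\1_(`[a, b]%classic) x : R)%:E)%E.
  by apply: eq_integral => x _; rewrite indicE; congr (_%:R%:E); rewrite mem_setE/= in_itv.
rewrite integral_indic//= setIT; apply: etrans (lebesgue_measure_itv _) _ => /=.
rewrite lte_fin; move: ab; rewrite le_eqVlt => /orP[/eqP ->|->]; first by rewrite ltxx subrr.
by rewrite EFinB.
Qed.

Lemma measurable_interval (a b : R) : measurable_fun [set: R] (fun x : R => (a <= x <= b)%R%:R : R).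
Proof.
rewrite (_ : (fun x => _) = fun x : R => (a <= x)%R%:R * (x <= b)%R%:R); last first.
  by apply/funext => x; case: (a <= x); case: (x <= b); rewrite ?mulr1 ?mulr0.
apply: measurable_funM; last exact: (measurable_le_cst b (@measurable_id _ _ setT)).
rewrite (_ : (fun x => _) = fun x : R => (-1 * x <= - a)%R%:R).
  by apply: (measurable_le_cst (v := fun x => -1 * x)); exact: measurable_dilate.
by apply/funext => x; rewrite mulN1r lerN2.
Qed.

Lemma vmu_box (c : 'rV[R]_n) (r : R) : 0 <= r ->
  (\int[vmu R n]_v ((`|v - c| <= r)%R%:R : R)%:E = ((2 * r) ^+ n)%:E)%E.
Proof.
move=> r0.
transitivity (\int[vmu R n]_v (\prod_(k < n) (c 0 k - r <= v 0 k <= c 0 k + r)%R%:R : R)%:E)%E.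
  apply: eq_integral => v _; congr EFin; rewrite prod_bool; congr (_%:R); congr nat_of_bool.
  apply/idP/forallP => [h k|h].
    have := le_trans (coord_le_norm (v - c) k) h; rewrite !mxE ler_norml => /andP[? ?] /=.
    by apply/andP; split; lra.
  apply: norm_le_coord => // k; have /= /andP[? ?] := h k; rewrite !mxE ler_norml.
  by apply/andP; split; lra.
rewrite (vmu_prod (phi := fun k x => (c 0 k - r <= x <= c 0 k + r)%R%:R))//; last by move=> k; exact: measurable_interval.
rewrite (eq_bigr (fun=> (2 * r)%:E)); last first.
  by move=> k _; rewrite integral_interval ?lerBlDr -?addrA ?lerDl ?addr_ge0//; congr EFin; ring.
by rewrite prodEFin prodr_const card_ord.
Qed.

End volume_bounds.

(** * Thin caps of a smooth convex body *)

Section thin_caps.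
Variables (R : realType) (m : nat).
Local Notation d := m.+1.
Local Notation D := m.+2.
Local Notation E := 'rV[R]_d.
Local Notation leb := (@lebesgue_measure R).
Variable K : set 'rV[R]_D.
Hypothesis hK : smooth_convex_body K.

Lemma body_measurable : measurable K.
Proof. by apply: closed_measurable_vec; apply: body_closed; case: hK. Qed.
Let mK := body_measurable.

Lemma body_bounded : exists2 B : R, 0 < B & forall x, K x -> `|x| <= B.
Proof.
have [[_ [/compact_bounded[M [_ hM]] _]] _] := hK.
exists (`|M| + 1); first by rewrite ltr_wpDl.
by move=> x Kx; apply: (hM (`|M| + 1)) => //; rewrite (le_lt_trans (ler_norm _))// ltrDl.
Qed.

Definition vol : R := fine (\int[vmu R D]_x (\1_K x : R)%:E)%E.

Lemma measurable_ind_body : measurable_fun setT (fun x : 'rV[R]_D => (\1_K x : R)%:E).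
Proof. by apply/measurable_EFinP; exact: measurable_indic. Qed.

Lemma measurable_box (c : 'rV[R]_D) r : measurable_fun setT (fun x : 'rV[R]_D => ((`|x - c| <= r)%R%:R : R)%:E).
Proof.
apply/measurable_EFinP.
rewrite (_ : (fun x => _) = fun x : 'rV[R]_D => \prod_(k < D) (c 0 k - r <= x 0 k <= c 0 k + r)%R%:R * (0 <= r)%R%:R); last first.
  apply/funext => x; have [r0|r0] := boolP (0 <= r); last first.
    rewrite mulr0; apply/eqP; rewrite pnatr_eq0 eqb0; apply: contra r0; exact: le_trans.
  rewrite mulr1 prod_bool; congr (_%:R); congr nat_of_bool.
  apply/idP/forallP => [h k|h].
    have := le_trans (coord_le_norm (x - c) k) h; rewrite !mxE ler_norml => /andP[? ?] /=.
    by apply/andP; split; lra.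
  apply: norm_le_coord => // k; have /= /andP[? ?] := h k; rewrite !mxE ler_norml.
  by apply/andP; split; lra.
apply: measurable_funM; last exact: measurable_cst.
apply: measurable_prod => k _.
exact: (measurableT_comp (measurable_interval _ _) (@measurable_coord R 1 D 0 k)).
Qed.

Lemma vol_fin : (\int[vmu R D]_x (\1_K x : R)%:E = vol%:E)%E.
Proof.
rewrite /vol fineK// ge0_fin_numE; last by apply: integral_ge0 => x _; rewrite lee_fin indicE.
have [B B0 hB] := body_bounded.
apply: (@le_lt_trans _ _ (\int[vmu R D]_v ((`|v - 0| <= B)%R%:R : R)%:E)%E); last first.
  by rewrite vmu_box ?ltry// ltW.
apply: ge0_le_integral => //; [exact: measurable_ind_body|exact: measurable_box|].
move=> x _; rewrite lee_fin indicE subr0.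
by have [/set_mem/hB ->|] := boolP (x \in K).
Qed.

Lemma vol_gt0 : 0 < vol.
Proof.
have [[_ [_ [x0 /nbhs_normP[r r0 hr]]]] _] := hK.
rewrite -lte_fin -vol_fin.
apply: (@lt_le_trans _ _ (\int[vmu R D]_v ((`|v - x0| <= r / 2)%R%:R : R)%:E)%E).
  by rewrite vmu_box ?divr_ge0 ?(ltW r0)// lte_fin exprn_gt0// mulr_gt0// divr_gt0.
apply: ge0_le_integral => //; [exact: measurable_box|exact: measurable_ind_body|].
move=> x _; rewrite lee_fin indicE; have [h|] := boolP (`|x - x0| <= r / 2); last by rewrite ler0n.
by rewrite mem_set//; apply: hr; apply: (le_lt_trans h); lra.
Qed.

Section one_slope.
Variables (a : E) (s : R) (q : 'rV[R]_D).
Hypotheses (ss : s * s = 1) (Kq : K q).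
Hypothesis qmax : forall x, K x -> dotv (dir a s) x <= dotv (dir a s) q.
Local Notation u := (dir a s).
Local Notation lev := (level a s q).
Local Notation plane := (pl a s q).
Local Notation A := (slice K a s q).
Local Notation l := (len a).

Definition islice t : \bar R := isec K (lev t, a).
Definition vcap t : R := fine (side K s (lev t, a)).

Lemma plane_depth t y : dotv u (q - plane t y) = t.
Proof. by rewrite dotvDr dotvNr dir_pl// subKr. Qed.

Lemma plane_out t : (forall y, ~ K (plane t y)) -> A t = 0%E /\ islice t = 0%E.
Proof.
move=> h; split; rewrite /slice /islice /isec; apply: integral0_eq => y _.
  by rewrite indicE memNset.
rewrite (_ : \prod_(i < D) _ = 0) ?mulr0//.
rewrite (bigD1 ord0)//= indicE memNset ?mul0r//; exact: h.
Qed.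

Lemma plane_neg t : t < 0 -> A t = 0%E /\ islice t = 0%E.
Proof.
move=> t0; apply: plane_out => y /qmax; rewrite dir_pl// leNgt => /negP; apply.
by rewrite ltrDl oppr_gt0.
Qed.

Lemma plane_far T t : (forall x, K x -> dotv u (q - x) <= T) -> T < t -> A t = 0%E /\ islice t = 0%E.
Proof.
by move=> hT Tt; apply: plane_out => y /hT; rewrite plane_depth leNgt Tt.
Qed.

Definition tailv (x : 'rV[R]_D) : E := \row_j x 0 (lift ord0 j).

(** A homothety or translation of space acts on the chart of a plane as [y -> tailv w + sg *: y];
    the equation in the hypotheses says that depth [t] goes to depth [t']. *)
Lemma plane_move (sg : R) w t t' :
  (forall x, K x -> dotv u (q - x) = t -> K (w + sg *: x)) ->
  dotv u w + sg * (dotv u q - t) = dotv u q - t' ->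
  forall y, K (plane t y) -> K (plane t' (tailv w + sg *: y)).
Proof.
move=> h e1 y Ky; have Kx := h _ Ky (plane_depth t y).
have xE : w + sg *: plane t y = cons_row ((w + sg *: plane t y) 0 0, tailv w + sg *: y).
  apply: cons_row_eq => // j.
  have tE : plane t y 0 (lift ord0 j) = y 0 j by rewrite /pl cons_rowS.
  by rewrite [LHS]mxE [X in _ + X = _]mxE tE [RHS]mxE [in RHS]mxE [X in _ = _ + X]mxE.
rewrite -(pl_surj ss (z := (w + sg *: plane t y) 0 0)) -?xE//.
by rewrite dotvDr dotvZr dir_pl.
Qed.

Lemma measurable_islice : measurable_fun setT islice.
Proof.
apply: (measurableT_comp (measurable_isec mK)); apply: measurable_fun_pair; last exact: measurable_cst.
exact: measurable_level.
Qed.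

Lemma side_le_vol s' p : (side K s' p <= vol%:E)%E.
Proof.
rewrite -vol_fin; apply: ge0_le_integral => //.
- apply/measurable_EFinP; apply: measurable_funM; first exact: measurable_indic.
  apply: measurable_gt0; apply: measurable_funM; first exact: measurable_cst.
  apply: measurable_funB; last exact: measurable_cst.
  by apply: measurable_dotv_pair; [exact: measurable_cst|exact: measurable_id].
- exact: measurable_ind_body.
- by move=> x _; rewrite lee_fin ler_piMr ?indicE// lern1; case: (_ < _).
Qed.

Lemma sideK s' p : (fine (side K s' p))%:E = side K s' p.
Proof.
by rewrite fineK// ge0_fin_numE ?side_ge0// (le_lt_trans (side_le_vol _ _))// ltry.
Qed.

Lemma vcap_le t : vcap t <= vol.
Proof. by rewrite -lee_fin sideK side_le_vol. Qed.

Lemma vcapE t : (vcap t)%:E = (l%:E * \int[leb]_x (A x * (x < t)%R%:R%:E))%E.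
Proof.
rewrite sideK; have := side_slices mK a q ss 1 t; rewrite mul1r => ->.
by congr (_ * _)%E; apply: eq_integral => x _; rewrite mul1r subr_gt0.
Qed.

Lemma measurable_vcap : measurable_fun setT vcap.
Proof.
have h : measurable_fun setT (fun t => side K s (lev t, a)).
  apply: (measurableT_comp (measurable_side mK s)); apply: measurable_fun_pair; last exact: measurable_cst.
  exact: measurable_level.
by apply/measurable_EFinP; apply: eq_measurable_fun h => t _; rewrite /= /vcap sideK.
Qed.

Lemma vcap_mono t t' : t <= t' -> vcap t <= vcap t'.
Proof.
move=> tt'; rewrite -lee_fin !vcapE lee_wpmul2l ?lee_fin ?(ltW (len_gt0 a))//.
have ml t1 : measurable_fun setT (fun x : R => A x * (x < t1)%R%:R%:E)%E.
  by apply: emeasurable_funM; [exact: measurable_slice|apply/measurable_EFinP; exact: measurable_lt_cst].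
apply: ge0_le_integral => //; [|exact: ml|exact: ml|].
  by move=> x _; rewrite mule_ge0 ?slice_ge0// lee_fin.
move=> x _; rewrite lee_wpmul2l ?slice_ge0// lee_fin ler_nat.
by case: (boolP (x < t)) => // xt; rewrite (lt_le_trans xt tt').
Qed.

Lemma vol_slice : vol%:E = (l%:E * \int[leb]_t A t)%E.
Proof. by rewrite -vol_fin (volume_slices mK a q ss). Qed.

(** The two open sides miss only the plane itself, that is, a single depth. *)
Lemma vcap_compl t : side K (- s) (lev t, a) = (vol - vcap t)%:E.
Proof.
have ml (g : R -> R) : measurable_fun setT g -> measurable_fun setT (fun x : R => A x * (g x)%:E)%E.
  by move=> mg; apply: emeasurable_funM; [exact: measurable_slice|apply/measurable_EFinP].
have o : (side K (- s) (lev t, a) + (vcap t)%:E = vol%:E)%E.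
  have := side_slices mK a q ss (-1) t; rewrite mulN1r => ->; rewrite vcapE vol_slice.
  rewrite -ge0_muleDr; last 2 first.
  - by apply: integral_ge0 => x _; rewrite mule_ge0 ?slice_ge0// lee_fin.
  - by apply: integral_ge0 => x _; rewrite mule_ge0 ?slice_ge0// lee_fin.
  congr (_ * _)%E; rewrite -ge0_integralD//; first last.
  - exact: (ml _ (measurable_lt_cst t)).
  - by move=> x _; rewrite mule_ge0 ?slice_ge0// lee_fin.
  - apply: ml; apply: measurable_gt0; apply: measurable_funM; first exact: measurable_cst.
    by apply: measurable_funB; [exact: measurable_cst|exact: measurable_id].
  - by move=> x _; rewrite mule_ge0 ?slice_ge0// lee_fin.
  apply: (@eq_integral_off _ t).
  - by move=> x; rewrite adde_ge0// mule_ge0 ?slice_ge0// lee_fin.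
  - by move=> x; exact: slice_ge0.
  move=> x xt; rewrite mulN1r oppr_gt0 subr_lt0.
  by move: xt; case: ltgtP => // _ _; rewrite mule0 ?add0e ?adde0 mule1.
move: o; rewrite -(sideK (- s)) -EFinD => -[<-]; rewrite addrK//.
Qed.

Lemma lev_surj b : exists t, b = lev t.
Proof.
exists (dotv u q - s * b / l); have l0 := len_gt0 a.
rewrite /level subKr; have -> : s * l * (s * b / l) = s * s * b by field; rewrite gt_eqF.
by rewrite ss mul1r.
Qed.

Definition weight (v0 : R) (k : nat) (b : R) : R :=
  (vol - fine (side K s (b, a))) ^+ k * (fine (side K s (b, a)) <= v0)%R%:R.

Lemma measurable_weight v0 k : measurable_fun setT (weight v0 k).
Proof.
have h : measurable_fun setT (fun b : R => fine (side K s (b, a))).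
  have h1 : measurable_fun setT (fun b : R => side K s (b, a)).
    apply: (measurableT_comp (measurable_side mK s)).
    by apply: measurable_fun_pair; [exact: measurable_id|exact: measurable_cst].
  by apply/measurable_EFinP; apply: eq_measurable_fun h1 => t _; rewrite /= sideK.
apply: measurable_funM; last exact: measurable_le_cst.
by apply: measurable_funX; apply: measurable_funB => //; exact: measurable_cst.
Qed.

Lemma side_fine_le s' p : fine (side K s' p) <= vol.
Proof. by rewrite -lee_fin sideK side_le_vol. Qed.

Lemma weight_ge0 v0 k b : 0 <= weight v0 k b.
Proof. by rewrite mulr_ge0// exprn_ge0// subr_ge0 side_fine_le. Qed.

Lemma weight_subst v0 k :
  (\int[leb]_b (isec K (b, a) * (weight v0 k b)%:E) = l%:E * thin_int islice vcap vol v0 k)%E.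
Proof.
rewrite (level_subst a q ss)//.
- apply: emeasurable_funM; last by apply/measurable_EFinP; exact: measurable_weight.
  apply: (measurableT_comp (measurable_isec mK)).
  by apply: measurable_fun_pair; [exact: measurable_id|exact: measurable_cst].
- by move=> b; rewrite mule_ge0 ?isec_ge0// lee_fin weight_ge0.
Qed.

End one_slope.
End thin_caps.

(** * Scaling inequalities uniform over all slopes *)

Section thin_caps_scaling.
Variables (R : realType) (m : nat).
Local Notation d := m.+1.
Local Notation D := m.+2.
Local Notation E := 'rV[R]_d.
Local Notation leb := (@lebesgue_measure R).
Variable K : set 'rV[R]_D.
Hypothesis hK : smooth_convex_body K.

Lemma depth_bound : exists2 T : R, 0 < T & forall (u q x : 'rV[R]_D), dotv u u = 1 ->
  K q -> K x -> dotv u (q - x) <= T.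
Proof.
have [B B0 hB] := body_bounded hK.
exists (D%:R * (2 * B)); first by rewrite mulr_gt0// mulr_gt0.
move=> u q x uu Kq Kx; apply: (le_trans (ler_norm _)); apply: (le_trans (dotv_le _ _)).
rewrite -mulrA ler_wpM2l//; apply: (@le_trans _ _ (1 * (2 * B))); last by rewrite mul1r.
apply: ler_pM => //; first exact: norm_le_dotv1.
by rewrite (le_trans (ler_normB _ _))//; have := hB _ Kq; have := hB _ Kx; lra.
Qed.

Lemma small_power (x C e : R) : 0 <= x < 1 -> 0 < C -> 0 < e -> exists j, x ^+ j * C <= e.
Proof.
move=> /andP[x0 x1] C0 e0.
have [x00|xn0] := eqVneq x 0; first by exists 1%N; rewrite expr1 x00 mul0r ltW.
have xp : 0 < x by rewrite lt_neqAle eq_sym xn0.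
have y0 : 0 < x^-1 - 1 by rewrite subr_gt0 invf_gt1.
pose j := Num.trunc (C / (e * (x^-1 - 1))); exists j.+1.
have e1 : C / e <= j.+1%:R * (x^-1 - 1).
  rewrite -ler_pdivrMr// -mulrA -invfM ltW// truncnS_gt//.
have e2 : C / e <= x^-1 ^+ j.+1.
  apply: (le_trans e1); have := bernoulli_add j.+1 (ltW y0).
  by rewrite [1 + (x^-1 - 1)]addrC subrK => h; apply: le_trans h; rewrite lerDr.
have xj : 0 < x ^+ j.+1 by exact: exprn_gt0.
by move: e2; rewrite exprVn ler_pdivrMr// mulrC ler_pdivlMr// mulrC.
Qed.

(** Collects what the final comparison needs from the geometry, with constants independent of slope
    and side: complementary volumes, the scaling inequality for thin caps, and a fixed share [c0] of
    the plane weight carried by caps of volume at most [v0 / 2]. *)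
Lemma thin_caps_scaling : exists v0 kap mu c0 : R,
  [/\ 0 < v0 < vol K, 0 < kap, 0 <= mu < 1, kap^-1 - 1 < D%:R * (1 - mu) & 0 < c0] /\
  forall (a : E) (s : R), s * s = 1 -> [/\
    forall b, side K (- s) (b, a) = (vol K - fine (side K s (b, a)))%:E,
    forall k, let Phi k := (\int[leb]_b (isec K (b, a) * (weight K a s v0 k b)%:E))%E in
      (kap%:E * (Phi k.+1 + (k.+1%:R * (1 - mu) * vol K)%:E * Phi k) <=
       (1 + kap * (k.+1%:R * (1 - mu)))%:E * Phi k.+1)%E &
    (c0%:E * \int[leb]_b isec K (b, a) <=
     \int[leb]_b (isec K (b, a) * (weight K a s (v0 / 2) 0 b)%:E))%E].
Proof.
have [nu [e [/andP[nu0 nu1] /andP[e0 e1] [mu1 kapmu]]]] := scaling_parameters R m.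
have V0 := vol_gt0 hK; have [T T0 hT] := depth_bound.
(* [sg] accompanies the move from depth [t] to [lam * t], and [sg'] the inverse move; the factor
   [1 - e] provides the strict inequality required by [cap_scaling]. *)
pose sg := (1 - e) * nu; pose lam := nu ^+ 2; pose sg' := (1 - e) / nu.
have ne0 : 0 < 1 - e by rewrite subr_gt0.
have sg0 : 0 < sg by rewrite mulr_gt0.
have sg'0 : 0 < sg' by rewrite divr_gt0.
have lam0 : 0 < lam by rewrite exprn_gt0.
have lam1 : lam < 1 by rewrite /lam exprn_ilt1// ltW.
have ne2 : (1 - e) ^+ 2 < 1 by rewrite exprn_ilt1 ?ltW// ltrBlDr ltrDl.
have sgl : sg ^+ 2 < lam by rewrite /sg exprMn -[X in _ < X]mul1r ltr_pM2r.
have sgl' : sg' ^+ 2 < lam^-1 by rewrite /sg' expr_div_n -[X in _ < X]mul1r ltr_pM2r// invr_gt0.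
have [t1 t10 cap1] := cap_scaling hK sg0 sgl.
have [t2 t20 cap2] := cap_scaling hK sg'0 sgl'.
pose t0 := Num.min t1 t2; have t00 : 0 < t0 by rewrite lt_min t10.
(* The forward move bounds plane weights from below; the upper bound on section areas comes from the
   inverse move. *)
pose kap0 := sg ^+ (d * D + d); pose mu0 := (sg' ^+ d)^-1.
have kap00 : 0 < kap0 by rewrite exprn_gt0.
have mu00 : 0 < mu0 by rewrite invr_gt0 exprn_gt0.
have mu1' : lam * mu0 < 1 by exact: mu1.
(* Contracting [K] towards its support point by [th0] brings every depth to at most [t0], and the
   image keeps the fraction [th0 ^+ D] of the volume. Since [v0] is half of that volume, caps of
   volume at most [v0] have depth at most [t0]. *)
pose th0 := Num.min 1 (t0 / T).
have th00 : 0 < th0 by rewrite lt_min ltr01 divr_gt0.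
have th01 : th0 <= 1 by rewrite ge_min lexx.
have th0T : th0 * T <= t0 by rewrite -ler_pdivlMr// ge_min lexx orbT.
pose v0 := th0 * th0 ^+ d * vol K / 2.
have thd0 : 0 < th0 * th0 ^+ d by rewrite mulr_gt0// exprn_gt0.
have v00 : 0 < v0 by rewrite divr_gt0// mulr_gt0.
have v0v : v0 < vol K.
  have : th0 * th0 ^+ d <= 1 by rewrite -exprS exprn_ile1// ltW.
  by rewrite /v0 => h; have := ler_wpM2r (ltW V0) h; move: V0; lra.
have lm : 0 <= lam * mu0 < 1 by rewrite mu1' (mulr_ge0 (ltW lam0) (ltW mu00)).
(* After [j] scalings from depth [t0] the cap volume is at most [v0 / 2]; contracting by [th1]
   brings every depth down to that level, which yields the constant [c0]. *)
have [j hj] := @small_power (lam * mu0) (vol K) (v0 / 2) lm V0 (divr_gt0 v00 (ltr0Sn _ 1)).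
pose th1 := Num.min 1 (lam ^+ j * t0 / T).
have lj0 : 0 < lam ^+ j * t0 by rewrite mulr_gt0// exprn_gt0.
have th10 : 0 < th1 by rewrite lt_min ltr01 divr_gt0.
have th11 : th1 <= 1 by rewrite ge_min lexx.
have th1T : th1 * T <= lam ^+ j * t0 by rewrite -ler_pdivlMr// ge_min lexx orbT.
exists v0, (lam * kap0), (lam * mu0), (th1 * th1 ^+ (d * D + d)); split.
  split=> //; [by rewrite v00|by rewrite mulr_gt0|by rewrite mulr_gt0// exprn_gt0].
move=> a s ss.
have mK := body_measurable hK.
have bK : convex_body K by case: hK.
have cvK : Defs.convex_set K by case: bK.
have [q Kq qmax] := support_point (dir a s) bK.
have uu : dotv (dir a s) (dir a s) = 1 by exact: dir_unit.
set A := slice K a s q; set I := islice K a s q; set v := vcap K a s q.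
have l0 := len_gt0 a.
have mA : measurable_fun setT A by exact: measurable_slice.
have mI : measurable_fun setT I by exact: measurable_islice.
have mv : measurable_fun setT v by exact: measurable_vcap.
have A0 t : (0 <= A t)%E by exact: slice_ge0.
have I0 t : (0 <= I t)%E by exact: isec_ge0.
have vE t : (v t)%:E = ((len a)%:E * \int[leb]_x (A x * (x < t)%R%:R%:E))%E by exact: vcapE.
have vvol t : v t <= vol K by exact: vcap_le.
have vmono t t' : t <= t' -> v t <= v t' by exact: vcap_mono.
have neg t : t < 0 -> A t = 0%E /\ I t = 0%E by exact: plane_neg.
have far t : T < t -> A t = 0%E /\ I t = 0%E.
  by apply: plane_far => // x Kx; exact: hT.
have move_plane (sg1 lam' t : R) :
    (forall x, K x -> dotv (dir a s) (q - x) = t ->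
      K (q + (sg1 *: (x - q) + ((sg1 - lam') * t) *: dir a s))) ->
    exists c, forall y, K (pl a s q t y) -> K (pl a s q (lam' * t) (c + sg1 *: y)).
  move=> h; pose w := q - sg1 *: q + ((sg1 - lam') * t) *: dir a s.
  exists (tailv w); apply: plane_move => //.
    move=> x Kx tx; have := h x Kx tx; congr K.
    rewrite /w scalerBr -!addrA; congr (q + _); rewrite addrCA; congr (_ + _).
    by rewrite addrC.
  rewrite /w; move: (dir a s) uu => u uu.
  by rewrite !dotvDr dotvNr !dotvZr uu; ring.
have HI t : 0 < t <= t0 -> (kap0%:E * I t <= I (lam * t)%R)%E.
  move=> /andP[tp tt]; have [|c hc] := move_plane sg lam t.
    move=> x Kx tx; have := cap1 _ q uu Kq qmax x Kx; rewrite tx tp; apply.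
    by rewrite (le_trans tt)// ge_min lexx.
  exact: (isec_scale mK sg0 hc).
have HA t : 0 < t <= t0 -> (A (lam * t)%R <= mu0%:E * A t)%E.
  move=> /andP[tp tt]; have [|c hc] := move_plane sg' lam^-1 (lam * t).
    move=> x Kx tx; have := cap2 _ q uu Kq qmax x Kx; rewrite tx; apply.
    rewrite mulr_gt0//= (le_trans _ (_ : t0 <= t2))//; last by rewrite ge_min lexx orbT.
    by rewrite (le_trans _ tt)// ler_piMl// ltW.
  rewrite mulKf ?gt_eqF// in hc.
  have := slice_scale mK sg'0 hc; rewrite -/A => h.
  have sd0 : 0 < sg' ^+ d by exact: exprn_gt0.
  have : (mu0%:E * ((sg' ^+ d)%:E * A (lam * t)%R) <= mu0%:E * A t)%E.
    by rewrite lee_wpmul2l// lee_fin ltW.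
  by rewrite muleA -EFinM /mu0 mulVf ?gt_eqF// mul1e.
(* Plain convexity: the homothety with centre [q] and ratio [th] maps [K] into itself. *)
have HC th t : 0 < th -> th <= 1 -> exists c, forall y,
    K (pl a s q t y) -> K (pl a s q (th * t) (c + th *: y)).
  move=> h0 h1; apply: move_plane => x Kx _.
  rewrite subrr mul0r scale0r addr0.
  have := cvK q x Kq Kx th; rewrite (ltW h0) h1 => /(_ isT).
  by rewrite scalerBl scale1r scalerBr addrAC -addrA.
have Hcut t : v t <= v0 -> t <= t0.
  move=> vt; rewrite leNgt; apply/negP => tt.
  have HAc x : 0 < x -> ((th0 ^+ d)%:E * A x <= A (th0 * x)%R)%E.
    by move=> _; have [c hc] := HC th0 x th00 th01; exact: (slice_scale mK th00 hc).
  have := @dilation_mass R A th0 T (th0 ^+ d) mA A0 (fun x h => (neg x h).1)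
    (fun x h => (far x h).1) th00 (exprn_ge0 _ (ltW th00)) HAc (fun x => (x < t)%R%:R)
    (measurable_lt_cst t) (fun=> ler0n _ _) _.
  have gt x : x <= th0 * T -> 1 <= (x < t)%R%:R :> R.
    by move=> xt; rewrite (le_lt_trans xt)// (le_lt_trans th0T tt).
  move=> /(_ gt) h.
  have : ((len a)%:E * ((th0 * th0 ^+ d)%:E * \int[leb]_t0 A t0) <= (v t)%:E)%E.
    by rewrite vE lee_wpmul2l// lee_fin ltW.
  rewrite muleCA -vol_slice// -EFinM lee_fin => h2.
  by move: vt v00 h2; rewrite /v0; lra.
split.
- by move=> b; have [t ->] := lev_surj a q ss b; exact: (vcap_compl hK a q ss t).
- move=> k /=.
  have := @scaling_inequality R A I v (len a) (vol K) lam kap0 mu0 t0 v0 mA mI mv A0 I0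
    (fun x h => (neg x h).1) (fun x h => (neg x h).2) (ltW l0) vE lam0 (ltW kap00) (ltW mu00) (ltW mu1')
    HI HA vvol Hcut k.
  rewrite !(weight_subst hK a q ss) -/I -/v.
  set P1 := thin_int _ _ _ _ _; set P0 := thin_int _ _ _ _ _ => h.
  have P00 : (0 <= P0)%E by exact: thin_int_ge0.
  have P10 : (0 <= P1)%E by exact: thin_int_ge0.
  have c0 : 0 <= k.+1%:R * (1 - lam * mu0) * vol K.
    by rewrite !mulr_ge0 ?subr_ge0 ?(ltW mu1') ?(ltW V0).
  rewrite [((_ * vol K)%:E * _)%E]muleCA -ge0_muleDr ?mule_ge0 ?lee_fin//.
  rewrite [((lam * kap0)%:E * _)%E]muleCA [X in (_ <= X)%E]muleCA lee_wpmul2l// lee_fin.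
  exact: ltW.
- have vj : v (lam ^+ j * t0) <= v0 / 2.
    apply: le_trans hj.
    exact: (@v_iter R A v (len a) (vol K) lam mu0 t0 mA A0 (fun x h => (neg x h).1) (ltW l0) vE lam0 (ltW mu00) HA vvol j t00 (ltW lam1)).
  have HIc x : 0 < x -> ((th1 ^+ (d * D + d))%:E * I x <= I (th1 * x)%R)%E.
    by move=> _; have [c hc] := HC th1 x th10 th11; exact: (isec_scale mK th10 hc).
  pose g t : R := (vol K - v t) ^+ 0 * (v t <= v0 / 2)%R%:R.
  have mg : measurable_fun setT g.
    by rewrite /g; under eq_fun do rewrite expr0 mul1r; exact: measurable_le_cst.
  have g0 t : 0 <= g t by rewrite /g expr0 mul1r ler0n.
  have g1 x : x <= th1 * T -> 1 <= g x.
    move=> xt; rewrite /g expr0 mul1r (le_trans (vmono _ _ _) vj)//.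
    exact: le_trans xt th1T.
  have := @dilation_mass R I th1 T (th1 ^+ (d * D + d)) mI I0 (fun x h => (neg x h).2)
    (fun x h => (far x h).2) th10 (exprn_ge0 _ (ltW th10)) HIc g mg g0 g1.
  rewrite (weight_subst hK a q ss) -/I -/v => h.
  rewrite (level_subst a q ss); last 2 first.
  - apply: (measurableT_comp (measurable_isec mK)).
    by apply: measurable_fun_pair; [exact: measurable_id|exact: measurable_cst].
  - by move=> b; exact: isec_ge0.
  by rewrite muleCA lee_wpmul2l// lee_fin ltW.
Qed.

End thin_caps_scaling.

Lemma pmu_prod (R : realType) d (f : 'rV[R]_d -> R) (v : R) n :
  measurable_fun setT f -> (forall x, 0 <= f x) ->
  (\int[vmu R d]_x (f x)%:E = v%:E)%E ->
  (\int[pmu R d n]_xs (\prod_(i < n) f (nth 0 xs i))%:E = (v ^+ n)%:E)%E.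
Proof.
move=> mf f0 fv.
have mP k : measurable_fun setT (fun xs : seq 'rV[R]_d => (\prod_(i < k) f (nth 0 xs i))%:E).
  apply/measurable_EFinP; apply: measurable_prod => i _.
  exact: (measurableT_comp mf (measurable_nth i)).
have P0 k (xs : seq 'rV[R]_d) : (0 <= (\prod_(i < k) f (nth 0 xs i))%:E)%E.
  by rewrite lee_fin prodr_ge0.
elim: n => [|n IH]; first by rewrite pmu0E// big_ord0.
rewrite (pmuS n (mP _) (P0 _)).
transitivity (\int[vmu R d]_x ((v ^+ n)%:E * (f x)%:E))%E.
  apply: eq_integral => x _.
  transitivity (\int[pmu R d n]_xs ((f x)%:E * (\prod_(i < n) f (nth 0 xs i))%:E))%E.
    by apply: eq_integral => xs _; rewrite big_ord_recl EFinM.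
  by rewrite -(integral_scale (pmu R d n) (mP n) (P0 n) (f0 x)) IH muleC.
have v0 : 0 <= v by rewrite -lee_fin -fv; apply: integral_ge0 => x _; rewrite lee_fin.
rewrite -(integral_scale (vmu R d)) ?exprn_ge0//; last first.
- exact/measurable_EFinP.
by rewrite fv -EFinM -exprSr.
Qed.

(** * Growth of the facet integral *)

Section plane_integral.
Variables (R : realType) (d : nat).
Local Notation E := 'rV[R]_d.
Local Notation leb := (@lebesgue_measure R).

Definition plane_int (G : R * E -> \bar R) : \bar R :=
  (\int[vmu R d]_a \int[leb]_b G (b, a))%E.

Variables G H : R * E -> \bar R.
Hypotheses (mG : measurable_fun setT G) (mH : measurable_fun setT H).
Hypotheses (G0 : forall p, (0 <= G p)%E) (H0 : forall p, (0 <= H p)%E).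

Lemma measurable_line_int (F : R * E -> \bar R) : measurable_fun setT F ->
  (forall p, (0 <= F p)%E) -> measurable_fun setT (fun a => \int[leb]_b F (b, a))%E.
Proof.
move=> mF F0.
have mF' : measurable_fun setT (fun q : E * R => F (q.2, q.1)).
  by apply: (measurableT_comp mF); exact: measurable_fun_pair.
exact: (measurable_integral_param leb mF' (fun q => F0 (q.2, q.1))).
Qed.

Lemma measurable_line (F : R * E -> \bar R) a : measurable_fun setT F ->
  measurable_fun setT (fun b => F (b, a)).
Proof.
move=> mF; apply: (measurableT_comp mF).
by apply: measurable_fun_pair; [exact: measurable_id|exact: measurable_cst].
Qed.

Lemma plane_int_ge0 : (0 <= plane_int G)%E.
Proof. by apply: integral_ge0 => a _; apply: integral_ge0 => b _. Qed.

Lemma le_plane_int : (forall a, \int[leb]_b G (b, a) <= \int[leb]_b H (b, a))%E ->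
  (plane_int G <= plane_int H)%E.
Proof.
move=> GH; apply: ge0_le_integral => //.
- by move=> a _; apply: integral_ge0.
- exact: measurable_line_int.
- exact: measurable_line_int.
Qed.

Lemma le_line_int a : (forall p, G p <= H p)%E ->
  (\int[leb]_b G (b, a) <= \int[leb]_b H (b, a))%E.
Proof.
move=> GH; apply: ge0_le_integral => //; exact: measurable_line.
Qed.

Lemma line_intD a :
  (\int[leb]_b (G (b, a) + H (b, a)) = \int[leb]_b G (b, a) + \int[leb]_b H (b, a))%E.
Proof.
exact: (ge0_integralD leb measurableT (fun b _ => G0 (b, a)) (measurable_line a mG)
  (fun b _ => H0 (b, a)) (measurable_line a mH)).
Qed.

Lemma plane_intD : (plane_int (fun p => G p + H p) = plane_int G + plane_int H)%E.
Proof.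
rewrite /plane_int; under eq_integral do rewrite line_intD.
have g0 (F : R * E -> \bar R) (F0 : forall p, (0 <= F p)%E) a : (0 <= \int[leb]_b F (b, a))%E.
  by apply: integral_ge0 => b _.
exact: (ge0_integralD (vmu R d) measurableT (fun a _ => g0 G G0 a) (measurable_line_int mG G0)
  (fun a _ => g0 H H0 a) (measurable_line_int mH H0)).
Qed.

Lemma plane_intZ c : 0 <= c -> (plane_int (fun p => c%:E * G p) = c%:E * plane_int G)%E.
Proof.
move=> c0; rewrite /plane_int (integral_scale (vmu R d) (measurable_line_int mG G0) _ c0).
  by apply: eq_integral => a _; rewrite (integral_scale leb (measurable_line a mG) (fun b => G0 (b, a)) c0).
by move=> a; apply: integral_ge0.
Qed.

End plane_integral.

Lemma le_of_EFin (R : realType) (x y : R) (X Y : \bar R) : x%:E = X -> y%:E = Y -> (X <= Y)%E -> x <= y.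
Proof. by move=> <- <-; rewrite lee_fin. Qed.

Section weighted_mass.
Variables (R : realType) (d : nat) (I : R * 'rV[R]_d -> \bar R).
Local Notation E := 'rV[R]_d.
Local Notation leb := (@lebesgue_measure R).
Hypotheses (mI : measurable_fun setT I) (I0 : forall p, (0 <= I p)%E).
Hypothesis Ifin : (plane_int I < +oo)%E.

(** Boundedness makes the mass finite, so that the final comparison takes place in the reals. *)
Definition admissible (g : R * E -> R) :=
  measurable_fun setT g /\ exists M, forall p, 0 <= g p <= M.

Definition mass (g : R * E -> R) : R := fine (plane_int (fun p => I p * (g p)%:E)%E).

Let mIg g : admissible g -> measurable_fun setT (fun p => I p * (g p)%:E)%E.
Proof. by move=> [mg _]; apply: emeasurable_funM => //; exact/measurable_EFinP. Qed.

Let Ig0 g : admissible g -> forall p, (0 <= I p * (g p)%:E)%E.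
Proof. by move=> [_ [M h]] p; rewrite mule_ge0// lee_fin; case/andP: (h p). Qed.

Lemma massE g : admissible g -> (mass g)%:E = plane_int (fun p => I p * (g p)%:E)%E.
Proof.
move=> ag; rewrite fineK// ge0_fin_numE; last exact/plane_int_ge0/Ig0.
have [mg [M h]] := ag.
have M0 : 0 <= M by case/andP: (h (0, 0)) => h1 h2; exact: le_trans h1 h2.
apply: (@le_lt_trans _ _ (plane_int (fun p => M%:E * I p)%E)).
  apply: le_plane_int; [exact: mIg|exact: measurable_funeM|exact: Ig0|by move=> p; rewrite mule_ge0|].
  move=> a; apply: (le_line_int (mIg ag) (measurable_funeM _ mI) (Ig0 ag) a).
  by move=> p; rewrite muleC lee_wpmul2r// lee_fin; case/andP: (h p).
by rewrite (plane_intZ mI I0 M0) lte_mul_pinfty.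
Qed.

Lemma mass_ge0 g : admissible g -> 0 <= mass g.
Proof. by move=> ag; rewrite -lee_fin (massE ag); exact/plane_int_ge0/Ig0. Qed.

Lemma admissibleD g h : admissible g -> admissible h -> admissible (fun p => g p + h p).
Proof.
move=> [mg [M hM]] [mh [N hN]]; split; first exact: measurable_funD.
exists (M + N) => p; case/andP: (hM p) => ? ?; case/andP: (hN p) => ? ?.
by rewrite addr_ge0// lerD.
Qed.

Lemma admissibleZ c g : 0 <= c -> admissible g -> admissible (fun p => c * g p).
Proof.
move=> c0 [mg [M hM]]; split; first by apply: measurable_funM => //; exact: measurable_cst.
by exists (c * M) => p; case/andP: (hM p) => ? ?; rewrite mulr_ge0// ler_wpM2l.
Qed.

Lemma massD g h : admissible g -> admissible h -> mass (fun p => g p + h p) = mass g + mass h.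
Proof.
move=> ag ah; apply: EFin_inj; apply: etrans (massE (admissibleD ag ah)) _.
apply: etrans (esym (f_equal2 adde (massE ag) (massE ah))).
apply: etrans (plane_intD (mIg ag) (mIg ah) (Ig0 ag) (Ig0 ah)).
apply: eq_integral => a _; apply: eq_integral => b _.
by rewrite EFinD ge0_muleDr// lee_fin; [case: ag => _ [M h']|case: ah => _ [M h']]; case/andP: (h' (b, a)).
Qed.

Lemma massZ c g : 0 <= c -> admissible g -> mass (fun p => c * g p) = c * mass g.
Proof.
move=> c0 ag; apply: EFin_inj; apply: etrans (massE (admissibleZ c0 ag)) _.
apply: etrans (esym (f_equal (fun x => c%:E * x)%E (massE ag))).
apply: etrans (plane_intZ (mIg ag) (Ig0 ag) c0).
by apply: eq_integral => a _; apply: eq_integral => b _; rewrite EFinM muleCA.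
Qed.

Lemma line_massD g h a : admissible g -> admissible h ->
  (\int[leb]_b (I (b, a) * (g (b, a) + h (b, a))%:E) =
   \int[leb]_b (I (b, a) * (g (b, a))%:E) + \int[leb]_b (I (b, a) * (h (b, a))%:E))%E.
Proof.
move=> ag ah; rewrite -(line_intD (mIg ag) (mIg ah) (Ig0 ag) (Ig0 ah)).
apply: eq_integral => b _.
by rewrite EFinD ge0_muleDr// lee_fin; [case: ag => _ [M h']|case: ah => _ [M h']]; case/andP: (h' (b, a)).
Qed.

Lemma line_massZ c g a : 0 <= c -> admissible g ->
  (\int[leb]_b (I (b, a) * (c * g (b, a))%:E) = c%:E * \int[leb]_b (I (b, a) * (g (b, a))%:E))%E.
Proof.
move=> c0 ag; rewrite (integral_scale leb (measurable_line a (mIg ag)) (fun b => Ig0 ag (b, a)) c0).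
by apply: eq_integral => b _; rewrite EFinM muleCA.
Qed.

Lemma le_mass_line g h : admissible g -> admissible h ->
  (forall a, \int[leb]_b (I (b, a) * (g (b, a))%:E) <= \int[leb]_b (I (b, a) * (h (b, a))%:E))%E ->
  mass g <= mass h.
Proof.
move=> ag ah gh; apply: (le_of_EFin (massE ag) (massE ah)).
exact: (le_plane_int (mIg ag) (mIg ah) (Ig0 ag) (Ig0 ah)).
Qed.

Lemma le_mass g h : admissible g -> admissible h -> (forall p, g p <= h p) -> mass g <= mass h.
Proof.
move=> ag ah gh; apply: le_mass_line => // a.
apply: (le_line_int (mIg ag) (mIg ah) (Ig0 ag) a).
by move=> p; rewrite lee_wpmul2l// lee_fin.
Qed.

End weighted_mass.

Section facet_integral.
Variables (R : realType) (m : nat).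
Local Notation d := m.+1.
Local Notation D := m.+2.
Local Notation E := 'rV[R]_d.
Local Notation leb := (@lebesgue_measure R).
Variable K : set 'rV[R]_D.
Hypothesis hK : smooth_convex_body K.

Let mK := body_measurable hK.
Let V0 := vol_gt0 hK.
Let mI := measurable_isec mK.
Let I0 := @isec_ge0 R m K.

(** The facet integral for [n = D]: all exponents are zero and the integrand is twice the indicator
    of [D] points in [K]. *)
Lemma isec_total : (plane_int (isec K) + plane_int (isec K) = (vol K ^+ D)%:E *+ 2)%E.
Proof.
rewrite -(plane_intD mI mI I0 I0).
transitivity (facet_int D K).
  rewrite (facet_int_planes mK) /plane_int; apply: eq_integral => a _; apply: eq_integral => b _.
  by rewrite subnn !expe0 ge0_muleDr// !mule1.
rewrite /facet_int subnn.
transitivity (\int[pmu R D D]_ys ((all_in K ys)%:E + (all_in K ys)%:E))%E.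
  by apply: eq_integral => ys _; rewrite !expe0 ge0_muleDr// !mule1.
have mA : measurable_fun setT (fun ys => (all_in K ys)%:E).
  by apply/measurable_EFinP; exact: measurable_all_in.
have A0 ys : (0 <= (all_in K ys)%:E)%E by rewrite lee_fin all_in_ge0.
rewrite (ge0_integralD (pmu R D D) measurableT (fun ys _ => A0 ys) mA (fun ys _ => A0 ys) mA).
rewrite mule2n; congr (_ + _)%E; apply: (pmu_prod D _ _ (vol_fin hK)).
- exact: measurable_indic.
- by move=> x; rewrite indicE.
- exact: measurable_indic.
- by move=> x; rewrite indicE.
Qed.

Lemma isec_total_fin : (plane_int (isec K) < +oo)%E.
Proof.
have := isec_total; have := plane_int_ge0 I0.
by case: (plane_int (isec K)) => [r| |] //= _; rewrite ltry.
Qed.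

Local Notation mass := (mass (isec K)).
Let Ifin := isec_total_fin.

Lemma mass1_gt0 : 0 < mass (fun=> 1).
Proof.
have a1 : admissible (fun _ : R * E => 1 : R).
  by split; [exact: measurable_cst|exists 1 => p; rewrite ler01 lexx].
have := massE mI I0 Ifin a1.
rewrite (_ : plane_int _ = plane_int (isec K)); last first.
  by apply: eq_integral => a _; apply: eq_integral => b _; rewrite mule1.
move=> e; have := isec_total; rewrite -e => /eqP.
rewrite mule2n -!EFinD eqe => /eqP h.
have : 0 < vol K ^+ D by exact: exprn_gt0.
by move: h; move: (mass _) (vol K ^+ D) => x y; lra.
Qed.

(** The base is the volume left after removing the cap on side [s], where the [k] points off the
    plane must lie for that cap to be empty. *)
Definition full s k (p : R * E) : R := (vol K - fine (side K s p)) ^+ k.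
Definition thin s v0 k p := full s k p * (fine (side K s p) <= v0)%R%:R.
Definition thick s v0 k p := full s k p * (0 < fine (side K s p) - v0)%R%:R.

Lemma full_bounds s k p : 0 <= full s k p <= vol K ^+ k.
Proof.
have h : 0 <= vol K - fine (side K s p) by rewrite subr_ge0 side_fine_le.
by rewrite exprn_ge0//= lerXn2r ?nnegrE ?(ltW V0)// gerBl fine_ge0// side_ge0.
Qed.

Lemma measurable_side_fine s : measurable_fun setT (fun p => fine (side K s p)).
Proof.
by apply/measurable_EFinP; apply: eq_measurable_fun (measurable_side mK s) => t _; rewrite /= sideK.
Qed.

Lemma admissible_full s k : admissible (full s k).
Proof.
split; last by exists (vol K ^+ k) => p; exact: full_bounds.
apply: measurable_funX; apply: measurable_funB; first exact: measurable_cst.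
exact: measurable_side_fine.
Qed.

Lemma admissible_cut s k (c : R * E -> bool) : measurable_fun setT (fun p => (c p)%:R : R) ->
  admissible (fun p => full s k p * (c p)%:R).
Proof.
move=> mc; split; first by apply: measurable_funM => //; exact: (admissible_full s k).1.
exists (vol K ^+ k) => p; case/andP: (full_bounds s k p) => h0 h1.
by case: (c p); rewrite ?mulr1 ?mulr0 ?h0// lexx exprn_ge0// ltW.
Qed.

Lemma admissible_thick s v0 k : admissible (thick s v0 k).
Proof.
apply: admissible_cut; apply: measurable_gt0; apply: measurable_funB; last exact: measurable_cst.
exact: measurable_side_fine.
Qed.

Lemma thin_add_thick s v0 k p : full s k p = thin s v0 k p + thick s v0 k p.
Proof. by rewrite /thin /thick subr_gt0 leNgt; case: (v0 < _); rewrite mulr0 mulr1 ?add0r ?addr0. Qed.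

Lemma admissible_thin s v0 k : admissible (thin s v0 k).
Proof.
apply: admissible_cut; rewrite (_ : (fun p => _) =
  fun p => 1 - (0 < fine (side K s p) - v0)%R%:R); last first.
  by apply/funext => p; rewrite subr_gt0 leNgt; case: (v0 < _); rewrite ?subr0 ?subrr.
apply: measurable_funB; first exact: measurable_cst.
apply: measurable_gt0; apply: measurable_funB; last exact: measurable_cst.
exact: measurable_side_fine.
Qed.

Lemma facet_int_split v0 k :
  (forall a b, side K (-1) (b, a) = (vol K - fine (side K 1 (b, a)))%:E) ->
  (forall a b, side K 1 (b, a) = (vol K - fine (side K (-1) (b, a)))%:E) ->
  facet_int (D + k) K = (mass (thin 1 v0 k) + mass (thin (-1) v0 k) +
    (mass (thick 1 v0 k) + mass (thick (-1) v0 k)))%:E.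
Proof.
move=> h1 h2.
have split s : mass (full s k) = mass (thin s v0 k) + mass (thick s v0 k).
  rewrite -(massD mI I0 Ifin (admissible_thin s v0 k) (admissible_thick s v0 k)).
  by congr mass; apply/funext => p; exact: thin_add_thick.
pose a1 := admissible_full 1 k; pose a2 := admissible_full (-1) k.
transitivity ((mass (full 1 k) + mass (full (-1) k))%:E); last by rewrite addrACA !split.
transitivity ((mass (fun p => full 1 k p + full (-1) k p))%:E); last first.
  by congr EFin; apply: etrans (massD mI I0 Ifin a1 a2) _.
apply: etrans (esym (massE mI I0 Ifin (admissibleD a1 a2))).
rewrite (facet_int_planes mK) addKn.
apply: eq_integral => a _; apply: eq_integral => b _; congr (_ * _)%E.
by rewrite h1 {1}h2 -!EFin_expe -EFinD addrC.
Qed.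

End facet_integral.

(** The binomial expansion up to second order; its quadratic term is what beats the linear factor in
    [exp_beats_linear]. *)
Lemma bernoulli_quadratic (R : realType) (x : R) k : 0 <= x ->
  2 + 2 * k%:R * x + k%:R * (k%:R - 1) * (x * x) <= 2 * (1 + x) ^+ k.
Proof.
move=> x0; elim: k => [|k IH]; first by rewrite !(mulr0, mul0r) !addr0 expr0 mulr1.
rewrite exprSr -[k.+1%:R]natr1.
have kk : 0 <= k%:R * (k%:R - 1) :> R.
  by case: (k) => [|j]; rewrite ?mul0r// -natr1 addrK mulr_ge0// natr1.
have x3 := mulr_ge0 kk (mulr_ge0 (mulr_ge0 x0 x0) x0).
have := ler_wpM2r (addr_ge0 ler01 x0) IH.
move: x3; move: ((1 + x) ^+ k) (k%:R : R) => e y; lra.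
Qed.

Lemma exp_beats_linear (R : realType) (a b C : R) : 0 < b -> b < a -> 0 < C ->
  exists N : nat, forall k, (N <= k)%N -> k.+1%:R * b ^+ k < C * a ^+ k.
Proof.
move=> b0 ba C0.
have [x x0 aE] : exists2 x, 0 < x & a = b * (1 + x).
  by exists (a / b - 1); [rewrite subr_gt0 ltr_pdivlMr// mul1r|field; rewrite gt_eqF].
(* Makes [k * (k - 1) * C * x ^ 2] exceed [6 * (k - 1)], which is at least [2 * (k + 1)] once
   [k >= 2]. *)
pose N := Num.trunc (6 / (C * (x * x))).
exists (N + 2)%N => k kN.
have Cx : 0 < C * (x * x) by rewrite !mulr_gt0.
have k1 : 6 < k%:R * (C * (x * x)).
  rewrite -ltr_pdivrMr//; apply: (lt_le_trans (truncnS_gt _)).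
  by rewrite ler_nat (leq_trans _ kN)// addn2.
have k2 : 2 <= k%:R :> R by rewrite ler_nat (leq_trans _ kN)// leq_addl.
rewrite aE exprMn mulrCA [X in X < _]mulrC ltr_pM2l ?exprn_gt0//.
rewrite -(@ltr_pM2l _ 2)// mulrCA; apply: lt_le_trans (ler_wpM2l (ltW C0) (bernoulli_quadratic k (ltW x0))).
rewrite -[k.+1%:R]natr1.
have h1 : 6 * (k%:R - 1) < k%:R * (C * (x * x)) * (k%:R - 1).
  by rewrite ltr_pM2r// subr_gt0; move: k2; lra.
have h2 : 0 <= C * (2 * k%:R * x) by rewrite !mulr_ge0// ltW.
move: h1 h2 C0 k2; move: (k%:R : R) => y; lra.
Qed.

Lemma sub_half (R : realType) (V v : R) : 0 < v -> v < V -> 0 < V - v / 2 /\ V - v < V - v / 2.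
Proof. by move=> v0 vV; split; move: v0 vV; lra. Qed.

(** [T] stands for the thin caps, [S] for the thick ones. The factor on the right being [D] more
    than [k.+1], the thin caps leave the surplus [(D - th) * T1], of order at least [w ^+ k]; the
    last hypothesis makes it exceed the thick term, of order [k * b ^+ k]. *)
Lemma growth_arith (R : realType) (V M th c0 w b T0 T1 S0 S1 : R) (D k : nat) :
  0 < V -> 0 < M -> 0 < D%:R - th ->
  k.+1%:R * V * T0 <= (k.+1%:R + th) * T1 -> 2 * (w ^+ k.+1 * (c0 * M)) <= T1 ->
  S0 <= 2 * (b ^+ k * M) -> 0 <= S1 ->
  k.+1%:R * b ^+ k < (D%:R - th) * (w * c0) / V * w ^+ k ->
  k.+1%:R * V * (T0 + S0) < (D + k).+1%:R * (T1 + S1).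
Proof.
move=> V0 M0 thD g1 g2 g3 g4 hk.
have hk2 : k.+1%:R * V * (2 * (b ^+ k * M)) < (D%:R - th) * (2 * (w ^+ k.+1 * (c0 * M))).
  have := hk; rewrite -(@ltr_pM2r _ (V * (2 * M))) ?mulr_gt0//.
  have -> : (D%:R - th) * (w * c0) / V * w ^+ k * (V * (2 * M)) =
    (D%:R - th) * (2 * (w ^+ k.+1 * (c0 * M))) by rewrite exprS; field; rewrite gt_eqF.
  by have -> : k.+1%:R * b ^+ k * (V * (2 * M)) = k.+1%:R * V * (2 * (b ^+ k * M)) by ring.
have h1 := ler_wpM2l (ltW thD) g2.
have h2 : k.+1%:R * V * S0 <= k.+1%:R * V * (2 * (b ^+ k * M)).
  by rewrite ler_wpM2l// mulr_ge0// ltW.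
have h3 : 0 <= (D + k).+1%:R * S1 by rewrite mulr_ge0.
have e : (D + k).+1%:R = D%:R + k.+1%:R :> R by rewrite -natrD addnS.
rewrite !mulrDr; move: h1 h2 h3 g1 hk2; rewrite e.
move: (k.+1%:R * V * _) (w ^+ k.+1) => A W.
move: (k.+1%:R : R) (D%:R : R) => y z; move: (y * V * T0) (y * V * S0) (2 * (W * (c0 * M))) => a1 a2 a3.
lra.
Qed.

(** * Thin caps against thick caps *)

Section thin_thick.
Variables (R : realType) (m : nat).
Local Notation d := m.+1.
Local Notation D := m.+2.
Local Notation E := 'rV[R]_d.
Local Notation leb := (@lebesgue_measure R).
Variable K : set 'rV[R]_D.
Hypothesis hK : smooth_convex_body K.
Local Notation mass := (mass (isec K)).

Let mI := measurable_isec (body_measurable hK).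
Let I0 := @isec_ge0 R m K.
Let Ifin := isec_total_fin hK.
Let at_ s v0 k := admissible_thin hK s v0 k.

Lemma admissible1 : admissible (fun _ : R * E => 1 : R).
Proof. by split; [exact: measurable_cst|exists 1 => p; rewrite ler01 lexx]. Qed.

(** The scaling inequality integrated over all slopes, then divided by [kap * (1 - mu)]. *)
Lemma thin_growth (s v0 kap mu : R) k : 0 < kap -> mu < 1 ->
  (forall a : E, let Phi j := (\int[leb]_b (isec K (b, a) * (weight K a s v0 j b)%:E))%E in
    (kap%:E * (Phi k.+1 + (k.+1%:R * (1 - mu) * vol K)%:E * Phi k) <=
     (1 + kap * (k.+1%:R * (1 - mu)))%:E * Phi k.+1)%E) ->
  k.+1%:R * vol K * mass (thin K s v0 k) <=
  (k.+1%:R + (kap^-1 - 1) / (1 - mu)) * mass (thin K s v0 k.+1).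
Proof.
move=> kap0 mu1 h; have V0 := vol_gt0 hK.
set c := k.+1%:R * (1 - mu) * vol K in h; set C := 1 + kap * (k.+1%:R * (1 - mu)) in h.
have nu0 : 0 < 1 - mu by rewrite subr_gt0.
have c0 : 0 <= c by rewrite /c !mulr_ge0// ltW.
have C0 : 0 <= C by rewrite addr_ge0// !mulr_ge0// ltW.
pose a1 := at_ s v0 k.+1; pose a0 := at_ s v0 k.
pose a2 := admissibleZ c0 a0; pose a3 := admissibleD a1 a2.
pose a4 := admissibleZ (ltW kap0) a3; pose a5 := admissibleZ C0 a1.
have := @le_mass_line R d (isec K) mI I0 Ifin _ _ a4 a5.
have hl a : (\int[leb]_b (isec K (b, a) * (kap * (thin K s v0 k.+1 (b, a) + c * thin K s v0 k (b, a)))%:E) <=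
    \int[leb]_b (isec K (b, a) * (C * thin K s v0 k.+1 (b, a))%:E))%E.
  have e1 := line_massZ mI I0 a (ltW kap0) a3.
  have e2 := line_massD mI I0 a a1 a2.
  have e3 := line_massZ mI I0 a c0 a0.
  have e4 := line_massZ mI I0 a C0 a1.
  rewrite e1 e2 e3 e4; exact: h.
move=> /(_ hl) {hl}.
have -> : mass (fun p => kap * (thin K s v0 k.+1 p + c * thin K s v0 k p)) =
    kap * (mass (thin K s v0 k.+1) + c * mass (thin K s v0 k)).
  apply: etrans (massZ mI I0 Ifin (ltW kap0) a3) _; congr (_ * _).
  apply: etrans (massD mI I0 Ifin a1 a2) _; congr (_ + _).
  exact: (massZ mI I0 Ifin c0 a0).
have -> : mass (fun p => C * thin K s v0 k.+1 p) = C * mass (thin K s v0 k.+1).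
  exact: (massZ mI I0 Ifin C0 a1).
move: (mass (thin K s v0 k.+1)) (mass (thin K s v0 k)) => P1 P0 {h a0 a1 a2 a3 a4 a5}.
rewrite /c /C => h.
have e : (k.+1%:R + (kap^-1 - 1) / (1 - mu)) * P1 - k.+1%:R * vol K * P0 =
    ((1 + kap * (k.+1%:R * (1 - mu))) * P1 - kap * (P1 + k.+1%:R * (1 - mu) * vol K * P0)) /
      (kap * (1 - mu)).
  by field; rewrite !gt_eqF.
by rewrite -subr_ge0 e divr_ge0 ?subr_ge0// mulr_ge0// ltW.
Qed.

Lemma thick_decay (s v0 : R) k : v0 <= vol K ->
  mass (thick K s v0 k) <= (vol K - v0) ^+ k * mass (fun=> 1).
Proof.
move=> vv; have w0 : 0 <= (vol K - v0) ^+ k by rewrite exprn_ge0// subr_ge0.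
rewrite -(massZ mI I0 Ifin w0 admissible1).
apply: (le_mass mI I0 Ifin (admissible_thick hK s v0 k) (admissibleZ w0 admissible1)) => p.
rewrite /thick mulr1 subr_gt0; case: ltP => h; rewrite ?mulr1 ?mulr0//.
by rewrite lerXn2r ?nnegrE ?subr_ge0 ?side_fine_le// lerB// ltW.
Qed.

(** Keeping only caps of volume at most [v0 / 2] gives the base [vol K - v0 / 2], strictly larger
    than the base [vol K - v0] of [thick_decay]; hence the halved threshold. *)
Lemma thin_lower (s v0 c0 : R) k : 0 < v0 -> v0 <= vol K -> 0 <= c0 ->
  (forall a : E, (c0%:E * \int[leb]_b isec K (b, a) <=
     \int[leb]_b (isec K (b, a) * (weight K a s (v0 / 2) 0 b)%:E))%E) ->
  (vol K - v0 / 2) ^+ k * (c0 * mass (fun=> 1)) <= mass (thin K s v0 k).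
Proof.
move=> v00 vv c00 h.
have w0 : 0 <= vol K - v0 / 2 by move: v00 vv; lra.
have h1 : c0 * mass (fun=> 1) <= mass (thin K s (v0 / 2) 0).
  rewrite -(massZ mI I0 Ifin c00 admissible1).
  apply: (le_mass_line mI I0 Ifin (admissibleZ c00 admissible1) (at_ s (v0 / 2) 0)) => a.
  have e := line_massZ mI I0 a c00 admissible1.
  rewrite e; apply: le_trans (h a); rewrite lee_wpmul2l ?lee_fin//.
  by under eq_integral do rewrite mule1.
have wk : 0 <= (vol K - v0 / 2) ^+ k by exact: exprn_ge0.
apply: le_trans (ler_wpM2l wk h1) _.
rewrite -(massZ mI I0 Ifin wk (at_ s (v0 / 2) 0)).
apply: (le_mass mI I0 Ifin (admissibleZ wk (at_ s (v0 / 2) 0)) (at_ s v0 k)) => p.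
rewrite /thin /full expr0 mul1r.
have s1 := side_fine_le hK s p.
case: (leP _ (v0 / 2)) => sv; last by rewrite mulr0 mulr_ge0// exprn_ge0// subr_ge0.
have -> : fine (side K s p) <= v0.
  by apply: le_trans sv _; rewrite ler_pdivrMr// mulr2n mulrDr mulr1 lerDl ltW.
by rewrite !mulr1; apply: lerXn2r; [exact: w0|rewrite nnegrE subr_ge0|rewrite lerB].
Qed.

Lemma facet_int_growth : exists (L : nat -> R) (N : nat),
  (forall k, facet_int (D + k) K = (L k)%:E) /\
  forall k, (N <= k)%N -> k.+1%:R * vol K * L k < (D + k).+1%:R * L k.+1.
Proof.
have V0 := vol_gt0 hK; have M0 := mass1_gt0 hK.
have [v0 [kap [mu [c0 [[/andP[v00 vv] kap0 /andP[_ mu1] kapmu c00] H]]]]] := thin_caps_scaling hK.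
have H1 := fun a => H a 1 (mulr1 1).
have N11 : -1 * -1 = 1 :> R by rewrite mulrNN mulr1.
have H2 := fun a => H a (-1) N11.
pose T k := mass (thin K 1 v0 k) + mass (thin K (-1) v0 k).
pose S k := mass (thick K 1 v0 k) + mass (thick K (-1) v0 k).
pose M := mass (fun=> 1).
pose th := (kap^-1 - 1) / (1 - mu).
have thD : 0 < D%:R - th by rewrite subr_gt0 ltr_pdivrMr// subr_gt0.
pose w := vol K - v0 / 2.
have [w0 bw] : 0 < w /\ vol K - v0 < w by exact: sub_half.
have C0 : 0 < (D%:R - th) * (w * c0) / vol K by rewrite divr_gt0// !mulr_gt0.
have b0 : 0 < vol K - v0 by rewrite subr_gt0.
have [N hN] := exp_beats_linear b0 bw C0.
exists (fun k => T k + S k), N; split=> [k|k Nk].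
  apply: facet_int_split => // a b; first by have [-> _ _] := H1 a.
  by have [+ _ _] := H2 a => /(_ b); rewrite opprK.
have tg s (ss : s * s = 1) := @thin_growth s v0 kap mu k kap0 mu1
  (fun a => let: And3 _ h _ := H a s ss in h k).
have tl s (ss : s * s = 1) := @thin_lower s v0 c0 k.+1 v00 (ltW vv) (ltW c00)
  (fun a => let: And3 _ _ h := H a s ss in h).
have g1 : k.+1%:R * vol K * T k <= (k.+1%:R + th) * T k.+1.
  by rewrite /T !mulrDr; apply: lerD; apply: tg; rewrite ?mulr1.
have g2 : 2 * (w ^+ k.+1 * (c0 * M)) <= T k.+1.
  by rewrite mulr_natl mulr2n; apply: lerD; apply: tl; rewrite ?mulr1.
have g3 : S k <= 2 * ((vol K - v0) ^+ k * M).
  by rewrite mulr_natl mulr2n; apply: lerD; apply: thick_decay; exact: ltW.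
have g4 : 0 <= S k.+1.
  by apply: addr_ge0; apply: (mass_ge0 mI I0 Ifin); exact: admissible_thick.
exact: (growth_arith V0 (mass1_gt0 hK) thD g1 g2 g3 g4 (hN k Nk)).
Qed.

End thin_thick.

Lemma volumeE (R : realType) m (K : set 'rV[R]_m.+2) : smooth_convex_body K ->
  volume K = (vol K)%:E.
Proof.
move=> hK; rewrite -(vol_fin hK) (vmuE (measurable_ind_body hK))//.
Qed.

Lemma expected_fnumE (R : realType) m (K : set 'rV[R]_m.+2) n i (kappa L : R) :
  smooth_convex_body K -> (m.+2 < n)%N -> 0 <= kappa ->
  (forall X : 'I_n -> 'rV[R]_m.+2, genpos X ->
    (fnum X i)%:R = kappa * (fnum X (m.+2 - 1))%:R :> R) ->
  facet_int n K = L%:E ->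
  expected_fnum K n i = (kappa * ('C(n, m.+2)%:R * L) / vol K ^+ n)%:E.
Proof.
move=> hK Dn k0 fk LE; have V0 := vol_gt0 hK.
rewrite /expected_fnum (facet_expectation (body_measurable hK) Dn k0 fk) LE volumeE//.
by rewrite -EFin_expe inver gt_eqF ?exprn_gt0.
Qed.

Theorem theorem2 (R : realType) (d : nat) (K : set 'rV[R]_d) :
  (2 <= d)%N ->
  smooth_convex_body K ->
  exists nK : nat, forall n : nat, (0 < n)%N -> (nK <= n)%N ->
    forall i : nat, i = (d - 2)%N \/ i = (d - 1)%N ->
      (expected_fnum K n i < expected_fnum K n.+1 i)%E.
Proof.
case: d K => [|[|m]] // K _ hK; set D := m.+2.
have V0 := vol_gt0 hK.
have [L [N [LE hL]]] := facet_int_growth hK.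
(* [D.+1] ensures that there is a point off every [D]-subset, and [N] that [k = n - D] is large
   enough for the growth of [L]. *)
exists (D.+1 + N)%N => n _ nN i hi.
have [k nE] : exists k, n = (D + k)%N.
  by exists (n - D)%N; rewrite subnKC// (leq_trans _ nN)// addSn ltnW// ltnS leq_addr.
have Dn : (D < n)%N by rewrite (leq_trans _ nN)// leq_addr.
have Nk : (N <= k)%N by move: nN; rewrite nE addSn ltn_add2l => /ltnW.
have [kap kap0 hkap] : exists2 kap : R, 0 < kap & forall l (X : 'I_l -> 'rV[R]_D), (D < l)%N ->
    genpos X -> (fnum X i)%:R = kap * (fnum X (D - 1))%:R :> R.
  case: hi => ->; last by exists 1 => // *; rewrite mul1r.
  exists (D%:R / 2); first by rewrite divr_gt0.
  move=> l X Dl gX; have := @ridge_facet_count R D l X isT Dl gX.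
  move/(congr1 (fun j => j%:R : R)); rewrite !natrM => h.
  by rewrite mulrAC -h mulrC mulrA mulVf ?mul1r// pnatr_eq0.
rewrite (expected_fnumE hK Dn (ltW kap0) (fun X => hkap n X Dn) (L := L k)); last by rewrite nE.
have Dn1 : (D < n.+1)%N by exact: ltnW.
rewrite (expected_fnumE hK Dn1 (ltW kap0) (fun X => hkap n.+1 X Dn1) (L := L k.+1)); last first.
  by rewrite nE -addnS.
rewrite lte_fin exprS -!mulrA ltr_pM2l// invfM !mulrA ltr_pM2r ?invr_gt0 ?exprn_gt0//.
rewrite ltr_pdivlMr//.
(* The ratio of consecutive binomial coefficients, with [n.+1 - D = k.+1]; it reduces the comparison
   to the growth of [L]. *)
have bE : k.+1%:R * 'C(n.+1, D)%:R = n.+1%:R * 'C(n, D)%:R :> R.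
  rewrite -!natrM; congr (_%:R).
  by have /= -> := mul_bin_down n.+1 D; congr (_ * _)%N; rewrite nE -addnS addKn.
rewrite -(@ltr_pM2l _ k.+1%:R)// -/D [X in _ < X]mulrA bE.
have C0 : 0 < 'C(n, D)%:R :> R by rewrite ltr0n bin_gt0 ltnW.
have := hL k Nk; rewrite -nE -(ltr_pM2l C0).
congr (_ < _); ring.
Qed.
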